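(* Let $f\in L^1[0,\infty)$ be a function and let $\alpha,\beta\in\mathbb{C}$ be two parameters with $\mathrm{Re}(\alpha)>0$. The Mellin transform of the tempered fractional integral of $f$ can be written as $$\widehat{{}^{T}_{0}I^{(\alpha,\beta)}f}(s)=\beta^{-\alpha-s+1}\int_0^{\infty}f(u)\,e^{\beta u}\sum_{n=0}^{\infty}\frac{\Gamma(\alpha+s-n-1,\beta u)}{\Gamma(\alpha-n)}\cdot\frac{(\beta u)^n}{n!}\,du.$$
   Context: The tempered fractional integral, defined for $\mathrm{Re}(\alpha)>0$ and $\mathrm{Re}(\beta)\ge0$, is ${}^{T}_{0}I^{(\alpha,\beta)}_t f(t)=\frac{1}{\Gamma(\alpha)}\int_0^t (t-u)^{\alpha-1}e^{-\beta(t-u)}f(u)\,du$. The Mellin transform of a function $g(t)$ is the function $\widehat{g}(s)=\int_0^\infty t^{s-1}g(t)\,dt$. $\Gamma(p,z)=\int_z^\infty v^{p-1}e^{-v}\,dv$ is the upper incomplete gamma function.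
   Formalization: The printed series is false (α=2, β=s=1, f=1 on [0,1] gives 1 versus 2): (βu)^n is corrected to (-βu)^n; β≠0 is assumed, and s has 1-Re α<Re s≤1 with Re β>0, or makes the double integral of the Mellin transform absolutely convergent. *)

(* Defs.v *)
From HB Require Import structures.
From mathcomp Require Import all_boot all_order all_algebra.
From mathcomp Require Export complex.
From mathcomp Require Import all_classical all_reals all_analysis.

Set Implicit Arguments.
Unset Strict Implicit.
Unset Printing Implicit Defensive.

Import Order.TTheory GRing.Theory Num.Theory.
Import numFieldNormedType.Exports.

Local Open Scope classical_set_scope.
Local Open Scope ring_scope.
Local Open Scope complex_scope.

(** ** Elementary complex functions *)
Section ComplexElementary.
Context {R : realType}.
Implicit Types z w : R[i].

Definition cexp z : R[i] :=
  (expR (complex.Re z) * cos (complex.Im z))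
    +i* (expR (complex.Re z) * sin (complex.Im z)).

Definition cmod z : R :=
  Num.sqrt (complex.Re z ^+ 2 + complex.Im z ^+ 2).

(** Principal argument, with values in ]-pi, pi] for [z != 0]. *)
Definition carg z : R :=
  if 0 <= complex.Im z then acos (complex.Re z / cmod z)
  else - acos (complex.Re z / cmod z).

Definition clog z : R[i] := ln (cmod z) +i* carg z.

(** Principal power; [cpow 0 w] is [1] if [w = 0] and [0] otherwise, as for
    the real [powR]. *)
Definition cpow z w : R[i] :=
  if z == 0 then (w == 0)%:R else cexp (w * clog z).

End ComplexElementary.

(** ** Integrals and series of complex-valued functions

    [R[i]] carries no topology or measurable structure in the libraries, so
    both are taken on real and imaginary parts. *)
Section ComplexIntegral.
Context {d : measure_display} {T : measurableType d} {R : realType}.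
Variables (m : {measure set T -> \bar R}) (D : set T) (f : T -> R[i]).

(** Equivalent to [f] being measurable on [D] with [|f|] of finite integral. *)
Definition cintegrable : Prop :=
  m.-integrable D (fun x => (complex.Re (f x))%:E) /\
  m.-integrable D (fun x => (complex.Im (f x))%:E).

Definition cintegral : R[i] :=
  Rintegral m D (fun x => complex.Re (f x))
    +i* Rintegral m D (fun x => complex.Im (f x)).

End ComplexIntegral.

Section ComplexSeries.
Context {R : realType}.
Variable u : nat -> R[i].

Definition csummable : Prop :=
  cvgn (series (fun n => complex.Re (u n))) /\
  cvgn (series (fun n => complex.Im (u n))).

Definition csum : R[i] :=
  limn (series (fun n => complex.Re (u n)))
    +i* limn (series (fun n => complex.Im (u n))).

End ComplexSeries.

(** ** Gamma functions *)
Section GammaFunctions.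
Context {R : realType}.
Local Notation mu := (@lebesgue_measure R).
Implicit Types p z : R[i].

(** Euler's integral; this is Gamma on [Re z > 0] only. *)
Definition euler_gamma z : R[i] :=
  cintegral mu `]0, +oo[
    (fun v : R => cpow v%:C (z - 1) * cexp (- v%:C)).

(** Gamma on the complex plane: outside [Re z > 0] it is continued by
    Gamma(z) = Gamma(z + k) / (z (z + 1) ... (z + k - 1)), where
    [k = shift z] makes [Re (z + k) > 0].  At the poles 0, -1, -2, ... the
    product vanishes, so the value is [0] and [(cGamma z)^-1 = 0]; this is the
    value there of the entire function 1/Gamma. *)
Definition shift z : nat := (Num.truncn (- complex.Re z)).+1.

Definition cGamma z : R[i] :=
  if 0 < complex.Re z then euler_gamma z
  else euler_gamma (z + (shift z)%:R) / \prod_(j < shift z) (z + j%:R).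

(** The integral of v^(p-1) e^(-v) from [z] to +oo along the horizontal
    half-line z + x, x >= 0.  When [z] is not in ]-oo, 0] this half-line avoids
    the branch cut of the power and the integral is absolutely convergent for
    every [p]. *)
Definition upper_gamma p z : R[i] :=
  cintegral mu `[0, +oo[
    (fun x : R => cpow (z + x%:C) (p - 1) * cexp (- (z + x%:C))).

End GammaFunctions.

(** ** Tempered fractional integral and Mellin transform *)
Section TemperedMellin.
Context {R : realType}.
Local Notation mu := (@lebesgue_measure R).
Implicit Types (a b s : R[i]) (f g : R -> R[i]).

Definition tempered_kernel a b (v : R) : R[i] :=
  cpow v%:C (a - 1) * cexp (- (b * v%:C)).

Definition tempered_integral a b f (t : R) : R[i] :=
  (cGamma a)^-1 *
  cintegral mu `[0, t] (fun u : R => tempered_kernel a b (t - u) * f u).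

Definition mellin_integrand g s (t : R) : R[i] := cpow t%:C (s - 1) * g t.

Definition mellin g s : R[i] :=
  cintegral mu `[0, +oo[ (mellin_integrand g s).

(** The Mellin transform of the tempered integral of [f] converges absolutely
    as a double integral over 0 <= u <= t, with [x = (t, u)]. *)
Definition mellin_tempered_abs_conv a b f s : Prop :=
  cintegrable (mu \x mu)%E [set x : R * R | 0 <= x.2 <= x.1]
    (fun x : R * R =>
       cpow x.1%:C (s - 1) * (tempered_kernel a b (x.1 - x.2) * f x.2)).

(** The factor (-1)^n inside (-(b u))^n comes from the binomial expansion
    (t-u)^(a-1) = sum_n Gamma(a) / (Gamma(a-n) n!) (-u)^n t^(a-1-n).  With
    (b u)^n in its place the Mellin formula fails: for a = 2, b = s = 1 the
    series would sum to (1 + 2 u) e^(-u) instead of e^(-u). *)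
Definition series_term a b s (u : R) (n : nat) : R[i] :=
  upper_gamma (a + s - n%:R - 1) (b * u%:C) / cGamma (a - n%:R)
    * ((- (b * u%:C)) ^+ n / n`!%:R).

Definition series_integrand a b f s (u : R) : R[i] :=
  f u * cexp (b * u%:C) * csum (series_term a b s u).

End TemperedMellin.

(* Main.v *)
Require Import Defs.
From mathcomp Require Import all_boot all_order all_algebra.
From mathcomp Require Import all_classical all_reals all_analysis.
From mathcomp Require Import measurable_realfun ring lra.

(** Both sides of the formula are iterated integrals of
    [t ^ (s - 1) (t - u) ^ (alpha - 1) exp (- beta (t - u)) f u / Gamma alpha]
    over [0 < u < t].  Integrating in [u] first gives the Mellin transform of
    the tempered integral.  Integrating in [t] first leaves, for fixed [u], the
    integral over [y > 0] of
    [(u + y) ^ (s - 1) y ^ (alpha - 1) exp (- beta y)], and this has to be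
    matched with the series of incomplete gamma functions.  That takes two
    steps.

    - Rotation ([laplace_rotation]).  Turning the ray of integration from the
      direction [1] to the direction [1 / beta] replaces this integral by
      [beta ^ (1 - alpha - s)] times the integral over [x > 0] of
      [x ^ (alpha - 1) (z + x) ^ (s - 1) exp (- x)], where [z = beta u].  The
      integral along the intermediate ray has derivative zero in the direction
      parameter, because the derivative of the integrand in that parameter is
      also a derivative along the ray.  The two extreme rays are reached by
      dominated convergence; for imaginary [beta] the first of them carries no
      exponential decay.
    - Summation ([cvg_binomial_moments], [csum_series_term]).  Writing
      [x ^ (alpha - 1)] as [(z + x) ^ (alpha - 1) (1 - w) ^ (alpha - 1)] with
      [w = z / (z + x)] and expanding in powers of [w] yields the series term
      by term, since [Gamma alpha / Gamma (alpha - n)] is a falling product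
      ([invr_cGamma_subn]).  When [z] is imaginary, [|w|] is so close to [1]
      near [x = 0] that the expansion need not be absolutely integrable, so
      summation and integration are interchanged by Abel's method: insert
      [r ^ n] with [r < 1], and bound the tails uniformly in [r].  The bound
      combines an integration by parts, which gives the factor [1 / n] to the
      integral of [w ^ n] ([shift_ratio_moment_le]), with the fact that, for large
      [n], the binomial coefficients [c_n] satisfy
      [|c_n| / (n + 1) <= (2 / Re alpha) (|c_n| - |c_(n+1)|)]
      ([bincoef_telescope]).

    The interchange of the integrals in [t] and [u] is Fubini's theorem.
    Absolute convergence is either assumed or, for [Re beta > 0] and
    [1 - Re alpha < Re s <= 1], follows from Tonelli's theorem, as then
    [t ^ (Re s - 1) <= (t - u) ^ (Re s - 1)]. *)

Set Implicit Arguments.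
Unset Strict Implicit.
Unset Printing Implicit Defensive.

Import Order.TTheory GRing.Theory Num.Theory.
Import numFieldNormedType.Exports.

Local Open Scope classical_set_scope.
Local Open Scope ring_scope.
Local Open Scope complex_scope.

Local Notation Re := complex.Re.
Local Notation Im := complex.Im.

(** * Complex numbers, exponential and principal logarithm *)

Section ComplexAlgebra.
Context {R : realType}.
Implicit Types (z w : R[i]) (x y : R).

Lemma cplx_eq z w : Re z = Re w -> Im z = Im w -> z = w.
Proof. by case: z w => [a b] [c d] /= -> ->. Qed.

Lemma cReD z w : Re (z + w) = Re z + Re w. Proof. by case: z w => [a b] [c d]. Qed.
Lemma cImD z w : Im (z + w) = Im z + Im w. Proof. by case: z w => [a b] [c d]. Qed.
Lemma cReN z : Re (- z) = - Re z. Proof. by case: z. Qed.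
Lemma cImN z : Im (- z) = - Im z. Proof. by case: z. Qed.
Lemma cReM z w : Re (z * w) = Re z * Re w - Im z * Im w.
Proof. by case: z w => [a b] [c d]. Qed.
Lemma cImM z w : Im (z * w) = Re z * Im w + Im z * Re w.
Proof. by case: z w => [a b] [c d]. Qed.
Lemma cRe1 : Re (1 : R[i]) = 1. Proof. by []. Qed.
Lemma cIm1 : Im (1 : R[i]) = 0. Proof. by []. Qed.
Lemma cRe0 : Re (0 : R[i]) = 0. Proof. by []. Qed.
Lemma cIm0 : Im (0 : R[i]) = 0. Proof. by []. Qed.
Lemma cReR x : Re x%:C = x. Proof. by []. Qed.
Lemma cImR x : Im x%:C = 0. Proof. by []. Qed.
Lemma natrC n : (n%:R : R[i]) = (n%:R : R)%:C. Proof. by rewrite rmorph_nat. Qed.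
Lemma cRen n : Re (n%:R : R[i]) = n%:R. Proof. by rewrite natrC. Qed.
Lemma cImn n : Im (n%:R : R[i]) = 0. Proof. by rewrite natrC. Qed.

Definition creE := (cReD, cImD, cReN, cImN, cReM, cImM, cRe1, cIm1, cRe0, cIm0,
  cReR, cImR, cRen, cImn).

Lemma cRe_sum (I : Type) (r : seq I) (P : pred I) (F : I -> R[i]) :
  Re (\sum_(i <- r | P i) F i) = \sum_(i <- r | P i) Re (F i).
Proof. by elim/big_rec2: _ => // i x z _ <-; rewrite cReD. Qed.
Lemma cIm_sum (I : Type) (r : seq I) (P : pred I) (F : I -> R[i]) :
  Im (\sum_(i <- r | P i) F i) = \sum_(i <- r | P i) Im (F i).
Proof. by elim/big_rec2: _ => // i x z _ <-; rewrite cImD. Qed.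

Lemma cmodE z : cmod z = complex.ComplexField.Normc.normc z.
Proof. by case: z. Qed.
Lemma cmodM z w : cmod (z * w) = cmod z * cmod w.
Proof. by rewrite !cmodE complex.ComplexField.Normc.normcM. Qed.
Lemma cmodV z : cmod z^-1 = (cmod z)^-1.
Proof. by rewrite !cmodE complex.ComplexField.Normc.normcV. Qed.
Lemma cmodN z : cmod (- z) = cmod z.
Proof. by rewrite /cmod !creE !sqrrN. Qed.
Lemma ler_cmodD z w : cmod (z + w) <= cmod z + cmod w.
Proof. by rewrite !cmodE le_normcD. Qed.
Lemma cmod_ge0 z : 0 <= cmod z. Proof. exact: sqrtr_ge0. Qed.
Lemma cmod0 : cmod (0 : R[i]) = 0.
Proof. by rewrite cmodE complex.ComplexField.Normc.normc0. Qed.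
Lemma cmod_gt0 z : (0 < cmod z) = (z != 0).
Proof.
rewrite lt_def cmod_ge0 andbT; congr negb; apply/eqP/eqP => [|->]; last exact: cmod0.
by rewrite cmodE; apply: complex.ComplexField.Normc.eq0_normc.
Qed.
Lemma cmodR x : cmod x%:C = `|x|.
Proof. by rewrite /cmod /= expr0n addr0 sqrtr_sqr. Qed.
Lemma cmod1 : cmod (1 : R[i]) = 1.
Proof. by rewrite (cmodR 1) normr1. Qed.
Lemma cmod_nat n : cmod (n%:R : R[i]) = n%:R.
Proof. by rewrite natrC cmodR normr_nat. Qed.
Lemma cmodX z n : cmod (z ^+ n) = cmod z ^+ n.
Proof. by elim: n => [|n IH]; rewrite ?expr0 ?cmod1// !exprS cmodM IH. Qed.
Lemma sqr_cmod z : cmod z ^+ 2 = Re z ^+ 2 + Im z ^+ 2.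
Proof. by rewrite sqr_sqrtr// addr_ge0 ?sqr_ge0. Qed.
Lemma normRe_cmod z : `|Re z| <= cmod z.
Proof. by rewrite -sqrtr_sqr ler_wsqrtr// lerDl sqr_ge0. Qed.
Lemma normIm_cmod z : `|Im z| <= cmod z.
Proof. by rewrite -sqrtr_sqr ler_wsqrtr// lerDr sqr_ge0. Qed.
Lemma cmod_le_ReIm z : cmod z <= `|Re z| + `|Im z|.
Proof.
rewrite -(@ler_pXn2r _ 2)// ?nnegrE ?cmod_ge0 ?addr_ge0//.
rewrite sqr_cmod -(real_normK (num_real (Re z))) -(real_normK (num_real (Im z))).
have := mulr_ge0 (normr_ge0 (Re z)) (normr_ge0 (Im z)).
by nra.
Qed.
Lemma ler_cmodB z w : cmod (z - w) <= cmod z + cmod w.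
Proof. by rewrite -(cmodN w) ler_cmodD. Qed.
Lemma ler_cmod_sum (I : Type) (r : seq I) (P : pred I) (F : I -> R[i]) :
  cmod (\sum_(i <- r | P i) F i) <= \sum_(i <- r | P i) cmod (F i).
Proof.
elim/big_rec2: _ => [|i x z _ h]; first by rewrite cmod0.
by rewrite (le_trans (ler_cmodD _ _))// lerD2l.
Qed.

Lemma Re_cexp z : Re (cexp z) = expR (Re z) * cos (Im z). Proof. by []. Qed.
Lemma Im_cexp z : Im (cexp z) = expR (Re z) * sin (Im z). Proof. by []. Qed.
Lemma cexpD z w : cexp (z + w) = cexp z * cexp w.
Proof.
by apply: cplx_eq; rewrite !(creE, Re_cexp, Im_cexp) expRD ?cosD ?sinD; ring.
Qed.
Lemma cexp0 : cexp (0 : R[i]) = 1.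
Proof. by apply: cplx_eq; rewrite !(Re_cexp, Im_cexp, creE) expR0 ?cos0 ?sin0 ?mulr0 ?mulr1. Qed.
Lemma cexpR x : cexp x%:C = (expR x)%:C.
Proof. by apply: cplx_eq; rewrite !(Re_cexp, Im_cexp, creE) ?cos0 ?sin0 ?mulr0 ?mulr1. Qed.
Lemma cmod_cexp z : cmod (cexp z) = expR (Re z).
Proof.
rewrite /cmod Re_cexp Im_cexp !exprMn -mulrDr cos2Dsin2 mulr1 sqrtr_sqr ger0_norm ?expR_ge0//.
Qed.
Lemma cexp_neq0 z : cexp z != 0.
Proof. by rewrite -cmod_gt0 cmod_cexp expR_gt0. Qed.
Lemma cexpN z : cexp (- z) = (cexp z)^-1.
Proof.
apply: (mulIf (cexp_neq0 z)).
by rewrite mulVf ?cexp_neq0// -cexpD addNr cexp0.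
Qed.
Lemma cexpB z w : cexp (z - w) = cexp z / cexp w.
Proof. by rewrite cexpD cexpN. Qed.
Lemma cexp_natM n z : cexp (n%:R * z) = cexp z ^+ n.
Proof.
elim: n => [|n IH]; first by rewrite mul0r cexp0 expr0.
by rewrite exprS -IH -cexpD; congr cexp; rewrite mulrS mulrDl mul1r.
Qed.

(** Injectivity of the exponential on a period strip identifies the principal
    logarithm, which makes its functional equations a matter of comparing
    imaginary parts. *)
Lemma clog_uniq z l : cexp l = z -> - pi < Im l <= pi -> clog z = l.
Proof.
move=> <-{z} /andP[l1 l2]; rewrite /clog cmod_cexp expRK.
apply: cplx_eq => //=.
have e0 : 0 < expR (Re l) by exact: expR_gt0.
rewrite /carg cmod_cexp Re_cexp Im_cexp mulrAC mulfV ?gt_eqF// mul1r pmulr_rge0//.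
have [l0|l0] := leP 0 (Im l).
  have -> : 0 <= sin (Im l) by rewrite sin_ge0_pi// l0 l2.
  by rewrite cosK// in_itv/= l0 l2.
have -> : (0 <= sin (Im l)) = false.
  apply/negbTE; rewrite -ltNge -oppr_gt0 -sinN sin_gt0_pi// ltrNl l1.
  by rewrite ltrNr oppr0 l0.
rewrite -cosN cosK ?opprK// in_itv/= oppr_ge0 (ltW l0)/=.
by rewrite lerNl ltW.
Qed.

Lemma cexp_clog z : z != 0 -> cexp (clog z) = z.
Proof.
rewrite -cmod_gt0 => z0.
have m2 : (Re z / cmod z) ^+ 2 + (Im z / cmod z) ^+ 2 = 1.
  by rewrite !expr_div_n -mulrDl -sqr_cmod mulfV// expf_neq0 ?gt_eqF.
have mr : -1 <= Re z / cmod z <= 1.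
  rewrite -ler_norml -(@ler_pXn2r _ 2)// ?nnegrE// real_normK ?num_real// expr1n.
  by rewrite -m2 lerDl sqr_ge0.
have ca : cos (carg z) = Re z / cmod z.
  by rewrite /carg; case: ifP => _; rewrite ?cosN acosK.
have sa : sin (carg z) = Im z / cmod z.
  have e : Num.sqrt (1 - (Re z / cmod z) ^+ 2) = `|Im z| / cmod z.
    rewrite -m2 addrAC subrr add0r sqrtr_sqr normrM normfV.
    by rewrite (ger0_norm (ltW z0)).
  rewrite /carg; case: ifPn => [i0|]; rewrite ?sinN sin_acos// e.
    by rewrite ger0_norm.
  by rewrite -ltNge => i0; rewrite ltr0_norm// mulNr opprK.
apply: cplx_eq; rewrite /clog ?Re_cexp ?Im_cexp /= lnK ?posrE// ?ca ?sa mulrC mulfVK//; exact: lt0r_neq0.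
Qed.

Lemma Re_clog z : Re (clog z) = ln (cmod z). Proof. by []. Qed.
Lemma Im_clog z : Im (clog z) = carg z. Proof. by []. Qed.

Lemma carg_atan z : 0 < Re z -> carg z = atan (Im z / Re z).
Proof.
move=> z0; have zn0 : z != 0 by apply: contraTneq z0 => ->; rewrite ltxx.
set t := Im z / Re z.
have a1 := atan_gtNpi2 t; have a2 := atan_ltpi2 t; have p0 := pi_gt0 R.
suff e : clog z = ln (cmod z) +i* atan t by rewrite -Im_clog e.
apply: clog_uniq => /=; last by apply/andP; split; lra.
have s0 : 0 < Num.sqrt (1 + t ^+ 2) by rewrite sqrtr_gt0 ltr_pwDl// sqr_ge0.
have cz : cmod z = Re z * Num.sqrt (1 + t ^+ 2).
  rewrite -[X in X * _]ger0_norm ?ltW// -sqrtr_sqr -sqrtrM ?sqr_ge0// mulrDr mulr1.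
  by rewrite -exprMn /t mulrC mulfVK// gt_eqF.
have c0 : 0 < cos (atan t) by rewrite cos_atan invr_gt0.
have st : sin (atan t) = t * cos (atan t).
  by rewrite -{2}(atanK t) /tan mulfVK// gt_eqF.
apply: cplx_eq; rewrite ?Re_cexp ?Im_cexp /= lnK ?posrE ?cmod_gt0// ?st cos_atan cz.
  by rewrite mulfK// gt_eqF.
rewrite -mulrA (mulrCA _ t) mulfV ?gt_eqF// mulr1 mulrC mulfVK// gt_eqF//.
Qed.

Lemma carg_half z : 0 < Re z -> - (pi / 2) < carg z < pi / 2.
Proof. by move=> /carg_atan ->; rewrite atan_gtNpi2 atan_ltpi2. Qed.

Lemma carg_halfW z : 0 <= Re z -> - (pi / 2) <= carg z <= pi / 2.
Proof.
rewrite le_eqVlt => /predU1P[z0|/carg_half/andP[/ltW-> /ltW->]//].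
have p0 := pi_gt0 R.
by rewrite /carg -z0 mul0r acos0; case: ifP => _; apply/andP; split; lra.
Qed.

(** The arguments lie in [-pi/2, pi/2], one of them strictly inside, so that
    their difference stays in the range ]-pi, pi] of the principal argument. *)
Lemma clog_div z w : 0 < Re z -> 0 <= Re w -> w != 0 ->
  clog (z / w) = clog z - clog w.
Proof.
move=> z0 w0 wn0; have zn0 : z != 0 by apply: contraTneq z0 => ->; rewrite ltxx.
apply: clog_uniq; first by rewrite cexpB !cexp_clog.
rewrite !creE !Im_clog.
by have /andP[? ?] := carg_half z0; have /andP[? ?] := carg_halfW w0; apply/andP; split; lra.
Qed.

Lemma clogR x : 0 < x -> clog x%:C = (ln x)%:C.
Proof.
move=> x0; apply: clog_uniq; first by rewrite cexpR lnK.
by have p0 := pi_gt0 R; rewrite !creE; apply/andP; split; lra.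
Qed.

Lemma clog1 : clog (1 : R[i]) = 0.
Proof. by rewrite (clogR (@ltr01 R)) ln1. Qed.

Lemma cpowE z w : z != 0 -> cpow z w = cexp (w * clog z).
Proof. by rewrite /cpow => /negbTE ->. Qed.

Lemma cpowR x w : 0 < x -> cpow x%:C w = cexp (w * (ln x)%:C).
Proof.
move=> x0; rewrite cpowE ?clogR//.
by apply: contraTneq x0 => -[->]; rewrite ltxx.
Qed.

End ComplexAlgebra.

(** * Differentiation along a real parameter *)

Section ComplexDerivative.
Context {R : realType}.
Implicit Types (f g : R -> R) (F G : R -> R[i]) (x : R).

Lemma is_deriveD_fun f g x a b : is_derive x 1 f a -> is_derive x 1 g b ->
  is_derive x 1 (fun t => f t + g t) (a + b).
Proof. by move=> hf hg; exact: is_deriveD. Qed.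
Lemma is_deriveB_fun f g x a b : is_derive x 1 f a -> is_derive x 1 g b ->
  is_derive x 1 (fun t => f t - g t) (a - b).
Proof. by move=> hf hg; exact: is_deriveB. Qed.
Lemma is_deriveM_fun f g x a b : is_derive x 1 f a -> is_derive x 1 g b ->
  is_derive x 1 (fun t => f t * g t) (a * g x + f x * b).
Proof.
move=> hf hg; apply: (@is_derive_eq _ _ _ (f * g)).
by rewrite addrC; congr (_ + _); rewrite mulrC.
Qed.
Lemma is_derive_comp_fun f g x a b : is_derive x 1 g b -> is_derive (g x) 1 f a ->
  is_derive x 1 (fun t => f (g t)) (a * b).
Proof. by move=> hg hf; exact: (@is_derive1_comp _ f g). Qed.
Lemma is_deriveV_fun f x a : is_derive x 1 f a -> f x != 0 ->
  is_derive x 1 (fun t => (f t)^-1) (- (f x) ^- 2 * a).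
Proof. by move=> hf fx; exact: (is_deriveV fx). Qed.
Lemma is_derive_eqv f x a b : is_derive x 1 f a -> a = b -> is_derive x 1 f b.
Proof. by move=> h <-. Qed.

Lemma is_deriveMr_fun f x a c : is_derive x 1 f a ->
  is_derive x 1 (fun t => f t * c) (a * c).
Proof.
move=> h; apply: is_derive_eqv (is_deriveM_fun h (is_derive_cst c x 1)) _.
by rewrite mulr0 addr0.
Qed.

Lemma is_derive_continuous f x a : is_derive x 1 f a -> {for x, continuous f}.
Proof. by case=> d _; exact/differentiable_continuous/derivable1_diffP. Qed.

(** Only real parameters are differentiated: the integrands are treated as
    curves in the plane, and their analyticity enters through the chain rule
    for [cexp] and [clog]. *)
Definition is_cderive F x (d : R[i]) : Prop :=
  is_derive x (1 : R) (fun t => Re (F t)) (Re d) /\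
  is_derive x (1 : R) (fun t => Im (F t)) (Im d).

Lemma is_cderive_eq F x d d' : is_cderive F x d -> d = d' -> is_cderive F x d'.
Proof. by move=> h <-. Qed.

Lemma is_cderive_cst (c : R[i]) x : is_cderive (fun=> c) x 0.
Proof. by split; exact: is_derive_cst. Qed.

Lemma is_cderive_real f x a :
  is_derive x 1 f a -> is_cderive (fun t => (f t)%:C) x a%:C.
Proof. by move=> h; split => //=; exact: is_derive_cst. Qed.

Lemma is_cderive_id x : is_cderive (fun t => t%:C) x 1.
Proof. exact/(is_cderive_real (is_derive_id _ _)). Qed.

Lemma is_cderiveD F G x a b : is_cderive F x a -> is_cderive G x b ->
  is_cderive (fun t => F t + G t) x (a + b).
Proof.
move=> [fr fi] [gr gi]; split.
  by under eq_fun do rewrite cReD; rewrite cReD; exact: is_deriveD_fun.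
by under eq_fun do rewrite cImD; rewrite cImD; exact: is_deriveD_fun.
Qed.

Lemma is_cderiveM F G x a b : is_cderive F x a -> is_cderive G x b ->
  is_cderive (fun t => F t * G t) x (a * G x + F x * b).
Proof.
move=> [fr fi] [gr gi]; split.
  under eq_fun do rewrite cReM.
  apply: is_derive_eqv (is_deriveB_fun (is_deriveM_fun fr gr) (is_deriveM_fun fi gi)) _.
  by rewrite !creE; ring.
under eq_fun do rewrite cImM.
apply: is_derive_eqv (is_deriveD_fun (is_deriveM_fun fr gi) (is_deriveM_fun fi gr)) _.
  by rewrite !creE; ring.
Qed.

Lemma is_cderiveZ (c : R[i]) F x a : is_cderive F x a ->
  is_cderive (fun t => c * F t) x (c * a).
Proof.
move=> h; apply: is_cderive_eq (is_cderiveM (is_cderive_cst c x) h) _.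
by rewrite mul0r add0r.
Qed.

Lemma is_cderiveN F x a : is_cderive F x a -> is_cderive (fun t => - F t) x (- a).
Proof.
move=> h; rewrite -[- a]mulN1r; under eq_fun do rewrite -mulN1r.
exact: is_cderiveZ.
Qed.

Lemma is_cderiveB F G x a b : is_cderive F x a -> is_cderive G x b ->
  is_cderive (fun t => F t - G t) x (a - b).
Proof. by move=> hF hG; apply: is_cderiveD => //; exact: is_cderiveN. Qed.

Lemma is_cderiveX n F x a : is_cderive F x a ->
  is_cderive (fun t => F t ^+ n) x (n%:R * F x ^+ n.-1 * a).
Proof.
move=> h; elim: n => [|n IH].
  by under eq_fun do rewrite expr0; rewrite mul0r mul0r; exact: is_cderive_cst.
under eq_fun do rewrite exprS.
apply: is_cderive_eq (is_cderiveM h IH) _; rewrite -natr1 /=.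
case: n {IH} => [|n] /=; first by rewrite expr0; ring.
by rewrite exprS; ring.
Qed.

Lemma is_cderive_cexp F x a : is_cderive F x a ->
  is_cderive (fun t => cexp (F t)) x (cexp (F x) * a).
Proof.
move=> [fr fi]; have e := is_derive_comp_fun fr (is_derive_expR (Re (F x))).
have c := is_derive_comp_fun fi (is_derive_cos (Im (F x))).
have s := is_derive_comp_fun fi (is_derive_sin (Im (F x))).
split; under eq_fun do rewrite ?Re_cexp ?Im_cexp.
  apply: is_derive_eqv (is_deriveM_fun e c) _.
  by rewrite cReM Re_cexp Im_cexp; ring.
apply: is_derive_eqv (is_deriveM_fun e s) _.
by rewrite cImM Re_cexp Im_cexp; ring.
Qed.

Lemma Re_cinv (z : R[i]) : Re z^-1 = Re z * (Re z ^+ 2 + Im z ^+ 2)^-1.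
Proof. by case: z. Qed.
Lemma Im_cinv (z : R[i]) : Im z^-1 = - Im z * (Re z ^+ 2 + Im z ^+ 2)^-1.
Proof. by case: z => a b /=; rewrite mulNr. Qed.

Lemma sqr_cmod_neq0 (z : R[i]) : z != 0 -> Re z ^+ 2 + Im z ^+ 2 != 0.
Proof. by rewrite -sqr_cmod expf_eq0 /= -cmod_gt0; apply: lt0r_neq0. Qed.

Lemma is_derive_sqr_cmod F x a : is_cderive F x a ->
  is_derive x 1 (fun t => Re (F t) ^+ 2 + Im (F t) ^+ 2)
    (2 * (Re (F x) * Re a + Im (F x) * Im a)).
Proof.
move=> [fr fi]; apply: is_derive_eqv (is_deriveD_fun (is_deriveM_fun fr fr) (is_deriveM_fun fi fi)) _.
  by ring.
Qed.

Lemma is_cderiveV F x a : F x != 0 -> is_cderive F x a ->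
  is_cderive (fun t => (F t)^-1) x (- a / F x ^+ 2).
Proof.
move=> F0 h; have [fr fi] := h.
have n0 := sqr_cmod_neq0 F0.
rewrite expr2 invfM mulrA.
have q := is_deriveV_fun (is_derive_sqr_cmod h) n0.
have fiN : is_derive x (1 : R) (fun t => - Im (F t)) (- Im a) by exact: is_deriveN.
split.
  under eq_fun do rewrite Re_cinv.
  apply: is_derive_eqv (is_deriveM_fun fr q) _.
  by rewrite !(creE, Re_cinv, Im_cinv); field.
under eq_fun do rewrite Im_cinv.
apply: is_derive_eqv (is_deriveM_fun fiN q) _.
by rewrite !(creE, Re_cinv, Im_cinv); field.
Qed.

Lemma ln_sqrt_half (q : R) : 0 < q -> ln (Num.sqrt q) = ln q / 2.
Proof.
move=> q0; have := @lnXn _ 2 (Num.sqrt q).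
rewrite sqrtr_gt0 => /(_ q0); rewrite sqr_sqrtr ?ltW// => ->.
by rewrite mulr2n; field.
Qed.

Lemma is_cderive_continuous F x a : is_cderive F x a ->
  {for x, continuous (fun t => Re (F t))} /\ {for x, continuous (fun t => Im (F t))}.
Proof. by case=> /is_derive_continuous ? /is_derive_continuous. Qed.

(** Near a point of the open right half-plane the principal argument is the
    arctangent of the slope. *)
Lemma is_cderive_clog F x a : 0 < Re (F x) -> is_cderive F x a ->
  is_cderive (fun t => clog (F t)) x (a / F x).
Proof.
move=> F0 h; have [fr fi] := h; have [cr _] := is_cderive_continuous h.
have Fn0 : F x != 0 by apply: contraTneq F0 => ->; rewrite ltxx.
have n0 := sqr_cmod_neq0 Fn0.
have q0 : 0 < Re (F x) ^+ 2 + Im (F x) ^+ 2.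
  by rewrite lt_def n0 addr_ge0 ?sqr_ge0.
have npos : \near x, 0 < Re (F x) by exact: (cvgr_gt _ cr).
split.
  apply: (@near_eq_is_derive _ _ _
    (fun t => ln (Re (F t) ^+ 2 + Im (F t) ^+ 2) * 2^-1)).
    near=> t; rewrite Re_clog /cmod ln_sqrt_half// ltr_pwDl ?sqr_ge0// exprn_gt0//.
    by near: t.
  have l := is_derive_comp_fun (is_derive_sqr_cmod h) (is_derive1_ln q0).
  apply: is_derive_eqv (is_deriveMr_fun 2^-1 l) _.
  by rewrite cReM Re_cinv Im_cinv; field.
apply: (@near_eq_is_derive _ _ _ (fun t => atan (Im (F t) * (Re (F t))^-1))).
  by near=> t; rewrite Im_clog carg_atan//; near: t.
have i := is_deriveM_fun fi (is_deriveV_fun fr (lt0r_neq0 F0)).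
apply: is_derive_eqv (is_derive_comp_fun i (is_derive1_atan _)) _.
rewrite cImM Re_cinv Im_cinv; field.
by rewrite n0 lt0r_neq0.
Unshelve. all: by end_near. Qed.

Lemma is_cderive_ln x : 0 < x -> is_cderive (fun t => (ln t)%:C) x (x%:C)^-1.
Proof.
move=> x0; rewrite -fmorphV; apply: is_cderive_real; exact: is_derive1_ln.
Qed.
End ComplexDerivative.

(** * Integrals of complex-valued functions *)

Section ComplexIntegration.
Context {d : measure_display} {T : measurableType d} {R : realType}.
Implicit Types (D : set T) (f g : T -> R[i]) (h : T -> R).

Definition cmeasurable D f : Prop :=
  measurable_fun D (fun x => Re (f x)) /\ measurable_fun D (fun x => Im (f x)).

Lemma cmeasurable_real D h : measurable_fun D h -> cmeasurable D (fun x => (h x)%:C).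
Proof. by move=> mh; split => //; exact: measurable_cst. Qed.

Lemma cmeasurable_cst D (c : R[i]) : cmeasurable D (fun=> c).
Proof. by split; exact: measurable_cst. Qed.

Lemma cmeasurableD D f g : cmeasurable D f -> cmeasurable D g ->
  cmeasurable D (fun x => f x + g x).
Proof.
move=> [fr fi] [gr gi]; split.
  by under eq_fun do rewrite cReD; exact: measurable_funD.
by under eq_fun do rewrite cImD; exact: measurable_funD.
Qed.

Lemma cmeasurableM D f g : cmeasurable D f -> cmeasurable D g ->
  cmeasurable D (fun x => f x * g x).
Proof.
move=> [fr fi] [gr gi]; split.
  by under eq_fun do rewrite cReM; apply: measurable_funB; exact: measurable_funM.
by under eq_fun do rewrite cImM; apply: measurable_funD; exact: measurable_funM.
Qed.

Lemma cmeasurableN D f : cmeasurable D f -> cmeasurable D (fun x => - f x).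
Proof.
move=> mf; under eq_fun do rewrite -mulN1r.
exact/cmeasurableM/mf/cmeasurable_cst.
Qed.

Lemma cmeasurable_cexp D f : cmeasurable D f -> cmeasurable D (fun x => cexp (f x)).
Proof.
move=> [fr fi].
have e := measurableT_comp (@measurable_expR R) fr.
have c := measurableT_comp (continuous_measurable_fun (@continuous_cos R)) fi.
have s := measurableT_comp (continuous_measurable_fun (@continuous_sin R)) fi.
by split; [exact: measurable_funM e c|exact: measurable_funM e s].
Qed.

Lemma measurable_cmod D f : cmeasurable D f -> measurable_fun D (fun x => cmod (f x)).
Proof.
move=> [fr fi]; rewrite /cmod.
apply: (measurableT_comp (continuous_measurable_fun (@sqrt_continuous R))).
by apply: measurable_funD; exact: measurable_funX.
Qed.

Lemma eq_cmeasurable D f g : (forall x, D x -> f x = g x) ->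
  cmeasurable D f -> cmeasurable D g.
Proof.
by move=> fg [fr fi]; split; [apply: eq_measurable_fun fr|apply: eq_measurable_fun fi] => x /set_mem Dx; rewrite fg.
Qed.

Lemma cmeasurableS D E f : measurable E -> D `<=` E -> cmeasurable E f -> cmeasurable D f.
Proof. by move=> mE DE [fr fi]; split; exact: measurable_funS mE DE _. Qed.

Variable m : {measure set T -> \bar R}.

Lemma cintegrable_measurable D f : cintegrable m D f -> cmeasurable D f.
Proof. by case=> /measurable_int/measurable_EFinP ? /measurable_int/measurable_EFinP. Qed.

Lemma cintegrable_le D f h : measurable D -> cmeasurable D f ->
  m.-integrable D (EFin \o h) -> (forall x, D x -> cmod (f x) <= h x) ->
  cintegrable m D f.
Proof.
move=> mD [fr fi] ih le; split; apply: (le_integrable mD _ _ ih);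
  try exact/measurable_EFinP; move=> x Dx /=; rewrite lee_fin;
  apply: le_trans (ler_norm _); apply: le_trans (le _ Dx).
- exact: normRe_cmod.
- exact: normIm_cmod.
Qed.

Lemma integrable_cmod D f : measurable D -> cintegrable m D f ->
  m.-integrable D (EFin \o (fun x => cmod (f x))).
Proof.
move=> mD fi; have mf := cintegrable_measurable fi; case: fi => fr fi.
have ii := integrableD mD (integrable_abse fr) (integrable_abse fi).
apply: (le_integrable mD _ _ ii).
  exact/measurable_EFinP/measurable_cmod.
move=> x Dx /=; rewrite lee_fin ger0_norm ?cmod_ge0//.
by apply: le_trans (ler_norm _); exact: cmod_le_ReIm.
Qed.

Lemma eq_cintegral D f g : (forall x, D x -> f x = g x) ->
  cintegral m D f = cintegral m D g.
Proof.
by move=> fg; rewrite /cintegral; congr (_ +i* _); apply: eq_Rintegral => x /set_mem Dx; rewrite fg.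
Qed.

Lemma eq_cintegrable D f g : measurable D -> (forall x, D x -> f x = g x) ->
  cintegrable m D f -> cintegrable m D g.
Proof.
by move=> mD fg [fr fi]; split; [apply: eq_integrable fr|apply: eq_integrable fi] => // x /set_mem Dx; rewrite /= fg.
Qed.

Lemma cintegrableD D f g : measurable D -> cintegrable m D f -> cintegrable m D g ->
  cintegrable m D (fun x => f x + g x).
Proof.
move=> mD [fr fi] [gr gi]; split.
  by apply: eq_integrable (integrableD mD fr gr) => // x _; rewrite cReD.
by apply: eq_integrable (integrableD mD fi gi) => // x _; rewrite cImD.
Qed.

Lemma cintegralD D f g : measurable D -> cintegrable m D f -> cintegrable m D g ->
  cintegral m D (fun x => f x + g x) = cintegral m D f + cintegral m D g.
Proof.
move=> mD [fr fi] [gr gi]; apply: cplx_eq => /=; rewrite -RintegralD//;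
  apply: eq_Rintegral => x _; by rewrite ?cReD ?cImD.
Qed.

Lemma cintegrableZ D (c : R[i]) f : measurable D -> cintegrable m D f ->
  cintegrable m D (fun x => c * f x).
Proof.
move=> mD [fr fi]; split.
  apply: eq_integrable (integrableB mD (integrableZl mD (Re c) fr) (integrableZl mD (Im c) fi)) => //.
  by move=> x _ /=; rewrite cReM EFinB !EFinM.
apply: eq_integrable (integrableD mD (integrableZl mD (Re c) fi) (integrableZl mD (Im c) fr)) => //.
by move=> x _ /=; rewrite cImM EFinD !EFinM.
Qed.

Lemma cintegralZ D (c : R[i]) f : measurable D -> cintegrable m D f ->
  cintegral m D (fun x => c * f x) = c * cintegral m D f.
Proof.
move=> mD [fr fi].
have z k h : m.-integrable D (EFin \o h) -> m.-integrable D (EFin \o (fun x => k * h x)).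
  move=> ih; apply: eq_integrable (integrableZl mD k ih) => //.
apply: cplx_eq; rewrite /cintegral ?cReM ?cImM /=.
  rewrite -!RintegralZl// -RintegralB//; try exact: z.
  by apply: eq_Rintegral => x _; rewrite cReM.
rewrite -!RintegralZl// -RintegralD//; try exact: z.
by apply: eq_Rintegral => x _; rewrite cImM.
Qed.

Lemma cintegrable0 D : measurable D -> cintegrable m D (fun=> 0).
Proof. by move=> mD; split; exact: integrable0. Qed.

Lemma cintegral0 D : cintegral m D (fun=> 0) = 0.
Proof.
by apply: cplx_eq; rewrite /cintegral /Rintegral /= integral0.
Qed.

Lemma cintegrable_sum D (n : nat) (F : nat -> T -> R[i]) : measurable D ->
  (forall i, cintegrable m D (F i)) ->
  cintegrable m D (fun x => \sum_(i < n) F i x).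
Proof.
move=> mD iF; elim: n => [|n IH].
  by under eq_fun do rewrite big_ord0; exact: cintegrable0.
under eq_fun do rewrite big_ord_recr /=.
exact: cintegrableD.
Qed.

Lemma cintegral_sum D (n : nat) (F : nat -> T -> R[i]) : measurable D ->
  (forall i, cintegrable m D (F i)) ->
  cintegral m D (fun x => \sum_(i < n) F i x) = \sum_(i < n) cintegral m D (F i).
Proof.
move=> mD iF; elim: n => [|n IH].
  by under eq_fun do rewrite big_ord0; rewrite big_ord0 cintegral0.
under eq_fun do rewrite big_ord_recr /=.
rewrite big_ord_recr /= -IH; apply: cintegralD => //.
exact: cintegrable_sum.
Qed.

Lemma cmod_cintegral_le D f h : measurable D -> cintegrable m D f ->
  m.-integrable D (EFin \o h) -> (forall x, D x -> cmod (f x) <= h x) ->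
  cmod (cintegral m D f) <= 2 * Rintegral m D h.
Proof.
move=> mD [fr fi] ih le; apply: le_trans (cmod_le_ReIm _) _; rewrite mulr2n mulrDl mul1r.
have aux k : m.-integrable D (EFin \o k) -> (forall x, D x -> `|k x| <= h x) ->
    `|Rintegral m D k| <= Rintegral m D h.
  move=> ik kh; apply: le_trans (le_normr_Rintegral mD ik) _.
  apply: le_Rintegral => //; exact: (integrable_abse ik).
apply: lerD; apply: aux => // x Dx; apply: le_trans (le _ Dx).
- exact: normRe_cmod.
- exact: normIm_cmod.
Qed.

Definition ccvg (u : nat -> R[i]) (l : R[i]) : Prop :=
  Re (u n) @[n --> \oo] --> Re l /\ Im (u n) @[n --> \oo] --> Im l.

Lemma dominated_cvg_cintegral D (F : nat -> T -> R[i]) f h : measurable D ->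
  (forall n, cmeasurable D (F n)) ->
  m.-integrable D (EFin \o h) ->
  (forall n x, D x -> cmod (F n x) <= h x) ->
  (forall x, D x -> ccvg (F ^~ x) (f x)) ->
  cintegrable m D f /\
  ccvg (fun n => cintegral m D (F n)) (cintegral m D f).
Proof.
move=> mD mF ih le cv.
have aux (G : nat -> T -> R) (g : T -> R) : (forall n, measurable_fun D (G n)) ->
    (forall n x, D x -> `|G n x| <= h x) ->
    (forall x, D x -> G n x @[n --> \oo] --> g x) ->
    m.-integrable D (EFin \o g) /\ Rintegral m D (G n) @[n --> \oo] --> Rintegral m D g.
  move=> mG leG cvG.
  have mg : measurable_fun D g by apply: measurable_fun_cvg mG cvG.
  have [] := @dominated_convergence _ _ _ m D mD (fun n x => (G n x)%:E) (EFin \o g) (EFin \o h).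
  - by move=> n; exact/measurable_EFinP.
  - exact/measurable_EFinP.
  - by apply: aeW => x Dx; apply: cvg_EFin; [exact: nearW|exact: cvG].
  - by [].
  - by apply: aeW => x n Dx; rewrite /= lee_fin leG.
  move=> ig _ lim; split=> //; apply: fine_cvg; rewrite fineK//.
  exact: integrable_fin_num.
have [ir lr] : m.-integrable D (EFin \o (fun x => Re (f x))) /\
    Rintegral m D (fun x => Re (F n x)) @[n --> \oo] --> Rintegral m D (fun x => Re (f x)).
  apply: aux => [n|n x Dx|x Dx]; [exact: (mF n).1| |exact: (cv x Dx).1].
  by apply: le_trans (le n x Dx); exact: normRe_cmod.
have [ii li] : m.-integrable D (EFin \o (fun x => Im (f x))) /\
    Rintegral m D (fun x => Im (F n x)) @[n --> \oo] --> Rintegral m D (fun x => Im (f x)).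
  apply: aux => [n|n x Dx|x Dx]; [exact: (mF n).2| |exact: (cv x Dx).2].
  by apply: le_trans (le n x Dx); exact: normIm_cmod.
by [].
Qed.
End ComplexIntegration.

(** * Integrals over the positive half-line *)

Section HalfLine.
Context {R : realType}.
Local Notation mu := (@lebesgue_measure R).
Local Notation P := (`](0 : R), +oo[%classic : set (measurableTypeR R)).
Implicit Types (f g : R -> R) (F G : R -> R[i]).

Lemma measurable_halfline f : (forall x : R, 0 < x -> {for x, continuous f}) ->
  measurable_fun P f.
Proof.
move=> cf; apply: open_continuous_measurable_fun; first exact: interval_open.
by move=> x; rewrite inE/= in_itv/= andbT; exact: cf.
Qed.

Lemma cmeasurable_halfline F : (forall x : R, 0 < x -> exists d, is_cderive F x d) ->
  cmeasurable P F.
Proof.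
move=> dF; split; apply: measurable_halfline => x /dF[d] /is_cderive_continuous [] //.
Qed.

Lemma FTC_segment g g' (a b : R) : 0 < a -> a < b ->
  (forall x : R, 0 < x -> is_derive x (1 : R) g (g' x)) ->
  (forall x : R, 0 < x -> {for x, continuous g'}) ->
  (\int[mu]_(x in `[a, b]) (g' x)%:E = (g b)%:E - (g a)%:E)%E.
Proof.
move=> a0 ab dg cg; have b0 : 0 < b by exact: lt_trans ab.
have cg0 x : 0 < x -> {for x, continuous g} by move=> x0; exact: is_derive_continuous (dg _ x0).
apply: continuous_FTC2 => //.
- apply: continuous_in_subspaceT => x; rewrite inE/= in_itv/= => /andP[ax _].
  exact/cg/(lt_le_trans a0).
- split.
  + move=> x; rewrite in_itv/= => /andP[ax _].
    by have [] := dg _ (lt_trans a0 ax).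
  + exact/cvg_at_right_filter/cg0.
  + exact/cvg_at_left_filter/cg0.
- move=> x; rewrite in_itv/= => /andP[ax _]; rewrite derive1E.
  by have [] := dg _ (lt_trans a0 ax).
Qed.

Let b_ k : R := k.+2%:R.
Let S_ k : set R := `[(b_ k)^-1, b_ k]%classic.

Let b_gt1 k : 1 < b_ k. Proof. by rewrite ltr1n. Qed.
Let b_gt0 k : 0 < b_ k. Proof. by rewrite (lt_trans ltr01). Qed.
Let bV_gt0 k : 0 < (b_ k)^-1. Proof. by rewrite invr_gt0. Qed.
Let bV_lt k : (b_ k)^-1 < b_ k.
Proof. by rewrite (lt_trans _ (b_gt1 k))// invf_lt1. Qed.

Let S_sub k : S_ k `<=` P.
Proof. by move=> x /=; rewrite !in_itv/= andbT => /andP[h _]; exact: lt_le_trans (bV_gt0 k) h. Qed.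

Let S_near x : 0 < x -> \forall k \near \oo, S_ k x.
Proof.
move=> x0.
have h1 : \forall k \near \oo, x <= b_ k.
  near=> k; apply: (@le_trans _ _ k%:R); last by rewrite ler_nat ltnW.
  by near: k; exact: nbhs_infty_ger.
have h2 : \forall k \near \oo, x^-1 <= b_ k.
  near=> k; apply: (@le_trans _ _ k%:R); last by rewrite ler_nat ltnW.
  by near: k; exact: nbhs_infty_ger.
near=> k; rewrite /S_ /= in_itv/=; apply/andP; split; last by near: k.
rewrite -[leRHS]invrK lef_pV2 ?posrE ?invr_gt0//; by near: k.
Unshelve. all: by end_near. Qed.

(** The integral over ]0, oo[ is the limit of those over [1/k, k]: boundary
    values need not exist, only the increments of [g] along that exhaustion. *)
Lemma improper_FTC g g' :
  (forall x : R, 0 < x -> is_derive x (1 : R) g (g' x)) ->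
  (forall x : R, 0 < x -> {for x, continuous g'}) ->
  mu.-integrable P (EFin \o g') ->
  g k.+2%:R - g (k.+2%:R)^-1 @[k --> \oo] --> Rintegral mu P g'.
Proof.
move=> dg cg ig.
have e k : g k.+2%:R - g (k.+2%:R)^-1 = Rintegral mu P (g' \_ (S_ k)).
  rewrite -Rintegral_mkcondr setIC.
  have -> : S_ k `&` P = S_ k by apply/setIidPl; exact: S_sub.
  by rewrite /Rintegral (FTC_segment (bV_gt0 k) (bV_lt k) dg cg).
under eq_fun do rewrite e.
have mg' : measurable_fun P g' by exact: measurable_halfline.
apply: fine_cvg; rewrite fineK; last exact: integrable_fin_num.
apply: (@dominated_cvg _ _ _ mu P _ (fun k x => ((g' \_ (S_ k)) x)%:E) (EFin \o g')
  (abse \o (EFin \o g'))) => //.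
- move=> k; apply/measurable_EFinP; apply/measurable_restrict; [exact: measurable_itv|exact: measurable_itv|].
  exact: (@measurable_funS _ _ _ _ P _ _ (measurable_itv _) (@subIsetl _ _ _) mg').
- move=> x; rewrite /= in_itv/= andbT => x0; apply: cvg_near_cst.
  by apply: filterS (S_near x0) => k Sx; rewrite patchE mem_set.
- exact: integrable_abse.
- move=> k x _ /=; rewrite patchE; case: ifP => _ //=.
  by rewrite normr0 lee_fin.
Qed.

(** Monotone convergence along the same exhaustion. *)
Lemma integrable_bounded_antiderivative g g' (M : R) :
  (forall x : R, 0 < x -> is_derive x (1 : R) g (g' x)) ->
  (forall x : R, 0 < x -> {for x, continuous g'}) ->
  (forall x, 0 < x -> 0 <= g' x) -> (forall x, 0 < x -> `|g x| <= M) ->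
  mu.-integrable P (EFin \o g').
Proof.
move=> dg cg g0 gM.
have mg' : measurable_fun P g' by exact: measurable_halfline.
apply/integrableP; split; first exact/measurable_EFinP.
have UP : \bigcup_k S_ k = P.
  apply/seteqP; split=> [x [k _ /S_sub//]|x]; rewrite /= in_itv/= andbT.
  by move=> /S_near[k _ /(_ k (leqnn k))]; exists k.
have PE : (\int[mu]_(x in P) `|(EFin \o g') x| = \int[mu]_(x in P) (g' x)%:E)%E.
  apply: eq_integral => x; rewrite inE/= in_itv/= andbT => x0.
  by rewrite ger0_norm ?g0.
rewrite PE -UP.
have cvS : (\int[mu]_(x in S_ k) (g' x)%:E)%E @[k --> \oo] -->
    (\int[mu]_(x in \bigcup_k S_ k) (g' x)%:E)%E.
  apply: (@ge0_nondecreasing_set_cvg_integral _ (measurableTypeR R) R S_ (EFin \o g') mu).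
  - move=> i j ij; apply/subsetPset => x; rewrite /S_ /= !in_itv/= => /andP[h1 h2].
    have bij : b_ i <= b_ j by rewrite ler_nat.
    apply/andP; split; last exact: le_trans bij.
    by apply: le_trans h1; rewrite lef_pV2 ?posrE.
  - by move=> k; exact: measurable_itv.
  - move=> k; apply/measurable_EFinP.
    exact: (@measurable_funS _ _ _ _ P _ _ (measurable_itv _) (@S_sub k) mg').
  - by move=> k x /S_sub; rewrite /= in_itv/= andbT lee_fin; exact: g0.
rewrite -(cvg_lim _ cvS)//; apply: (@le_lt_trans _ _ (M + M)%:E); last exact: ltry.
apply: lime_le; first by apply/cvg_ex; eexists; exact: cvS.
apply: nearW => k; rewrite (FTC_segment (bV_gt0 k) (bV_lt k) dg cg) -EFinB lee_fin.
by apply: le_trans (ler_norm _) _; apply: le_trans (ler_normB _ _) _; apply: lerD; apply: gM.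
Qed.

(** The exponential beats every power.  Moduli are handled through their
    logarithms throughout, which keeps powers with real exponents linear. *)
Lemma mul_ln_sub_linear_bounded (B u c : R) : 0 < u -> 0 < c ->
  exists K, forall y, 0 < y -> B * ln (u + y) - c * y <= K.
Proof.
move=> u0 c0; have [B0|B0] := leP B 0.
  exists (B * ln u) => y y0; rewrite lerBlDr.
  have : ln u <= ln (u + y) by rewrite ler_ln ?posrE ?addr_gt0// lerDl ltW.
  by move=> h; have := mulr_ge0 (ltW c0) (ltW y0); nra.
exists (c * u - B * ln (c / B)) => y y0.
have cB : 0 < c / B by exact: divr_gt0.
have uy : 0 < u + y by exact: addr_gt0.
have := ln_sublinear (mulr_gt0 cB uy).
have -> : ln (c / B * (u + y)) = ln (c / B) + ln (u + y) by apply: lnM; rewrite posrE.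
move=> h; have {h} : B * (ln (c / B) + ln (u + y)) < B * (c / B * (u + y)).
  by rewrite ltr_pM2l.
rewrite mulrA (mulrC B (c / B)) mulfVK ?lt0r_neq0//; lra.
Qed.

Lemma power_exp_le (A B u c A' : R) : 0 < u -> 0 < c ->
  exists C, forall y, 0 < y ->
    expR (A * ln y + B * ln (u + y) - c * y) <= C * expR (A * ln y - A' * ln (1 + y)).
Proof.
move=> u0 c0.
have c2 : 0 < c / 2 by rewrite divr_gt0.
have [K1 h1] := mul_ln_sub_linear_bounded B u0 c2.
have [K2 h2] := mul_ln_sub_linear_bounded A' ltr01 c2.
exists (expR (K1 + K2)) => y y0; rewrite -expRD ler_expR.
have := h1 _ y0; have := h2 _ y0; lra.
Qed.

(** The integrand is at most a multiple of [y ^ A * (1 + y) ^ (- A - 2)], which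
    has the bounded antiderivative [(y / (1 + y)) ^ (A + 1) / (A + 1)]. *)
Lemma integrable_power_exp (A B u c : R) : -1 < A -> 0 < u -> 0 < c ->
  mu.-integrable P (EFin \o (fun y => expR (A * ln y + B * ln (u + y) - c * y))).
Proof.
move=> A1 u0 c0; have [C hC] := power_exp_le A B (A + 2) u0 c0.
have dln (y : R) : 0 < y -> is_derive y (1 : R) (@ln R) y^-1 by move=> y0; exact: is_derive1_ln.
have dlnu (v y : R) : 0 < v -> 0 < y -> is_derive y (1 : R) (fun y => ln (v + y)) (v + y)^-1.
  move=> v0 y0; have vy : 0 < v + y by exact: addr_gt0.
  have dv : is_derive y (1 : R) (fun y => v + y) 1.
    by apply: is_derive_eqv (is_deriveD_fun (is_derive_cst _ _ _) (is_derive_id _ _)) _; rewrite add0r.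
  apply: is_derive_eqv (is_derive_comp_fun dv (is_derive1_ln vy)) _.
  by rewrite mulr1.
have dZ (k : R) (f : R -> R) (y a : R) : is_derive y (1 : R) f a ->
    is_derive y (1 : R) (fun y => k * f y) (k * a).
  move=> h; under eq_fun do rewrite mulrC; rewrite mulrC; exact: is_deriveMr_fun.
pose G y := expR (A * ln y - (A + 2) * ln (1 + y)).
have cG (y : R) : 0 < y -> {for y, continuous G}.
  move=> y0; have d1 := is_deriveB_fun (dZ A _ _ _ (dln y y0)) (dZ (A + 2) _ _ _ (dlnu 1 y ltr01 y0)).
  exact: is_derive_continuous (is_derive_comp_fun d1 (is_derive_expR _)).
have Ap : 0 < A + 1 by lra.
pose g y := expR ((A + 1) * (ln y - ln (1 + y))) * (A + 1)^-1.
have iG : mu.-integrable P (EFin \o G).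
  apply: (@integrable_bounded_antiderivative g G (A + 1)^-1) => // [y y0|y y0|y y0].
  - have d1 := dZ (A + 1) _ _ _ (is_deriveB_fun (dln y y0) (dlnu 1 y ltr01 y0)).
    apply: is_derive_eqv (is_deriveMr_fun _ (is_derive_comp_fun d1 (is_derive_expR _))) _.
    have y1 : 0 < 1 + y by lra.
    have -> : G y = expR ((A + 1) * (ln y - ln (1 + y))) * expR (- ln y - ln (1 + y)).
      by rewrite -expRD /G; congr expR; ring.
    rewrite -mulrA; congr (_ * _); rewrite expRD !expRN !lnK ?posrE//.
    by field; rewrite !lt0r_neq0.
  - exact: expR_ge0.
  - have y1 : 0 < 1 + y by lra.
    have A1V : 0 < (A + 1)^-1 by rewrite invr_gt0.
    rewrite normrM (ger0_norm (expR_ge0 _)) (ger0_norm (ltW A1V)).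
    rewrite -[X in _ <= X]mul1r ler_pM2r// -[X in _ <= X]expR0 ler_expR.
    have : ln y <= ln (1 + y) by rewrite ler_ln ?posrE//; lra.
    move=> h; nra.
have mP : measurable P by exact: measurable_itv.
have iCG := integrableZl mP C iG.
apply: (le_integrable mP _ _ iCG).
  apply/measurable_EFinP; apply: measurable_halfline => y y0.
  have d1 := is_deriveD_fun (dZ A _ _ _ (dln y y0)) (dZ B _ _ _ (dlnu u y u0 y0)).
  have d2 := is_deriveB_fun d1 (dZ c _ _ _ (is_derive_id y 1)).
  exact: is_derive_continuous (is_derive_comp_fun d2 (is_derive_expR _)).
move=> y; rewrite /= in_itv/= andbT => y0; rewrite lee_fin ger0_norm ?expR_ge0//.
by apply: le_trans (hC _ y0) _; exact: ler_norm.
Qed.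

Lemma cvg_expR_ln_nat (A : R) : 0 < A ->
  expR (- A * ln k.+2%:R) @[k --> \oo] --> (0 : R).
Proof.
move=> A0; apply/cvgrPdist_lt => /= e e0; near=> k.
have k2 : expR (- ln e / A) < k.+2%:R.
  apply: (@lt_trans _ _ k%:R); last by rewrite ltr_nat.
  by near: k; exact: nbhs_infty_gtr.
rewrite sub0r normrN ger0_norm ?expR_ge0// -[ltRHS]lnK ?posrE// ltr_expR.
have : ln (expR (- ln e / A)) < ln k.+2%:R by rewrite ltr_ln ?posrE ?expR_gt0.
by rewrite expRK ltr_pdivrMr// => h; nra.
Unshelve. all: by end_near. Qed.

Lemma ccvg_unique (u : nat -> R[i]) l l' : ccvg u l -> ccvg u l' -> l = l'.
Proof.
by move=> [r i] [r' i']; apply: cplx_eq; [rewrite -(cvg_lim _ r)// -(cvg_lim _ r')|rewrite -(cvg_lim _ i)// -(cvg_lim _ i')].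
Qed.

Lemma ccvg0_le (u : nat -> R[i]) (v : nat -> R) : (forall n, cmod (u n) <= v n) ->
  v n @[n --> \oo] --> (0 : R) -> ccvg u 0.
Proof.
move=> uv v0; split; apply: norm_cvg0.
  apply: (@squeeze_cvgr _ _ _ _ (cst 0) v) => //; last exact: cvg_cst.
  by apply: nearW => n; rewrite normr_ge0/=; apply: le_trans (uv n); exact: normRe_cmod.
apply: (@squeeze_cvgr _ _ _ _ (cst 0) v) => //; last exact: cvg_cst.
by apply: nearW => n; rewrite normr_ge0/=; apply: le_trans (uv n); exact: normIm_cmod.
Qed.

Lemma ccvgM_cst (u : nat -> R[i]) l (k : R[i]) : ccvg u l -> ccvg (fun n => k * u n) (k * l).
Proof.
move=> [r i]; split.
  under eq_fun do rewrite cReM; rewrite cReM; apply: cvgB; exact: cvgMr.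
under eq_fun do rewrite cImM; rewrite cImM; apply: cvgD; exact: cvgMr.
Qed.

Lemma ccvgD (u u' : nat -> R[i]) l l' : ccvg u l -> ccvg u' l' ->
  ccvg (fun n => u n + u' n) (l + l').
Proof.
move=> [r i] [r' i']; split.
  under eq_fun do rewrite cReD; rewrite cReD; exact: cvgD.
under eq_fun do rewrite cImD; rewrite cImD; exact: cvgD.
Qed.

Lemma ccvg_cst (k : R[i]) : ccvg (fun=> k) k.
Proof. by split; exact: cvg_cst. Qed.

Lemma ccvg_cderive F (v : nat -> R) l d : is_cderive F l d ->
  v n @[n --> \oo] --> l -> ccvg (fun n => F (v n)) (F l).
Proof.
move=> /is_cderive_continuous[cr ci] vl; split.
  exact: (cvg_comp _ _ vl cr).
exact: (cvg_comp _ _ vl ci).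
Qed.

Lemma ccvg_cmod_le (u : nat -> R[i]) l (b : R) : ccvg u l ->
  (forall n, cmod (u n) <= b) -> cmod l <= 2 * b.
Proof.
move=> [r i] bu; apply: le_trans (cmod_le_ReIm _) _; rewrite mulr2n mulrDl mul1r.
apply: lerD.
  rewrite -(cvg_lim _ (cvg_norm r))//; apply: limr_le.
    by apply/cvg_ex; eexists; exact: cvg_norm r.
  by apply: nearW => k; apply: le_trans (normRe_cmod _) (bu k).
rewrite -(cvg_lim _ (cvg_norm i))//; apply: limr_le.
  by apply/cvg_ex; eexists; exact: cvg_norm i.
by apply: nearW => k; apply: le_trans (normIm_cmod _) (bu k).
Qed.

Definition harmonicS (n : nat) : R := (n.+2%:R)^-1.
Lemma harmonicS01 n : 0 < harmonicS n < 1.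
Proof. by rewrite invr_gt0 ltr0n/= invf_lt1// ltr1n. Qed.
Lemma cvg_harmonicS : harmonicS n @[n --> \oo] --> (0 : R).
Proof. by have := @cvg_harmonic R; rewrite -(cvg_shiftS _). Qed.

Lemma improper_cFTC F G :
  (forall x : R, 0 < x -> is_cderive F x (G x)) ->
  (forall x : R, 0 < x -> exists d, is_cderive G x d) ->
  cintegrable mu P G ->
  ccvg (fun k => F k.+2%:R - F (k.+2%:R)^-1) (cintegral mu P G).
Proof.
move=> dF dG [iR iI]; split.
  under eq_fun do rewrite cReD cReN.
  apply: (@improper_FTC (fun x => Re (F x)) (fun x => Re (G x))) => // x x0.
    by have [] := dF x x0.
  by have [d /is_cderive_continuous[]] := dG x x0.
under eq_fun do rewrite cImD cImN.
apply: (@improper_FTC (fun x => Im (F x)) (fun x => Im (G x))) => // x x0.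
  by have [] := dF x x0.
by have [d /is_cderive_continuous[]] := dG x x0.
Qed.

(** The bound on [F] is at most a multiple of [x ^ A * (1 + x) ^ (- 2 A)], hence
    of [k ^ (- A)] at both ends [1/k] and [k]. *)
Lemma improper_cFTC_vanish F G (A B u c C : R) : 0 < A -> 0 < u -> 0 < c ->
  (forall x : R, 0 < x -> is_cderive F x (G x)) ->
  (forall x : R, 0 < x -> exists d, is_cderive G x d) ->
  cintegrable mu P G ->
  (forall x : R, 0 < x -> cmod (F x) <= C * expR (A * ln x + B * ln (u + x) - c * x)) ->
  cintegral mu P G = 0.
Proof.
move=> A0 u0 c0 dF dG iG bF.
apply: ccvg_unique (improper_cFTC dF dG iG) _.
have [C' hC'] := power_exp_le A B (2 * A) u0 c0.
have C0 : 0 <= C.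
  have := le_trans (cmod_ge0 _) (bF 1 ltr01).
  by rewrite pmulr_lge0// expR_gt0.
have bF' y : 0 < y -> cmod (F y) <= C * C' * expR (A * (ln y - 2 * ln (1 + y))).
  move=> y0; apply: le_trans (bF y y0) _; rewrite -mulrA ler_wpM2l//.
  by apply: le_trans (hC' y y0) _; rewrite mulrBr mulrA (mulrC A 2).
have CC0 : 0 <= C * C'.
  have := le_trans (cmod_ge0 _) (bF' 1 ltr01).
  by rewrite pmulr_lge0// expR_gt0.
apply: (@ccvg0_le _ (fun k => (C * C' + C * C') * expR (- A * ln k.+2%:R))); last first.
  rewrite -(mulr0 (C * C' + C * C')); apply: cvgMr; exact: cvg_expR_ln_nat.
move=> k; have k0 : 0 < k.+2%:R :> R by [].
have k1 : 1 < k.+2%:R :> R by rewrite ltr1n.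
have lk : 0 <= ln (k.+2%:R : R) by rewrite ln_ge0// ltW.
have NA : - A * ln (k.+2%:R : R) = A * - ln (k.+2%:R : R) by ring.
apply: le_trans (ler_cmodB _ _) _; rewrite mulrDl; apply: lerD.
  apply: le_trans (bF' _ k0) _; rewrite ler_wpM2l// ler_expR NA ler_pM2l//.
  have : ln (k.+2%:R : R) <= ln (1 + k.+2%:R) by rewrite ler_ln ?posrE ?addr_gt0// lerDr.
  lra.
have kV : 0 < (k.+2%:R : R)^-1 by rewrite invr_gt0.
apply: le_trans (bF' _ kV) _; rewrite ler_wpM2l// ler_expR NA ler_pM2l//.
rewrite lnV ?posrE//.
have : 0 <= ln (1 + (k.+2%:R : R)^-1) by rewrite ln_ge0// lerDl ltW.
lra.
Qed.

(** A substitute for the boundary terms when [F] is bounded but its limit at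
    the origin is not at hand. *)
Lemma cmod_improper_cFTC_le F G (M : R) :
  (forall x : R, 0 < x -> is_cderive F x (G x)) ->
  (forall x : R, 0 < x -> exists d, is_cderive G x d) ->
  cintegrable mu P G ->
  (forall x : R, 0 < x -> cmod (F x) <= M) ->
  cmod (cintegral mu P G) <= 4 * M.
Proof.
move=> dF dG iG bF.
have b k : cmod (F k.+2%:R - F (k.+2%:R)^-1) <= 2 * M.
  rewrite mulr2n mulrDl mul1r; apply: le_trans (ler_cmodB _ _) _.
  by apply: lerD; apply: bF => //; rewrite invr_gt0.
have -> : 4 * M = 2 * (2 * M) by ring.
exact: ccvg_cmod_le (improper_cFTC dF dG iG) b.
Qed.

Lemma cintegral_itv_cy F : cmeasurable P F ->
  cintegral mu `[0, +oo[ F = cintegral mu P F.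
Proof.
move=> [mr mi]; rewrite /cintegral /Rintegral.
by rewrite !integral_itv_obnd_cbnd//; exact/measurable_EFinP.
Qed.

Lemma cintegrable_itv_cy F : cintegrable mu P F -> cintegrable mu `[0, +oo[ F.
Proof.
have aux g : mu.-integrable P (EFin \o g) -> mu.-integrable `[0, +oo[ (EFin \o g).
  move=> /integrableP[mg ig]; apply/integrableP; split.
    by apply/emeasurable_fun_itv_obnd_cbndP.
  by rewrite -integral_itv_obnd_cbnd//; exact: measurableT_comp.
by move=> [r i]; split; exact: aux.
Qed.
End HalfLine.

(** * The functional equation of Gamma *)

Section GammaRecurrence.
Context {R : realType}.
Local Notation mu := (@lebesgue_measure R).
Local Notation P := (`](0 : R), +oo[%classic : set (measurableTypeR R)).
Implicit Types (w z a : R[i]).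

(** The integrand [v ^ w * exp (- v)] of Euler's integral for [Gamma (w + 1)],
    as a single exponential. *)
Definition gamma_integrand w (v : R) : R[i] := cexp (w * (ln v)%:C - v%:C).

Lemma is_cderive_gamma_integrand w (v : R) : 0 < v ->
  is_cderive (gamma_integrand w) v (gamma_integrand w v * (w * (v%:C)^-1 - 1)).
Proof.
move=> v0; apply: is_cderive_cexp; apply: is_cderiveB.
  exact/is_cderiveZ/is_cderive_ln.
exact: is_cderive_id.
Qed.

Lemma cmod_gamma_integrand w (v : R) : cmod (gamma_integrand w v) =
  expR (Re w * ln v + 0 * ln (1 + v) - 1 * v).
Proof. by rewrite cmod_cexp !creE; congr expR; ring. Qed.

Lemma cintegrable_gamma_integrand w : -1 < Re w ->
  cintegrable mu P (gamma_integrand w).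
Proof.
move=> w1; apply: (cintegrable_le _ _ (integrable_power_exp 0 w1 ltr01 ltr01)).
- exact: measurable_itv.
- by apply: cmeasurable_halfline => x x0; eexists; exact: is_cderive_gamma_integrand.
- by move=> v _; rewrite cmod_gamma_integrand.
Qed.

Lemma euler_gammaE z : euler_gamma z = cintegral mu P (gamma_integrand (z - 1)).
Proof.
apply: eq_cintegral => v; rewrite /= in_itv/= andbT => v0.
by rewrite cpowR// -cexpD.
Qed.

Lemma euler_gammaS w : 0 < Re w -> euler_gamma (w + 1) = w * euler_gamma w.
Proof.
move=> w0; rewrite !euler_gammaE addrK.
have mP : measurable P by exact: measurable_itv.
have i1 : cintegrable mu P (gamma_integrand (w - 1)).
  by apply: cintegrable_gamma_integrand; rewrite !creE; lra.
have i2 : cintegrable mu P (gamma_integrand w).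
  by apply: cintegrable_gamma_integrand; lra.
pose G v := w * gamma_integrand (w - 1) v + -1 * gamma_integrand w v.
have iG : cintegrable mu P G by apply: cintegrableD => //; exact: cintegrableZ.
have : cintegral mu P G = 0.
  apply: (@improper_cFTC_vanish _ (gamma_integrand w) G (Re w) 0 1 1 1) => //.
  - move=> x x0; apply: is_cderive_eq (is_cderive_gamma_integrand w x0) _.
    rewrite mulrBr mulr1 /G mulN1r mulrCA; congr (_ * _ - _).
    have e : (w - 1) * (ln x)%:C - x%:C = w * (ln x)%:C - x%:C - (ln x)%:C by ring.
    by rewrite /gamma_integrand e (cexpB (w * _ - _)) cexpR lnK.
  - move=> x x0; eexists; apply: is_cderiveD; apply: is_cderiveZ;
    exact: is_cderive_gamma_integrand.
  - by move=> x x0; rewrite mul1r cmod_gamma_integrand.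
rewrite cintegralD//; [|exact: cintegrableZ..].
by rewrite !cintegralZ// mulN1r => /eqP; rewrite subr_eq0 => /eqP.
Qed.

Lemma euler_gamma_prod w k : 0 < Re w ->
  euler_gamma (w + k%:R) = (\prod_(0 <= j < k) (w + j%:R)) * euler_gamma w.
Proof.
move=> w0; elim: k => [|k IH]; first by rewrite addr0 big_nil mul1r.
rewrite -natr1 addrA euler_gammaS; last by rewrite !creE ltr_pwDl.
by rewrite IH big_nat_recr//= mulrA (mulrC (w + _)).
Qed.

Lemma cGamma_subn a n : 0 < Re a -> exists k,
  [/\ (k <= n)%N, 0 < Re (a - n%:R + k%:R) &
  cGamma (a - n%:R) =
    euler_gamma (a - n%:R + k%:R) / \prod_(0 <= j < k) (a - n%:R + j%:R)].
Proof.
move=> a0; rewrite /cGamma; case: ifPn => [an0|].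
  by exists 0%N; rewrite addr0 big_nil divr1.
rewrite -leNgt => an0; exists (Defs.shift (a - n%:R)); split.
- have an : 0 <= - Re (a - n%:R) by rewrite oppr_ge0.
  by rewrite /Defs.shift truncn_lt_nat// !creE; lra.
- have := truncnS_gt (- Re (a - n%:R)).
  by rewrite /Defs.shift [X in _ -> 0 < X]cReD cRen; lra.
- by rewrite big_mkord.
Qed.

(** [1 / Gamma (a - n) = (a - 1) ... (a - n) / Gamma a]: both sides vanish at
    the poles of Gamma, so no case distinction on [a] is called for. *)
Lemma invr_cGamma_subn a n : 0 < Re a ->
  (cGamma (a - n%:R))^-1 = (\prod_(0 <= j < n) (a - j.+1%:R)) / cGamma a.
Proof.
move=> a0; have [k [kn k0 ->]] := cGamma_subn n a0.
have -> : cGamma a = euler_gamma a by rewrite /cGamma a0.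
set z := a - n%:R in k0 *.
have -> : a = z + k%:R + (n - k)%:R.
  by rewrite -addrA -natrD subnKC// /z subrK.
rewrite (euler_gamma_prod (n - k) k0).
have -> : \prod_(0 <= j < n) (z + k%:R + (n - k)%:R - j.+1%:R) =
    \prod_(0 <= j < n) (z + j%:R).
  rewrite big_nat_rev /= big_nat_cond [RHS]big_nat_cond; apply: eq_bigr => j.
  rewrite andbT /= => jn.
  rewrite add0n -(addrA z) -natrD subnKC// subnSK// natrB ?(ltnW jn)//; ring.
rewrite (big_cat_nat (leq0n k) kn) /= invf_div.
have -> : \prod_(k <= i < n) (z + i%:R) = \prod_(0 <= i < n - k) (z + k%:R + i%:R).
  rewrite -{1}[k]add0n big_addn; apply: eq_bigr => j _.
  by rewrite natrD addrA addrAC.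
set Q := \prod_(0 <= i < n - k) _; have Q0 : Q != 0.
  rewrite prodf_seq_neq0; apply/allP => j _; apply/implyP => _.
  have : 0 < Re (z + k%:R + j%:R) by rewrite cReD cRen ltr_pwDl.
  by apply: contraTneq => ->; rewrite ltxx.
by rewrite invfM -mulrA (mulrA Q) mulfV// mul1r.
Qed.
End GammaRecurrence.

(** * Rotation of the contour *)

Section Cone.
Context {R : realType}.
Implicit Types (w : R[i]) (x y c M : R).

(** [x] and [y w] make an angle of at most pi/2, so they cannot cancel. *)
Lemma cmod_cone_ge w x y c : 0 <= Re w -> 0 <= x -> 0 <= y ->
  0 <= c -> c <= 1 -> c <= cmod w -> c / 2 * (x + y) <= cmod (x%:C + y%:C * w).
Proof.
move=> w0 x0 y0 c0 c1 cw.
have h0 : 0 <= c / 2 * (x + y) by rewrite mulr_ge0 ?divr_ge0 ?addr_ge0.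
rewrite -(@ler_pXn2r _ 2)// ?nnegrE ?cmod_ge0// sqr_cmod !creE.
have cw2 : c ^+ 2 <= Re w ^+ 2 + Im w ^+ 2.
  by rewrite -sqr_cmod ler_pXn2r ?nnegrE ?cmod_ge0.
have c2 : c ^+ 2 <= 1 by rewrite expr_le1.
have h1 := mulr_ge0 (mulr_ge0 x0 y0) w0.
have h2 : y ^+ 2 * c ^+ 2 <= y ^+ 2 * (Re w ^+ 2 + Im w ^+ 2) by rewrite ler_wpM2l ?sqr_ge0.
have h3 : x ^+ 2 * c ^+ 2 <= x ^+ 2 * 1 by rewrite ler_wpM2l ?sqr_ge0.
have h4 : 0 <= c ^+ 2 * (x - y) ^+ 2 by rewrite mulr_ge0 ?sqr_ge0.
have h5 : 0 <= c ^+ 2 * (x ^+ 2 + y ^+ 2) by rewrite mulr_ge0 ?addr_ge0 ?sqr_ge0.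
have -> : (c / 2 * (x + y)) ^+ 2 = c ^+ 2 * (x ^+ 2 + y ^+ 2) / 2 - c ^+ 2 * (x - y) ^+ 2 / 4.
  by field.
nra.
Qed.

Lemma cmod_cone_le w x y M : 0 <= x -> 0 <= y ->
  1 <= M -> cmod w <= M -> cmod (x%:C + y%:C * w) <= M * (x + y).
Proof.
move=> x0 y0 M1 wM; apply: le_trans (ler_cmodD _ _) _.
rewrite cmodM !cmodR !ger0_norm// mulrDr; apply: lerD.
  by rewrite ler_peMl.
by rewrite mulrC ler_wpM2r.
Qed.

Lemma ln_cmod_cone w x y c M : 0 <= Re w -> 0 < x -> 0 <= y ->
  0 < c -> c <= 1 -> c <= cmod w -> 1 <= M -> cmod w <= M ->
  `|ln (cmod (x%:C + y%:C * w)) - ln (x + y)| <= ln M - ln (c / 2).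
Proof.
move=> w0 x0 y0 c0 c1 cw M1 wM; have xy : 0 < x + y by rewrite ltr_pwDl.
have c2 : 0 < c / 2 by rewrite divr_gt0.
have M0 : 0 < M by rewrite (lt_le_trans ltr01).
have l := cmod_cone_ge w0 (ltW x0) y0 (ltW c0) c1 cw.
have g := cmod_cone_le (ltW x0) y0 M1 wM.
have l0 : 0 < c / 2 * (x + y) by rewrite mulr_gt0.
have m0 := lt_le_trans l0 l.
have e1 : ln (c / 2 * (x + y)) = ln (c / 2) + ln (x + y) by apply: lnM; rewrite posrE.
have e2 : ln (M * (x + y)) = ln M + ln (x + y) by apply: lnM; rewrite posrE.
have h1 : ln (c / 2 * (x + y)) <= ln (cmod (x%:C + y%:C * w)) by rewrite ler_ln.
have h2 : ln (cmod (x%:C + y%:C * w)) <= ln (M * (x + y)).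
  by rewrite ler_ln// posrE mulr_gt0.
have M2 : 0 <= ln M by exact: ln_ge0.
have c3 : ln (c / 2) <= 0 by apply: ln_le0; lra.
by rewrite ler_norml; apply/andP; split; lra.
Qed.

(** Up to a constant factor, the modulus of [z ^ p] is [exp (Re p * L)] as soon
    as [ln |z|] is within bounded distance of [L]. *)
Lemma cmod_cexp_clog_le (p z : R[i]) L K : 0 <= Re z -> `|ln (cmod z) - L| <= K ->
  Re (p * clog z) <= Re p * L + (`|Re p| * K + `|Im p| * (pi / 2)).
Proof.
move=> z0 hL; rewrite cReM Re_clog Im_clog.
have h1 : Re p * (ln (cmod z) - L) <= `|Re p| * K.
  apply: le_trans (ler_norm _) _; rewrite normrM ler_wpM2l//.
have h2 : - (Im p * carg z) <= `|Im p| * (pi / 2).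
  apply: le_trans (ler_norm _) _; rewrite normrN normrM ler_wpM2l//.
  by rewrite ler_norml; exact: carg_halfW.
lra.
Qed.
End Cone.

Section Rotation.
Context {R : realType}.
Local Notation mu := (@lebesgue_measure R).
Local Notation P := (`](0 : R), +oo[%classic : set (measurableTypeR R)).
Variables (alpha beta s : R[i]) (u : R).
Hypotheses (alpha0 : 0 < Re alpha) (beta_ge0 : 0 <= Re beta) (beta0 : beta != 0).
Hypothesis u0 : 0 < u.

(** The Laplace integrand on the ray of real numbers, and its image on the ray
    through [1 / beta]. *)
Definition laplace_integrand (y : R) : R[i] :=
  cexp ((alpha - 1) * (ln y)%:C + (s - 1) * (ln (u + y))%:C - beta * y%:C).
Definition tricomi_integrand (z : R[i]) (x : R) : R[i] :=
  cexp ((alpha - 1) * (ln x)%:C + (s - 1) * clog (z + x%:C) - x%:C).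

(** The direction of integration moves on the segment from [1] to [1 / beta],
    along which [beta * zeta t] runs from [beta] to [1]. *)
Let zeta (t : R) : R[i] := (1 - t)%:C + t%:C * beta^-1.
Let dzeta : R[i] := beta^-1 - 1.

Let L (t r : R) : R[i] := (alpha - 1) * (ln r)%:C + alpha * clog (zeta t)
  + (s - 1) * clog (u%:C + r%:C * zeta t) - beta * zeta t * r%:C.
Let F t r := cexp (L t r).
(** Logarithmic derivative of [F] in [t]. *)
Let E (t r : R) : R[i] := alpha * (dzeta / zeta t)
  + (s - 1) * (r%:C * dzeta / (u%:C + r%:C * zeta t)) - beta * dzeta * r%:C.

Let ReVbeta : 0 <= Re beta^-1.
Proof. by rewrite Re_cinv mulr_ge0// invr_ge0 addr_ge0 ?sqr_ge0. Qed.

Let Rezeta t : Re (zeta t) = 1 - t + t * Re beta^-1.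
Proof. by rewrite !creE; ring. Qed.

Let Rezeta_ge0 t : 0 <= t <= 1 -> 0 <= Re (zeta t).
Proof.
by move=> /andP[t0 t1]; rewrite Rezeta addr_ge0 ?subr_ge0// mulr_ge0.
Qed.

Let Rezeta_gt0 t : 0 <= t < 1 -> 0 < Re (zeta t).
Proof.
by move=> /andP[t0 t1]; rewrite Rezeta ltr_pwDl ?subr_gt0// mulr_ge0.
Qed.

Let Reshift_gt0 t r : 0 <= t <= 1 -> 0 <= r -> 0 < Re (u%:C + r%:C * zeta t).
Proof.
move=> t01 r0; rewrite cReD cReM !cReR cImR mul0r subr0 ltr_pwDl// mulr_ge0//.
exact: Rezeta_ge0.
Qed.

Let betazeta t : beta * zeta t = t%:C + (1 - t)%:C * beta.
Proof. by rewrite /zeta mulrDr mulrCA mulfV// mulr1 addrC [beta * _]mulrC. Qed.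

Let Re_neq0 (z : R[i]) : 0 < Re z -> z != 0.
Proof. by apply: contraTneq => ->; rewrite ltxx. Qed.

Let c : R := Num.min 1 (cmod beta^-1) / 2.
Let M : R := Num.max 1 (cmod beta^-1).

Let Vbeta_gt0 : 0 < cmod beta^-1. Proof. by rewrite cmod_gt0 invr_neq0. Qed.
Let c_gt0 : 0 < c. Proof. by rewrite divr_gt0// lt_min ltr01. Qed.
Let c_le1 : c <= 1.
Proof. rewrite /c; have : Num.min 1 (cmod beta^-1) <= 1 by rewrite ge_min lexx. lra. Qed.
Let M_ge1 : 1 <= M. Proof. by rewrite le_max lexx. Qed.

Let zeta_bounds t : 0 <= t <= 1 -> c <= cmod (zeta t) /\ cmod (zeta t) <= M.
Proof.
move=> /andP[t0 t1]; have s0 : 0 <= 1 - t by rewrite subr_ge0.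
have m1 : Num.min 1 (cmod beta^-1) <= 1 by rewrite ge_min lexx.
have m2 : Num.min 1 (cmod beta^-1) <= cmod beta^-1 by rewrite ge_min lexx orbT.
have m0 : 0 <= Num.min 1 (cmod beta^-1) by rewrite le_min ler01 ltW.
have M2 : cmod beta^-1 <= M by rewrite le_max lexx orbT.
have := cmod_cone_ge ReVbeta s0 t0 m0 m1 m2.
have := cmod_cone_le s0 t0 M_ge1 M2.
by rewrite subrK !mulr1.
Qed.

Let F_bound : exists C, forall t r, 0 <= t <= 1 -> 0 < r ->
  cmod (F t r) <= C * expR ((Re alpha - 1) * ln r + (Re s - 1) * ln (u + r)
    - ((1 - t) * Re beta + t) * r).
Proof.
pose K1 := `|Re alpha| * (ln M - ln c) + `|Im alpha| * (pi / 2).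
pose K2 := `|Re (s - 1)| * (ln M - ln (c / 2)) + `|Im (s - 1)| * (pi / 2).
exists (expR (K1 + K2)) => t r t01 r0.
rewrite cmod_cexp -expRD ler_expR.
have [z1 z2] := zeta_bounds t01.
have z0 : 0 < cmod (zeta t) by exact: lt_le_trans c_gt0 z1.
have M0 : 0 < M by exact: lt_le_trans ltr01 M_ge1.
have h1 : Re (alpha * clog (zeta t)) <= Re alpha * 0 + K1.
  apply: cmod_cexp_clog_le; first exact: Rezeta_ge0.
  have l1 : ln c <= ln (cmod (zeta t)) by rewrite ler_ln.
  have l2 : ln (cmod (zeta t)) <= ln M by rewrite ler_ln.
  have l3 : ln c <= 0 by exact: ln_le0.
  have l4 : 0 <= ln M by exact: ln_ge0.
  by rewrite subr0 ler_norml; apply/andP; split; lra.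
have h2 : Re ((s - 1) * clog (u%:C + r%:C * zeta t)) <= Re (s - 1) * ln (u + r) + K2.
  apply: cmod_cexp_clog_le; first exact/ltW/Reshift_gt0/ltW.
  apply: ln_cmod_cone => //; [exact: Rezeta_ge0|exact: ltW].
have h3 : Re (beta * zeta t * r%:C) = ((1 - t) * Re beta + t) * r.
  by rewrite betazeta !creE; ring.
have h4 : Re ((alpha - 1) * (ln r)%:C) = (Re alpha - 1) * ln r.
  by rewrite !creE; ring.
rewrite /L !cReD cReN h3 h4.
have e : Re (s - 1) = Re s - 1 by rewrite !creE.
by rewrite e in h2; lra.
Qed.

Let is_cderive_zeta t : is_cderive zeta t dzeta.
Proof.
have d1 := is_cderive_real (is_deriveB_fun (is_derive_cst (1 : R) t 1) (is_derive_id t 1)).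
have d2 := is_cderiveM (is_cderive_id t) (is_cderive_cst beta^-1 t).
apply: is_cderive_eq (is_cderiveD d1 d2) _.
by rewrite /dzeta mulr0 addr0 mul1r sub0r rmorphN addrC.
Qed.

Let is_cderive_shift t r : is_cderive (fun t => u%:C + r%:C * zeta t) t (r%:C * dzeta).
Proof.
apply: is_cderive_eq (is_cderiveD (is_cderive_cst _ _) (is_cderiveZ _ (is_cderive_zeta t))) _.
by rewrite add0r.
Qed.

Let is_cderive_Ft t r : 0 <= t < 1 -> 0 < r -> is_cderive (F ^~ r) t (F t r * E t r).
Proof.
move=> t01 r0; have t01' : 0 <= t <= 1 by case/andP: t01 => -> /ltW ->.
apply: is_cderive_cexp; apply: is_cderiveB.
  apply: is_cderive_eq.
    apply: is_cderiveD.
      apply: is_cderiveD; first exact: is_cderive_cst.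
      exact: is_cderiveZ (is_cderive_clog (Rezeta_gt0 t01) (is_cderive_zeta t)).
    exact: is_cderiveZ (is_cderive_clog (Reshift_gt0 t01' (ltW r0)) (is_cderive_shift t r)).
  by rewrite add0r.
apply: is_cderive_eq (is_cderiveM (is_cderiveZ _ (is_cderive_zeta t)) (is_cderive_cst _ _)) _.
by rewrite mulr0 addr0.
Qed.

Let is_cderive_shiftr t r : is_cderive (fun r => u%:C + r%:C * zeta t) r (zeta t).
Proof.
apply: is_cderive_eq (is_cderiveD (is_cderive_cst _ _) (is_cderiveM (is_cderive_id _) (is_cderive_cst _ _))) _.
by rewrite add0r mul1r mulr0 addr0.
Qed.

Let Er (t r : R) : R[i] := (alpha - 1) / r%:C
  + (s - 1) * (zeta t / (u%:C + r%:C * zeta t)) - beta * zeta t.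

Let is_cderive_Fr t r : 0 <= t <= 1 -> 0 < r -> is_cderive (F t) r (F t r * Er t r).
Proof.
move=> t01 r0.
apply: is_cderive_cexp; apply: is_cderiveB.
  apply: is_cderiveD.
    apply: is_cderive_eq.
      apply: is_cderiveD; last exact: is_cderive_cst.
      exact: is_cderiveZ (is_cderive_ln r0).
    by rewrite addr0.
  exact: is_cderiveZ (is_cderive_clog (Reshift_gt0 t01 (ltW r0)) (is_cderive_shiftr t r)).
apply: is_cderive_eq (is_cderiveZ _ (is_cderive_id r)) _.
by rewrite mulr1.
Qed.

Let real_neq0 (r : R) : 0 < r -> (r%:C : R[i]) != 0.
Proof. by move=> r0; apply: Re_neq0. Qed.

(** The tangential derivative of the integrand is a radial derivative: this is
    the Cauchy-Riemann equation behind the rotation of the contour. *)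
Let is_cderive_radial t r : 0 < t < 1 -> 0 < r ->
  is_cderive (fun r => r%:C * (dzeta / zeta t) * F t r) r (F t r * E t r).
Proof.
move=> /andP[t0 t1] r0.
have t01 : 0 <= t < 1 by rewrite ltW.
have t01' : 0 <= t <= 1 by rewrite !ltW.
apply: is_cderive_eq.
  apply: is_cderiveM; last exact: is_cderive_Fr.
  apply: is_cderiveM; [exact: is_cderive_id|exact: is_cderive_cst].
rewrite /E /Er; have z0 := Re_neq0 (Rezeta_gt0 t01).
have w0 := Re_neq0 (Reshift_gt0 t01' (ltW r0)); have rn := real_neq0 r0.
move: z0 w0 rn; set zz := zeta t; set rr := r%:C => z0 w0 rn.
by field; rewrite z0 w0 rn.
Qed.

Let is_cderive_E t r : 0 < t < 1 -> 0 < r -> exists d, is_cderive (fun r => F t r * E t r) r d.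
Proof.
move=> /andP[t0 t1] r0; have t01' : 0 <= t <= 1 by rewrite !ltW.
have w0 := Re_neq0 (Reshift_gt0 t01' (ltW r0)).
eexists; apply: is_cderiveM; first exact: is_cderive_Fr.
apply: is_cderiveB; last exact: is_cderiveZ (is_cderive_id r).
apply: is_cderiveD; first exact: is_cderive_cst.
apply: is_cderiveZ; apply: is_cderiveM; last exact: is_cderiveV w0 (is_cderive_shiftr t r).
by apply: is_cderiveM; [exact: is_cderive_id|exact: is_cderive_cst].
Qed.

Let E_bound : exists K, 0 <= K /\ forall t r, 0 <= t <= 1 -> 0 < r ->
  cmod (E t r) <= K * (1 + r).
Proof.
pose K := cmod alpha * (cmod dzeta / c) + cmod (s - 1) * (cmod dzeta * (2 / c))
  + cmod beta * cmod dzeta.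
have c2 : 0 < 2 / c by rewrite divr_gt0.
have g := @cmod_ge0 R.
have K0 : 0 <= K by rewrite !addr_ge0// !mulr_ge0// ?invr_ge0 ltW.
exists K; split=> // t r t01 r0.
have [z1 z2] := zeta_bounds t01.
have z0 : 0 < cmod (zeta t) by exact: lt_le_trans c_gt0 z1.
have h1 : cmod (alpha * (dzeta / zeta t)) <= cmod alpha * (cmod dzeta / c).
  rewrite cmodM ler_wpM2l// cmodM cmodV ler_wpM2l//.
  by rewrite lef_pV2 ?posrE.
have h2 : cmod ((s - 1) * (r%:C * dzeta / (u%:C + r%:C * zeta t))) <=
    cmod (s - 1) * (cmod dzeta * (2 / c)).
  rewrite cmodM ler_wpM2l// !cmodM cmodV cmodR (ger0_norm (ltW r0)) [r * _]mulrC -mulrA ler_wpM2l//.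
  have l := cmod_cone_ge (Rezeta_ge0 t01) (ltW u0) (ltW r0) (ltW c_gt0) c_le1 z1.
  have l' : c / 2 * r <= cmod (u%:C + r%:C * zeta t).
    apply: le_trans l; apply: ler_wpM2l; first by rewrite divr_ge0// ltW.
    by rewrite lerDr ltW.
  have m0 : 0 < cmod (u%:C + r%:C * zeta t).
    by apply: lt_le_trans l'; rewrite mulr_gt0// divr_gt0.
  rewrite ler_pdivrMr// mulrC.
  have e : c / 2 * r * (2 / c) = r by field; rewrite gt_eqF.
  by have := ler_wpM2r (ltW c2) l'; rewrite e mulrC.
have h3 : cmod (beta * dzeta * r%:C) = cmod beta * cmod dzeta * r.
  by rewrite !cmodM cmodR ger0_norm// ltW.
apply: le_trans (ler_cmodB _ _) _; rewrite h3.
apply: le_trans (lerD (ler_cmodD _ _) (lexx _)) _.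
have b0 : 0 <= cmod beta * cmod dzeta by rewrite mulr_ge0.
have a1 : 0 <= (cmod alpha * (cmod dzeta / c) + cmod (s - 1) * (cmod dzeta * (2 / c))) * r.
  apply: mulr_ge0 (ltW r0); rewrite addr_ge0// !mulr_ge0// ?invr_ge0 ltW//.
rewrite /K; move: a1 h1 h2 b0; lra.
Qed.

Let mP : measurable P. Proof. exact: measurable_itv. Qed.

Let tgt (t : R) : 0 < t < 1 -> 0 <= t <= 1.
Proof. by move=> /andP[t0 t1]; rewrite !ltW. Qed.

(** Away from [t = 0] the factor [exp (- t r)] absorbs the linear growth of
    [E t r]; this is what remains of the decay when [beta] is imaginary. *)
Let dF_bound t1 : 0 < t1 -> t1 < 1 ->
  exists g : R -> R, [/\ (forall r, 0 <= g r), mu.-integrable P (EFin \o g) &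
  forall t r, t1 < t < 1 -> 0 < r ->
    cmod (F t r) <= g r /\ cmod (F t r * E t r) <= g r].
Proof.
move=> t10 t11; have [C hC] := F_bound; have [K [K0 hK]] := E_bound.
have t12 : 0 < t1 / 2 by rewrite divr_gt0.
have [B hB] := mul_ln_sub_linear_bounded 1 ltr01 t12.
have C0 : 0 <= C.
  have := le_trans (cmod_ge0 _) (hC 0 1 _ ltr01); rewrite lexx ler01 => /(_ isT).
  by rewrite pmulr_lge0// expR_gt0.
pose D := (1 + K) * (C * expR B).
have D0 : 0 <= D by rewrite mulr_ge0 ?addr_ge0 ?mulr_ge0 ?expR_ge0.
pose e (r : R) := expR ((Re alpha - 1) * ln r + (Re s - 1) * ln (u + r) - t1 / 2 * r).
exists (fun r => D * e r); split.
- by move=> r; rewrite mulr_ge0// expR_ge0.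
- have a1 : -1 < Re alpha - 1 by have := alpha0; lra.
  have ie := integrable_power_exp (Re s - 1) a1 u0 t12.
  by apply: eq_integrable (integrableZl mP D ie).
move=> t r /andP[t1t tlt1] r0.
have t01 : 0 <= t <= 1 by rewrite !ltW// (lt_trans t10).
have h1 : (1 + r) * cmod (F t r) <= C * expR B * e r.
  apply: le_trans (ler_wpM2l _ (hC t r t01 r0)) _; first by rewrite addr_ge0// ltW.
  rewrite mulrCA -mulrA ler_wpM2l// -[1 + r]lnK ?posrE ?addr_gt0//.
  rewrite -!expRD ler_expR.
  have hb : t1 * r <= ((1 - t) * Re beta + t) * r.
    rewrite ler_wpM2r ?(ltW r0)// -[leLHS]add0r lerD ?(ltW t1t)//.
    by rewrite mulr_ge0 ?subr_ge0 ?(ltW tlt1).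
  have := hB r r0; move: hb; lra.
have X0 : 0 <= C * expR B * e r by rewrite !mulr_ge0 ?expR_ge0.
have De : D * e r = C * expR B * e r + K * (C * expR B * e r) by rewrite /D; ring.
have F0 := cmod_ge0 (F t r).
split.
  have : cmod (F t r) <= (1 + r) * cmod (F t r) by rewrite ler_peMl// lerDl ltW.
  have := mulr_ge0 K0 X0; rewrite De; lra.
rewrite cmodM De; apply: le_trans (ler_wpM2l F0 (hK t r t01 r0)) _.
have -> : cmod (F t r) * (K * (1 + r)) = K * ((1 + r) * cmod (F t r)) by ring.
by apply: le_trans (ler_wpM2l K0 h1) _; rewrite lerDr.
Qed.

Let cmeasurable_F t : 0 <= t <= 1 -> cmeasurable P (F t).
Proof.
by move=> t01; apply: cmeasurable_halfline => r r0; eexists; exact: is_cderive_Fr.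
Qed.

Let cintegrable_F t : 0 < t < 1 -> cintegrable mu P (F t).
Proof.
move=> t01; have /andP[t0 t1] := t01.
have t2 : t / 2 < 1 by lra.
have t3 : 0 < t / 2 by lra.
have [g [_ ig hg]] := dF_bound t3 t2.
apply: (cintegrable_le mP (cmeasurable_F (tgt t01)) ig) => r; rewrite /= in_itv/= andbT => r0.
apply: (hg t r _ r0).1; lra.
Qed.

Let J (t : R) : R[i] := cintegral mu P (F t).

(** The primitive [r * (dzeta / zeta t) * F t r] vanishes at the origin because
    [Re alpha > 0]. *)
Let radial_integral0 t : 0 < t < 1 ->
  cintegrable mu P (fun r => F t r * E t r) /\ cintegral mu P (fun r => F t r * E t r) = 0.
Proof.
move=> t01; have /andP[t0 t1] := t01.
have t2 : t / 2 < 1 by lra.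
have t3 : 0 < t / 2 by lra.
have [g [_ ig hg]] := dF_bound t3 t2.
have iFE : cintegrable mu P (fun r => F t r * E t r).
  apply: (cintegrable_le mP _ ig).
    by apply: cmeasurable_halfline => r r0; exact: is_cderive_E.
  move=> r; rewrite /= in_itv/= andbT => r0; apply: (hg t r _ r0).2; lra.
split=> //; have [C hC] := F_bound.
apply: (@improper_cFTC_vanish _ (fun r => r%:C * (dzeta / zeta t) * F t r) _
  (Re alpha) (Re s - 1) u ((1 - t) * Re beta + t) (cmod (dzeta / zeta t) * C)) => //.
- by rewrite ltr_wpDl// mulr_ge0// subr_ge0 ltW.
- by move=> r r0; exact: is_cderive_radial.
- by move=> r r0; exact: is_cderive_E.
move=> r r0; rewrite !cmodM cmodR (ger0_norm (ltW r0)).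
apply: le_trans (ler_wpM2l _ (hC t r (tgt t01) r0)) _.
  by rewrite !mulr_ge0 ?cmod_ge0// ltW.
rewrite le_eqVlt; apply/orP; left; apply/eqP.
set X := cmod _ * cmod _.
have -> : r * X * (C * expR ((Re alpha - 1) * ln r + (Re s - 1) * ln (u + r) -
    ((1 - t) * Re beta + t) * r)) = X * C * (r * expR ((Re alpha - 1) * ln r +
    (Re s - 1) * ln (u + r) - ((1 - t) * Re beta + t) * r)) by ring.
congr (_ * _); rewrite -[X in X * _]lnK ?posrE// -expRD; congr expR; ring.
Qed.

Let is_cderive_J t : 0 < t < 1 -> is_cderive J t 0.
Proof.
move=> t01; have /andP[t0 tl1] := t01.
have t2 : t / 2 < 1 by lra.
have t3 : 0 < t / 2 by lra.
have [g [g0 ig hg]] := dF_bound t3 t2.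
have It x : `]t / 2, 1[%classic x -> 0 < x < 1 /\ t / 2 < x < 1.
  by rewrite /= in_itv/= => /andP[x1 x2]; split; rewrite ?x1 ?x2 ?andbT// (lt_trans t3 x1).
have Itt : `]t / 2, 1[%classic t by rewrite /= in_itv/= tl1 andbT; lra.
have Pr r : P r -> 0 < r by rewrite /= in_itv/= andbT.
have [iFE zFE] := radial_integral0 t01.
have aux (p : R[i] -> R) : (forall (G : R -> R[i]) x d, is_cderive G x d -> is_derive x (1 : R) (fun y => p (G y)) (p d)) ->
    (forall z, `|p z| <= cmod z) ->
    (forall x, 0 < x < 1 -> mu.-integrable P (EFin \o (fun r => p (F x r)))) ->
    Rintegral mu P (fun r => p (F t r * E t r)) = 0 ->
    is_derive t (1 : R) (fun t => Rintegral mu P (fun r => p (F t r))) 0.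
  move=> dp pc ip zp.
  pose f (x y : R) : R := p (F x y).
  have df x r : `]t / 2, 1[%classic x -> P r -> is_derive x (1 : R) (f ^~ r) (p (F x r * E x r)).
    move=> /It[x01 _] /Pr r0; apply: dp; apply: is_cderive_Ft => //.
    by move: x01 => /andP[/ltW -> ->].
  have d1 x r : `]t / 2, 1[%classic x -> P r -> partial1of2 f x r = p (F x r * E x r).
    by move=> Ix Px; rewrite partial1of2E; have [_ ->] := df x r Ix Px.
  have h1 : forall x, `]t / 2, 1[%classic x -> mu.-integrable P (EFin \o f x).
    by move=> x /It[x01 _]; exact: ip.
  have h2 : forall x y, `]t / 2, 1[%classic x -> P y -> derivable (f ^~ y) x 1.
    by move=> x r Ix Px; have [] := df x r Ix Px.
  have h3 : forall x y, `]t / 2, 1[%classic x -> P y -> `|partial1of2 f x y| <= g y.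
    move=> x r Ix Px; rewrite d1//; apply: le_trans (pc _) _.
    by have [_ x2] := It _ Ix; exact: (hg x r x2 (Pr _ Px)).2.
  apply: DeriveDef; first exact: (derivable_under_integral mP Itt h1 h2 g0 ig h3).
  rewrite -derive1E (differentiation_under_integral mP Itt h1 h2 g0 ig h3).
  apply: etrans zp.
  by apply: eq_Rintegral => r /set_mem Px; rewrite d1.
split.
  refine (aux (@complex.Re R) _ _ _ _) => [G x d []//|z|x x01|]; first exact: normRe_cmod.
    by have [] := cintegrable_F x01.
  by rewrite -[LHS]/(Re (cintegral mu P (fun r => F t r * E t r))) zFE.
refine (aux (@complex.Im R) _ _ _ _) => [G x d []//|z|x x01|]; first exact: normIm_cmod.
  by have [] := cintegrable_F x01.
by rewrite -[LHS]/(Im (cintegral mu P (fun r => F t r * E t r))) zFE.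
Qed.

Let J_cst t t' : 0 < t < 1 -> 0 < t' < 1 -> J t = J t'.
Proof.
wlog tt : t t' / t < t'.
  move=> h t01 t01'; have [e|e|->//] := ltgtP t t'; first exact: h.
  exact/esym/h.
move=> /andP[t0 t1] /andP[t0' t1'].
have aux (p : R[i] -> R) : (forall x : R, 0 < x < 1 -> is_derive x (1 : R) (fun x => p (J x)) 0) ->
    p (J t) = p (J t').
  move=> dp; apply/eqP; rewrite -subr_eq0 -oppr_eq0 opprB; apply/eqP.
  have d (x : R) : t <= x <= t' -> is_derive x (1 : R) (fun x => p (J x)) 0.
    by move=> /andP[x1 x2]; apply: dp; rewrite (lt_le_trans t0)// (le_lt_trans x2).
  have [||x _ ->] := @MVT _ (fun x => p (J x)) (cst 0) t t' tt.
  - by move=> x; rewrite in_itv/= => /andP[x1 x2]; apply: d; rewrite !ltW.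
  - apply: derivable_within_continuous => x; rewrite in_itv/= => xtt.
    by have [] := d x xtt.
  - by rewrite mul0r.
by apply: cplx_eq; [apply: (aux (@complex.Re R))|apply: (aux (@complex.Im R))] => x /is_cderive_J[].
Qed.

Variable kappa : R.
Hypotheses (kappa_beta : kappa <= Re beta) (kappa_le1 : kappa <= 1).
Hypothesis dominating : mu.-integrable P
  (EFin \o (fun r => expR ((Re alpha - 1) * ln r + (Re s - 1) * ln (u + r) - kappa * r))).

(** [Re (beta * zeta t)] is a convex combination of [Re beta] and [1], hence at
    least [kappa] on the whole path. *)
Let cvg_J (v : nat -> R) (G : R -> R[i]) : (forall n, 0 < v n < 1) ->
  (forall r, 0 < r -> ccvg (fun n => F (v n) r) (G r)) ->
  cintegrable mu P G /\ cintegral mu P G = J (1 / 2).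
Proof.
move=> v01 FG; have [C hC] := F_bound.
have C0 : 0 <= C.
  have := le_trans (cmod_ge0 _) (hC 0 1 _ ltr01); rewrite lexx ler01 => /(_ isT).
  by rewrite pmulr_lge0// expR_gt0.
have [] := @dominated_cvg_cintegral _ _ _ mu P (fun n => F (v n)) G
  (fun r => C * expR ((Re alpha - 1) * ln r + (Re s - 1) * ln (u + r) - kappa * r)) mP.
- by move=> n; exact/cmeasurable_F/tgt.
- by apply: eq_integrable (integrableZl mP C dominating).
- move=> n r; rewrite /= in_itv/= andbT => r0.
  apply: le_trans (hC (v n) r (tgt (v01 n)) r0) _.
  rewrite ler_wpM2l// ler_expR lerD2l lerN2 ler_wpM2r ?(ltW r0)//.
  have /andP[v0 v1] := v01 n.
  have h1 : (1 - v n) * kappa <= (1 - v n) * Re beta by rewrite ler_wpM2l// subr_ge0 ltW.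
  have h2 : v n * kappa <= v n * 1 by rewrite ler_wpM2l// ltW.
  lra.
- by move=> r; rewrite /= in_itv/= andbT; exact: FG.
move=> iG cv; split=> //; apply: ccvg_unique cv _.
have h01 : 0 < (1 / 2 : R) < 1 by apply/andP; split; lra.
under eq_fun do rewrite -[cintegral _ _ _]/(J _) (J_cst (v01 _) h01).
by split; exact: cvg_cst.
Qed.

(** Turning the ray of integration from the reals to the direction [1 / beta]:
    Cauchy's theorem for [w ^ (alpha - 1) (u + w) ^ (s - 1) exp (- beta w)]. *)
Lemma laplace_rotation : cintegral mu P laplace_integrand =
  cpow beta (- alpha - s + 1) * cintegral mu P (tricomi_integrand (beta * u%:C)).
Proof.
pose v : nat -> R := @harmonicS R.
have v01 : forall n, 0 < v n < 1 := @harmonicS01 R.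
have v_cvg0 : v n @[n --> \oo] --> (0 : R) := @cvg_harmonicS R.
have v'01 n : 0 < 1 - v n < 1.
  by have /andP[? ?] := v01 n; apply/andP; split; lra.
have v'_cvg1 : 1 - v n @[n --> \oo] --> (1 : R).
  rewrite -[X in _ --> X]subr0; apply: cvgB; [exact: cvg_cst|exact: v_cvg0].
have start r : 0 < r -> ccvg (fun n => F (v n) r) (laplace_integrand r).
  move=> r0; have t0 : 0 <= (0 : R) < 1 by rewrite lexx ltr01.
  have -> : laplace_integrand r = F 0 r.
    rewrite /laplace_integrand /F /L /zeta subr0 mul0r addr0 clog1 !mulr1.
    by rewrite -rmorphD clogR ?addr_gt0// mulr0 addr0.
  exact: ccvg_cderive (is_cderive_Ft t0 r0) v_cvg0.
(* on the imaginary axis the logarithm is only one-sidedly regular, so near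
   [t = 1] it is taken of [beta * zeta t] instead of [zeta t] *)
pose G t r := cexp ((alpha - 1) * (ln r)%:C + alpha * (clog (t%:C + (1 - t)%:C * beta) - clog beta)
  + (s - 1) * clog (u%:C + r%:C * zeta t) - beta * zeta t * r%:C).
have FG t r : 0 < t <= 1 -> F t r = G t r.
  move=> /andP[t0 t1]; rewrite /F /L /G -clog_div// -?betazeta; last first.
    by rewrite betazeta !creE mul0r subr0 ltr_pwDl// mulr_ge0// subr_ge0.
  by rewrite [beta * _]mulrC mulfK// mulrC.
have dG r : 0 < r -> exists d, is_cderive (G ^~ r) 1 d.
  move=> r0; have t1 : 0 <= (1 : R) <= 1 by rewrite ler01 lexx.
  have d1 := is_cderive_real (is_deriveB_fun (is_derive_cst (1 : R) (1 : R) 1) (is_derive_id (1 : R) 1)).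
  have d2 := is_cderiveD (is_cderive_id (1 : R)) (is_cderiveM d1 (is_cderive_cst beta 1)).
  have p1 : 0 < Re ((1 : R)%:C + (1 - 1)%:C * beta) by rewrite subrr mul0r addr0.
  eexists; apply: is_cderive_cexp; apply: is_cderiveB; last first.
    exact: is_cderiveM (is_cderiveZ _ (is_cderive_zeta 1)) (is_cderive_cst _ _).
  apply: is_cderiveD; last first.
    exact: is_cderiveZ (is_cderive_clog (Reshift_gt0 t1 (ltW r0)) (is_cderive_shift 1 r)).
  apply: is_cderiveD; first exact: is_cderive_cst.
  apply: is_cderiveZ; apply: is_cderiveB; last exact: is_cderive_cst.
  exact: is_cderive_clog p1 d2.
have stop r : 0 < r ->
    ccvg (fun n => F (1 - v n) r) (cpow beta (- alpha - s + 1) * tricomi_integrand (beta * u%:C) r).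
  move=> r0; have [d dGr] := dG r r0.
  have -> : cpow beta (- alpha - s + 1) * tricomi_integrand (beta * u%:C) r = G 1 r.
    have zr : 0 < Re (beta * u%:C + r%:C).
      by rewrite !creE mulr0 subr0 ltr_wpDl// mulr_ge0// ltW.
    rewrite /G subrr mul0r addr0 clog1 sub0r.
    have -> : u%:C + r%:C * zeta 1 = (beta * u%:C + r%:C) / beta.
      by rewrite /zeta subrr add0r mul1r; field.
    rewrite clog_div// betazeta subrr mul0r addr0 mul1r cpowE// -cexpD.
    by congr cexp; ring.
  have -> : (fun n => F (1 - v n) r) = (fun n => G (1 - v n) r).
    by apply/funext => n; apply: FG; have /andP[-> /ltW->] := v'01 n.
  exact: ccvg_cderive dGr v'_cvg1.
have [_ ->] := cvg_J v01 start; have [iT <-] := cvg_J v'01 stop.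
set k := cpow beta _ in iT *; have k0 : k != 0 by rewrite /k cpowE// cexp_neq0.
rewrite cintegralZ//; apply: eq_cintegrable (cintegrableZ k^-1 mP iT) => // r _.
by rewrite mulrA mulVf// mul1r.
Qed.
End Rotation.

(** * The binomial series *)

Section BinomialSeries.
Context {R : realType}.
Variable alpha : R[i].
Hypothesis alpha0 : 0 < Re alpha.

(** Coefficients of the binomial series of [(1 - v) ^ (alpha - 1)]. *)
Definition bincoef (n : nat) : R[i] := \prod_(0 <= k < n) (1 - alpha / k.+1%:R).

Lemma bincoefS n : bincoef n.+1 = bincoef n * (1 - alpha / n.+1%:R).
Proof. by rewrite /bincoef big_nat_recr. Qed.

Lemma bincoefE n :
  \prod_(0 <= j < n) (alpha - j.+1%:R) * ((-1) ^+ n / n`!%:R) = bincoef n.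
Proof.
elim: n => [|n IH]; first by rewrite /bincoef !big_nil expr0 fact0 !mul1r invr1.
rewrite bincoefS -IH big_nat_recr//= factS natrM exprS.
have n0 : (n.+1%:R : R[i]) != 0 by rewrite pnatr_eq0.
have f0 : (n`!%:R : R[i]) != 0 by rewrite pnatr_eq0 -lt0n fact_gt0.
move: n0 f0; move: (n.+1%:R : R[i]) (n`!%:R : R[i]) => x y x0 y0.
by field; rewrite x0 y0.
Qed.

Let c := bincoef.
Let d n := cmod (c n).

Let a := Re alpha.

(** Since [|1 - alpha / m| <= 1 - (a / 2) / m] for large [m], the quotients
    [|c_n| / (n + 1)] telescope. *)
Lemma bincoef_telescope : exists N0 : nat, forall n, (N0 <= n)%N ->
  a / 2 * (d n / n.+1%:R) <= d n - d n.+1.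
Proof.
pose m0 := (cmod alpha ^+ 2 + a ^+ 2 + a) / a.
exists (Num.truncn m0).+1 => n Nn.
have a0 : 0 < a := alpha0.
have mm : m0 <= n.+1%:R.
  apply/ltW/(lt_le_trans (truncnS_gt m0)).
  by rewrite ler_nat (leq_trans Nn).
have m1 : cmod alpha ^+ 2 + a ^+ 2 + a <= n.+1%:R * a by rewrite -ler_pdivrMr.
have m2 : 0 < n.+1%:R :> R by [].
have q2 : 0 <= cmod alpha ^+ 2 by rewrite sqr_ge0.
have a2 : 0 <= a ^+ 2 by rewrite sqr_ge0.
suff h : cmod (1 - alpha / n.+1%:R) <= 1 - a / 2 / n.+1%:R.
  rewrite /d /c bincoefS cmodM; have := ler_wpM2l (cmod_ge0 (bincoef n)) h.
  have -> : a / 2 * (cmod (bincoef n) / n.+1%:R) = cmod (bincoef n) * (a / 2 / n.+1%:R) by ring.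
  by rewrite mulrBr mulr1 lerBrDr addrC -lerBrDr.
have r0 : 0 <= 1 - a / 2 / n.+1%:R.
  rewrite subr_ge0 ler_pdivrMr// mul1r.
  have : a + 1 <= n.+1%:R by rewrite -(ler_pM2r a0) mulrDl mul1r -expr2; lra.
  lra.
rewrite -(@ler_pXn2r _ 2)// ?nnegrE ?cmod_ge0// sqr_cmod.
have nC : (n.+1%:R : R[i]) = (n.+1%:R : R)%:C by exact: natrC.
have RV : Re (n.+1%:R : R[i])^-1 = (n.+1%:R : R)^-1 by rewrite nC -fmorphV.
have IV : Im (n.+1%:R : R[i])^-1 = 0 by rewrite nC -fmorphV.
rewrite cReD cImD cReN cImN cRe1 cIm1 sub0r cReM cImM RV IV !mulr0 subr0 add0r.
rewrite -/a; set i := (n.+1%:R : R)^-1.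
have i0 : 0 < i by rewrite invr_gt0.
have e : (1 - a / 2 * i) ^+ 2 - ((1 - a * i) ^+ 2 + (- (Im alpha * i)) ^+ 2) =
   i * (a + i * (a ^+ 2 / 4 - cmod alpha ^+ 2)).
  by rewrite sqr_cmod -/a; field.
rewrite -subr_ge0 e mulr_ge0 ?ltW//.
have ni : i * n.+1%:R = 1 by rewrite mulVf// gt_eqF.
have : i * (cmod alpha ^+ 2 + a ^+ 2 + a) <= i * (n.+1%:R * a) by rewrite ler_wpM2l// ltW.
rewrite mulrA ni mul1r; have := mulr_ge0 (ltW i0) a2; have := mulr_ge0 (ltW i0) (ltW a0).
nra.
Qed.

Lemma bincoef_bounded : exists D, forall n, d n <= D.
Proof.
have [N0 h] := bincoef_telescope.
have dec n : (N0 <= n)%N -> d n.+1 <= d n.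
  move=> Nn; rewrite -subr_ge0; apply: le_trans (h n Nn).
  by rewrite mulr_ge0 ?divr_ge0 ?cmod_ge0 ?(ltW alpha0).
exists (\sum_(i < N0.+1) d i) => n.
have [nN|Nn] := leqP n N0.
  have nN' : (n < N0.+1)%N by [].
  rewrite (bigD1 (Ordinal nN'))//= lerDl sumr_ge0// => i _; exact: cmod_ge0.
have dN k : d (N0 + k) <= d N0.
  elim: k => [|k IH]; first by rewrite addn0.
  by rewrite addnS; apply: le_trans IH; apply: dec; rewrite leq_addr.
rewrite -(subnKC (ltnW Nn)); apply: le_trans (dN _) _.
by rewrite big_ord_recr/= lerDr sumr_ge0// => i _; exact: cmod_ge0.
Qed.

Definition binsum (N : nat) (v : R[i]) : R[i] := \sum_(n < N) c n * v ^+ n.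

Lemma binsum_bounded : exists D, forall N v, cmod v < 1 ->
  cmod (binsum N v) <= D / (1 - cmod v).
Proof.
have [D hD] := bincoef_bounded; exists D => N v v1.
have D0 : 0 <= D by apply: le_trans (hD 0%N); exact: cmod_ge0.
have v0 : 0 < 1 - cmod v by rewrite subr_gt0.
apply: le_trans (ler_cmod_sum _ _ _) _.
have : \sum_(i < N) cmod (c i * v ^+ i) <= \sum_(i < N) D * cmod v ^+ i.
  apply: ler_sum => i _; rewrite cmodM cmodX ler_wpM2r//; last exact: hD.
  by rewrite exprn_ge0// cmod_ge0.
move=> h; apply: le_trans h _; rewrite -mulr_sumr ler_wpM2l// -[leRHS]mul1r ler_pdivlMr//.
have -> : (\sum_(i < N) cmod v ^+ i) * (1 - cmod v) = 1 - cmod v ^+ N.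
  elim: N => [|N IH]; first by rewrite big_ord0 expr0 mul0r subrr.
  by rewrite big_ord_recr /= mulrDl IH exprS; ring.
by rewrite lerBlDr lerDl exprn_ge0// cmod_ge0.
Qed.

Section Ray.
Variable v : R[i].
Hypothesis v1 : cmod v < 1.

Let E (t : R) : R[i] := cexp ((1 - alpha) * clog (1 - t%:C * v)).

Let tv t : 0 <= t <= 1 -> cmod (t%:C * v) <= cmod v.
Proof.
by move=> /andP[t0 t1]; rewrite cmodM cmodR ger0_norm// ler_piMl ?cmod_ge0.
Qed.

Let Re1tv t : 0 <= t <= 1 -> 1 - cmod v <= Re (1 - t%:C * v).
Proof.
move=> /tv h; rewrite cReD cReN cRe1 lerD2l lerN2.
by apply: le_trans (ler_norm _) _; apply: le_trans (normRe_cmod _) h.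
Qed.

Let Re1tv_gt0 t : 0 <= t <= 1 -> 0 < Re (1 - t%:C * v).
Proof. by move=> /Re1tv; apply: lt_le_trans; rewrite subr_gt0. Qed.

Let is_cderive_E t : 0 <= t <= 1 ->
  is_cderive E t (E t * ((1 - alpha) * (- v / (1 - t%:C * v)))).
Proof.
move=> t01; apply: is_cderive_cexp; apply: is_cderiveZ; apply: is_cderive_clog.
  exact: Re1tv_gt0.
apply: is_cderive_eq (is_cderiveB (is_cderive_cst _ _) (is_cderiveM (is_cderive_id t) (is_cderive_cst v t))) _.
by rewrite mulr0 addr0 mul1r sub0r.
Qed.

Let phi N (t : R) : R[i] := binsum N (t%:C * v) * E t.

(** The binomial polynomials almost solve the equation
    [(1 - v) T' = (1 - alpha) T] of the binomial function. *)
Let is_cderive_phi N t : 0 <= t <= 1 ->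
  is_cderive (phi N) t (- (N%:R * c N * v ^+ N * t%:C ^+ N.-1) * (E t / (1 - t%:C * v))).
Proof.
move=> t01; elim: N => [|N IH].
  rewrite /phi /binsum; under eq_fun do rewrite big_ord0 mul0r.
  by rewrite !mul0r oppr0 mul0r; exact: is_cderive_cst.
rewrite /phi /binsum; under eq_fun do rewrite big_ord_recr /= mulrDl.
have dp := is_cderiveX N (is_cderiveM (is_cderive_id t) (is_cderive_cst v t)).
have d1 := is_cderiveM (is_cderiveZ (c N) dp) (is_cderive_E t01).
apply: is_cderive_eq (is_cderiveD IH d1) _.
have w0 : 1 - t%:C * v != 0.
  by have := Re1tv_gt0 t01; apply: contraTneq => ->; rewrite ltxx.
have n0 : (N.+1%:R : R[i]) != 0 by rewrite pnatr_eq0.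
have cS : N.+1%:R * c N.+1 = (N.+1%:R - alpha) * c N.
  by rewrite /c bincoefS; field.
rewrite cS mulr0 addr0 mul1r /= !exprMn -natr1.
case: N {IH dp d1 cS n0} => [|N] /=.
  by rewrite !expr0 expr1; field.
by rewrite -natr1 !exprS; field.
Qed.

Let quot_bound : exists B, 0 <= B /\ forall t, 0 <= t <= 1 ->
  cmod (E t / (1 - t%:C * v)) <= B.
Proof.
have dl : 0 < 1 - cmod v by rewrite subr_gt0.
pose K := ln 2 - ln (1 - cmod v).
pose B := expR (`|Re (1 - alpha)| * K + `|Im (1 - alpha)| * (pi / 2)) / (1 - cmod v).
exists B; split; first by rewrite divr_ge0 ?expR_ge0 ?ltW.
move=> t t01; have r1 := Re1tv t01.
have c1 : 1 - cmod v <= cmod (1 - t%:C * v).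
  by apply: le_trans r1 _; apply: le_trans (ler_norm _) (normRe_cmod _).
have c0 := lt_le_trans dl c1.
have c2 : cmod (1 - t%:C * v) <= 2.
  apply: le_trans (ler_cmodB _ _) _; rewrite cmod1.
  by have := tv t01; move: v1; lra.
rewrite cmodM cmodV; apply: ler_pM; rewrite ?invr_ge0 ?cmod_ge0//; last first.
  by rewrite lef_pV2 ?posrE.
rewrite cmod_cexp ler_expR -[leRHS]add0r -[X in _ <= X + _](mulr0 (Re (1 - alpha))).
apply: cmod_cexp_clog_le; first exact/ltW/Re1tv_gt0.
have l1 : ln (1 - cmod v) <= ln (cmod (1 - t%:C * v)) by rewrite ler_ln ?posrE.
have l2 : ln (cmod (1 - t%:C * v)) <= ln 2 by rewrite ler_ln ?posrE.
have l3 : ln (1 - cmod v) <= 0 by apply: ln_le0; rewrite lerBlDr lerDl cmod_ge0.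
have l4 : 0 <= ln (2 : R) by rewrite ln_ge0// ler1n.
by rewrite subr0 ler_norml /K; apply/andP; split; lra.
Qed.

Let rho := cmod v.

Let nat_geometric : (N%:R * rho ^+ N) @[N --> \oo] --> (0 : R).
Proof.
have rho0 : 0 <= rho := cmod_ge0 v.
have [r0|r0] := eqVneq rho 0.
  have -> : (fun N => N%:R * rho ^+ N) = (fun=> 0).
    by apply/funext => -[|N]; rewrite ?mul0r// r0 expr0n mulr0.
  exact: cvg_cst.
have rp : 0 < rho by rewrite lt_def r0.
have lr : ln rho < 0 by apply: ln_lt0; rewrite rp.
have k0 : 0 < - ln rho / 2 by rewrite divr_gt0// oppr_gt0.
have [K hK] := mul_ln_sub_linear_bounded 1 ltr01 k0.
apply: (@squeeze_cvgr _ _ _ _ (cst 0) (fun N => expR K * expR (ln rho / 2) ^+ N)).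
- apply: nearW => -[|N]; rewrite /= ?mul0r ?expr0 ?mulr1 ?lexx ?expR_ge0//.
  rewrite mulr_ge0 ?exprn_ge0//=.
  apply: (@le_trans _ _ ((1 + N.+1%:R) * rho ^+ N.+1)).
    by rewrite ler_wpM2r ?exprn_ge0// lerDr.
  have N0 : 0 < N.+1%:R :> R by [].
  rewrite -[1 + _]lnK ?posrE ?addr_gt0// -[rho in leLHS]lnK ?posrE//.
  rewrite -!expRM_natr -!expRD ler_expR.
  by have := hK _ N0; lra.
- exact: cvg_cst.
- rewrite -(mulr0 (expR K)); apply: cvgMr; apply: cvg_expr.
  rewrite ger0_norm ?expR_ge0// -[ltRHS]expR0 ltr_expR; lra.
Qed.

Let phi_cvg : ccvg (fun N => phi N 1 - 1) 0.
Proof.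
have [B [B0 hB]] := quot_bound; have [D hD] := bincoef_bounded.
apply: (@ccvg0_le _ _ (fun N => cmod (phi N 1 - 1))) => //.
rewrite -cvg_shiftS /=.
apply: (@squeeze_cvgr _ _ _ _ (cst 0)
  (fun N => (2 * D * B) * (N.+1%:R * rho ^+ N.+1))).
- apply: nearW => N /=; rewrite cmod_ge0 /=.
  have p0 : phi N.+1 0 = 1.
    rewrite /phi /binsum big_ord_recl /= big1 => [|i _]; last first.
      by rewrite mul0r expr0n mulr0.
    by rewrite /c /bincoef big_nil mul0r expr0 mulr1 addr0 mul1r /E mul0r subr0 clog1 mulr0 cexp0.
  pose b := D * B * (N.+1%:R * rho ^+ N.+1).
  have db t : 0 <= t <= 1 ->
      cmod (- (N.+1%:R * c N.+1 * v ^+ N.+1 * t%:C ^+ N.+1.-1) * (E t / (1 - t%:C * v))) <= b.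
    move=> t01; rewrite cmodM cmodN !cmodM !cmodX cmod_nat cmodR.
    have /andP[t0 t1] := t01.
    have h1 : `|t| ^+ N.+1.-1 <= 1 by rewrite ger0_norm// exprn_ile1.
    have h2 := hB t t01; have h3 := hD N.+1.
    have n0 : 0 <= N.+1%:R * rho ^+ N.+1 by rewrite mulr_ge0 ?exprn_ge0 ?cmod_ge0.
    rewrite -cmodM; have -> : b = (N.+1%:R * D * rho ^+ N.+1 * 1) * B by rewrite /b; ring.
    apply: ler_pM; rewrite ?cmod_ge0// ?mulr_ge0 ?exprn_ge0 ?cmod_ge0//.
    apply: ler_pM; rewrite ?cmod_ge0// ?mulr_ge0 ?exprn_ge0 ?cmod_ge0//.
    by rewrite ler_wpM2r ?exprn_ge0 ?cmod_ge0// ler_wpM2l.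
  have mv (p : R[i] -> R) : (forall (G : R -> R[i]) x d, is_cderive G x d ->
      is_derive x (1 : R) (fun y => p (G y)) (p d)) -> (forall z, `|p z| <= cmod z) ->
      `|p (phi N.+1 1) - p (phi N.+1 0)| <= b.
    move=> dp pc.
    pose dp' (t : R) := p (- (N.+1%:R * c N.+1 * v ^+ N.+1 * t%:C ^+ N.+1.-1) *
      (E t / (1 - t%:C * v))).
    have dphi (x : R) : 0 <= x <= 1 -> is_derive x (1 : R) (fun y => p (phi N.+1 y)) (dp' x).
      by move=> x01; exact: dp (is_cderive_phi N.+1 x01).
    have [||x] := @MVT _ (fun y => p (phi N.+1 y)) dp' 0 1 ltr01.
    - by move=> x; rewrite in_itv/= => /andP[x0 x1]; apply: dphi; rewrite !ltW.
    - apply: derivable_within_continuous => x; rewrite in_itv/= => x01.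
      by have [] := dphi x x01.
    - rewrite in_itv/= => /andP[x0 x1] ->; rewrite subr0 mulr1.
      by apply: le_trans (pc _) (db x _); rewrite !ltW.
  rewrite -p0; apply: le_trans (cmod_le_ReIm _) _; rewrite !cReD !cImD !cReN !cImN.
  have -> : 2 * D * B * (N.+1%:R * rho ^+ N.+1) = b + b by rewrite /b; ring.
  apply: lerD; apply: mv; [by move=> G x e []|exact: normRe_cmod|by move=> G x e []|exact: normIm_cmod].
- exact: cvg_cst.
- rewrite -(mulr0 (2 * D * B)); apply: cvgMr.
  by rewrite (cvg_shiftS (fun N => N%:R * rho ^+ N)).
Qed.

(** [T_N(t v) * (1 - t v) ^ (1 - alpha)] has value [1] at [t = 0] and a derivative
    of order [N |v| ^ N], so that the mean value inequality gives the limit. *)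
Lemma cvg_binsum : ccvg (fun N => binsum N v) (cexp ((alpha - 1) * clog (1 - v))).
Proof.
have E1 : E 1 = cexp ((1 - alpha) * clog (1 - v)) by rewrite /E mul1r.
have := ccvgM_cst (E 1)^-1 (ccvgD phi_cvg (ccvg_cst 1)).
rewrite add0r mulr1 E1 -cexpN -mulNr opprB.
have -> // : (fun N => cexp ((alpha - 1) * clog (1 - v)) * (phi N 1 - 1 + 1)) =
    (fun N => binsum N v).
apply/funext => N; rewrite subrK /phi E1 mulrCA -cexpD.
have -> : (alpha - 1) * clog (1 - v) + (1 - alpha) * clog (1 - v) = 0 by ring.
by rewrite cexp0 mulr1 mul1r.
Qed.
End Ray.
End BinomialSeries.

(** * Moments of z / (z + x) *)

Section HalfLineShift.
Context {R : realType}.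
Local Notation mu := (@lebesgue_measure R).
Local Notation P := (`](0 : R), +oo[%classic : set (measurableTypeR R)).
Variable z : R[i].
Hypotheses (z_ge0 : 0 <= Re z) (z0 : z != 0).
Implicit Types (p q : R[i]) (x : R).

Let mP : measurable P. Proof. exact: measurable_itv. Qed.

(** The integrand [(z + x) ^ p exp (- x)] of [exp z * Gamma (p + 1, z)]. *)
Definition upper_gamma_integrand p x : R[i] := cexp (p * clog (z + x%:C) - x%:C).

Lemma Re_shift_gt0 x : 0 < x -> 0 < Re (z + x%:C).
Proof. by move=> x0; rewrite cReD cReR ltr_wpDl. Qed.

Lemma shift_neq0 x : 0 < x -> z + x%:C != 0.
Proof. by move=> /Re_shift_gt0; apply: contraTneq => ->; rewrite ltxx. Qed.

Lemma is_cderive_shift x : is_cderive (fun x => z + x%:C) x 1.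
Proof.
apply: is_cderive_eq (is_cderiveD (is_cderive_cst z x) (is_cderive_id x)) _.
by rewrite add0r.
Qed.

Lemma is_cderive_upper_gamma_integrand p x : 0 < x ->
  is_cderive (upper_gamma_integrand p) x
    (p * upper_gamma_integrand (p - 1) x - upper_gamma_integrand p x).
Proof.
move=> x0; apply: is_cderive_eq.
  apply: is_cderive_cexp; apply: is_cderiveB; last exact: is_cderive_id.
  apply: is_cderiveZ; apply: is_cderive_clog; first exact: Re_shift_gt0.
  exact: is_cderive_shift.
have e : (p - 1) * clog (z + x%:C) - x%:C = (p * clog (z + x%:C) - x%:C) - clog (z + x%:C).
  by ring.
rewrite /upper_gamma_integrand e (cexpB (p * _ - _)) cexp_clog ?shift_neq0//.
by rewrite div1r; ring.
Qed.

Lemma cmod_shift_power_le p : exists C, 0 <= C /\ forall x, 0 < x ->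
  cmod (cexp (p * clog (z + x%:C))) <= C * expR (Re p * ln (1 + x)).
Proof.
pose c := Num.min 1 (cmod z); pose M := Num.max 1 (cmod z).
have zp : 0 < cmod z by rewrite cmod_gt0.
have c0 : 0 < c by rewrite lt_min ltr01.
have c1 : c <= 1 by rewrite ge_min lexx.
have cz : c <= cmod z by rewrite ge_min lexx orbT.
have M1 : 1 <= M by rewrite le_max lexx.
have zM : cmod z <= M by rewrite le_max lexx orbT.
exists (expR (`|Re p| * (ln M - ln (c / 2)) + `|Im p| * (pi / 2))).
split=> [|x x0]; first exact: expR_ge0.
rewrite -expRD cmod_cexp ler_expR [leRHS]addrC; apply: cmod_cexp_clog_le.
  exact/ltW/Re_shift_gt0.
have := ln_cmod_cone z_ge0 x0 ler01 c0 c1 cz M1 zM.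
by rewrite mul1r [x%:C + z]addrC [x + 1]addrC.
Qed.

Lemma cmod_upper_gamma_integrandE p x :
  cmod (upper_gamma_integrand p x) = cmod (cexp (p * clog (z + x%:C))) * expR (- x).
Proof. by rewrite /upper_gamma_integrand cexpD cmodM [in X in _ * X]cmod_cexp !creE. Qed.

Lemma cmod_upper_gamma_integrand_le p : exists C, 0 <= C /\ forall x, 0 < x ->
  cmod (upper_gamma_integrand p x) <= C * expR (0 * ln x + Re p * ln (1 + x) - 1 * x).
Proof.
have [C [C0 hC]] := cmod_shift_power_le p; exists C; split=> // x x0.
rewrite cmod_upper_gamma_integrandE mul0r add0r mul1r expRD mulrA.
by rewrite ler_wpM2r ?expR_ge0// hC.
Qed.

Lemma cmeasurable_upper_gamma_integrand p : cmeasurable P (upper_gamma_integrand p).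
Proof.
by apply: cmeasurable_halfline => x x0; eexists; exact: is_cderive_upper_gamma_integrand.
Qed.

Lemma cintegrable_upper_gamma_integrand p : cintegrable mu P (upper_gamma_integrand p).
Proof.
have [C [C0 hC]] := cmod_upper_gamma_integrand_le p.
have N10 : -1 < 0 :> R by rewrite ltrN10.
have ie := integrable_power_exp (Re p) N10 ltr01 ltr01.
have iCe : mu.-integrable P (EFin \o (fun x => C * expR (0 * ln x + Re p * ln (1 + x) - 1 * x))).
  by apply: eq_integrable (integrableZl mP C ie).
apply: (cintegrable_le mP (cmeasurable_upper_gamma_integrand p) iCe).
by move=> x; rewrite /= in_itv/= andbT; exact: hC.
Qed.

Lemma upper_gamma_integrand_bounded p : exists M, forall x, 0 < x ->
  cmod (upper_gamma_integrand p x) <= M.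
Proof.
have [C [C0 hC]] := cmod_upper_gamma_integrand_le p.
have [K hK] := mul_ln_sub_linear_bounded (Re p) ltr01 (@ltr01 R).
exists (C * expR K) => x x0; apply: le_trans (hC x x0) _.
by rewrite ler_wpM2l// ler_expR mul0r add0r; exact: hK.
Qed.

Lemma upper_gammaE p : upper_gamma p z =
  cexp (- z) * cintegral mu P (upper_gamma_integrand (p - 1)).
Proof.
have e x : 0 < x -> cpow (z + x%:C) (p - 1) * cexp (- (z + x%:C)) =
    cexp (- z) * upper_gamma_integrand (p - 1) x.
  move=> x0; rewrite cpowE ?shift_neq0// /upper_gamma_integrand -!cexpD.
  by congr cexp; ring.
rewrite /upper_gamma cintegral_itv_cy; last first.
  apply: (@eq_cmeasurable _ _ _ _ (fun x => cexp (- z) * upper_gamma_integrand (p - 1) x)).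
    by move=> x; rewrite /= in_itv/= andbT => x0; rewrite e.
  apply: cmeasurableM; first exact: cmeasurable_cst.
  exact: cmeasurable_upper_gamma_integrand.
rewrite -cintegralZ//; last exact: cintegrable_upper_gamma_integrand.
by apply: eq_cintegral => x; rewrite /= in_itv/= andbT; exact: e.
Qed.

Definition shift_ratio x : R[i] := z / (z + x%:C).

Lemma cmod_shift_ratio_lt1 x : 0 < x -> cmod (shift_ratio x) < 1.
Proof.
move=> x0; have zx0 := shift_neq0 x0.
rewrite cmodM cmodV ltr_pdivrMr ?cmod_gt0// mul1r.
rewrite -(@ltr_pXn2r _ 2)// ?nnegrE ?cmod_ge0// !sqr_cmod !creE addr0.
have := mulr_ge0 z_ge0 (ltW x0); have := mulr_gt0 x0 x0; nra.
Qed.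

Lemma shift_ratio_power q n x : 0 < x ->
  z ^+ n * upper_gamma_integrand (q - n%:R) x =
  shift_ratio x ^+ n * upper_gamma_integrand q x.
Proof.
move=> x0; have e : (q - n%:R) * clog (z + x%:C) - x%:C =
  (q * clog (z + x%:C) - x%:C) - n%:R * clog (z + x%:C) by ring.
rewrite /upper_gamma_integrand e (cexpB (q * _ - _)) cexp_natM cexp_clog ?shift_neq0//.
by rewrite /shift_ratio expr_div_n; ring.
Qed.

(** The integrals of the powers of [z / (z + x)] decay like [1 / n]; on the
    imaginary axis this rests on an integration by parts, because
    [|z / (z + x)| = 1 - O(x ^ 2)] there. *)
Lemma shift_ratio_moment_le q : exists C, forall n : nat,
  n.+1%:R * cmod (z ^+ n * cintegral mu P (upper_gamma_integrand (q - n%:R))) <= C.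
Proof.
have [M hM] := upper_gamma_integrand_bounded (q + 1).
have i1 := integrable_cmod mP (cintegrable_upper_gamma_integrand (q + 1)).
have i0 := integrable_cmod mP (cintegrable_upper_gamma_integrand q).
pose I1 := Rintegral mu P (fun x => cmod (upper_gamma_integrand (q + 1) x)).
pose I0 := Rintegral mu P (fun x => cmod (upper_gamma_integrand q x)).
exists (2 * I1 + 4 * M + cmod (q + 2) * (2 * I0)) => n.
pose F p x := z ^+ n * upper_gamma_integrand (p - n%:R) x.
have Fle p x : 0 < x -> cmod (F p x) <= cmod (upper_gamma_integrand p x).
  move=> x0; rewrite /F shift_ratio_power// cmodM ler_piMl ?cmod_ge0//.
  by rewrite cmodX exprn_ile1 ?cmod_ge0// ltW// cmod_shift_ratio_lt1.
have iF p : cintegrable mu P (F p) := cintegrableZ _ mP (cintegrable_upper_gamma_integrand _).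
have IF p : cintegral mu P (F p) = z ^+ n * cintegral mu P (upper_gamma_integrand (p - n%:R)).
  exact: cintegralZ mP (cintegrable_upper_gamma_integrand _).
rewrite -IF; set G := cintegral mu P (F q); set H := cintegral mu P (F (q + 1)).
have hG : cmod G <= 2 * I0.
  by apply: cmod_cintegral_le i0 _ => // x; rewrite /= in_itv/= andbT; exact: Fle.
have hH : cmod H <= 2 * I1.
  by apply: cmod_cintegral_le i1 _ => // x; rewrite /= in_itv/= andbT; exact: Fle.
pose F' x := (q + 1 - n%:R) * F q x + (-1) * F (q + 1) x.
have iF' : cintegrable mu P F' by apply: cintegrableD => //; exact: cintegrableZ.
have eF' : cintegral mu P F' = (q + 1 - n%:R) * G - H.
  rewrite cintegralD//; [|exact: cintegrableZ..].
  by rewrite (cintegralZ _ mP (iF q)) (cintegralZ _ mP (iF (q + 1))) mulN1r.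
have hF' : cmod (cintegral mu P F') <= 4 * M.
  apply: (@cmod_improper_cFTC_le _ (F (q + 1))) iF' _ => x x0.
  - apply: is_cderive_eq (is_cderiveZ _ (is_cderive_upper_gamma_integrand _ x0)) _.
    by rewrite /F' /F (_ : q + 1 - n%:R - 1 = q - n%:R); ring.
  - eexists; apply: is_cderiveD; apply: is_cderiveZ; apply: is_cderiveZ;
    exact: is_cderive_upper_gamma_integrand.
  - by apply: le_trans (Fle _ _ x0) (hM x x0).
have nG : n.+1%:R * G = (q + 2) * G - (cintegral mu P F' + H).
  by rewrite eF' -natr1; ring.
have -> : n.+1%:R * cmod G = cmod (n.+1%:R * G) by rewrite cmodM cmod_nat.
rewrite nG; apply: le_trans (ler_cmodB _ _) _.
rewrite addrC; apply: lerD.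
  by apply: le_trans (ler_cmodD _ _) _; rewrite addrC; exact: lerD.
by rewrite cmodM ler_wpM2l// cmod_ge0.
Qed.
End HalfLineShift.

(** * Summation of the incomplete gamma series *)

Section TricomiSeries.
Context {R : realType}.
Local Notation mu := (@lebesgue_measure R).
Local Notation P := (`](0 : R), +oo[%classic : set (measurableTypeR R)).
Variables (alpha s z : R[i]).
Hypotheses (alpha0 : 0 < Re alpha) (z_ge0 : 0 <= Re z) (z0 : z != 0).

Let mP : measurable P. Proof. exact: measurable_itv. Qed.

Let q := alpha + s - 2.
Let a := Re alpha.
Let w := shift_ratio z.
Let k := upper_gamma_integrand z.
Let G n := z ^+ n * cintegral mu P (k (q - n%:R)).
Let c := bincoef alpha.
Let d n := cmod (c n).

Let Fr (r x : R) : R[i] := cexp ((alpha - 1) * clog (1 - r%:C * w x)) * k q x.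
Let S N (r : R) : R[i] := \sum_(n < N) c n * r%:C ^+ n * G n.

Let cmod_rw r x : 0 <= r -> r <= 1 -> 0 < x -> cmod (r%:C * w x) <= r.
Proof.
move=> r0 r1 x0; rewrite cmodM cmodR ger0_norm// ler_piMr//.
exact/ltW/cmod_shift_ratio_lt1.
Qed.

Let cmod_rw_lt1 r x : 0 <= r -> r <= 1 -> 0 < x -> cmod (r%:C * w x) < 1.
Proof.
move=> r0 r1 x0; rewrite cmodM cmodR ger0_norm//.
have := cmod_shift_ratio_lt1 z_ge0 x0; rewrite -/(w x); have := cmod_ge0 (w x).
nra.
Qed.

Let Re1_gt0 (v : R[i]) : cmod v < 1 -> 0 < Re (1 - v).
Proof.
move=> v1; rewrite cReD cReN cRe1 subr_gt0.
by apply: le_lt_trans (ler_norm _) _; apply: le_lt_trans (normRe_cmod _) v1.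
Qed.

(** For [r < 1] the series converges geometrically and may be integrated term
    by term. *)
Let cvg_S r : 0 <= r < 1 ->
  cintegrable mu P (Fr r) /\ ccvg (fun N => S N r) (cintegral mu P (Fr r)).
Proof.
move=> /andP[r0 r1].
have [D hD] := binsum_bounded alpha0.
pose T M x := \sum_(n < M) (c n * r%:C ^+ n * z ^+ n) * k (q - n%:R) x.
have ik p := cintegrable_upper_gamma_integrand z_ge0 z0 p.
have iT n : cintegrable mu P (fun x => (c n * r%:C ^+ n * z ^+ n) * k (q - n%:R) x).
  exact: cintegrableZ.
have TE M x : 0 < x -> T M x = binsum alpha M (r%:C * w x) * k q x.
  move=> x0; rewrite /T /binsum mulr_suml; apply: eq_bigr => n _.
  by rewrite -!mulrA (shift_ratio_power z_ge0)// (exprMn _ r%:C) !mulrA.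
have IT M : cintegral mu P (T M) = S M r.
  apply: etrans (cintegral_sum M mP iT) _.
  by apply: eq_bigr => n _; rewrite cintegralZ// /G !mulrA.
have iD := integrableZl mP (D / (1 - r)) (integrable_cmod mP (ik q)).
have r1' : 0 < 1 - r by rewrite subr_gt0.
have D0 : 0 <= D.
  have := hD 0%N 0; rewrite cmod0 subr0 divr1 ltr01 => /(_ isT).
  by apply: le_trans; exact: cmod_ge0.
have [] := @dominated_cvg_cintegral _ _ _ mu P T (Fr r) (fun x => D / (1 - r) * cmod (k q x)) mP.
- move=> M; apply: cintegrable_measurable; exact: (cintegrable_sum M mP iT).
- by apply: eq_integrable iD.
- move=> M x; rewrite /= in_itv/= andbT => x0; rewrite TE// cmodM ler_wpM2r ?cmod_ge0//.
  apply: le_trans (hD M _ (cmod_rw_lt1 r0 (ltW r1) x0)) _.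
  have h := cmod_rw r0 (ltW r1) x0.
  rewrite ler_wpM2l// lef_pV2 ?posrE//; last first.
    by rewrite subr_gt0; exact: cmod_rw_lt1 r0 (ltW r1) x0.
  by rewrite lerD2l lerN2.
- move=> x; rewrite /= in_itv/= andbT => x0.
  have h := ccvgM_cst (k q x) (cvg_binsum alpha0 (cmod_rw_lt1 r0 (ltW r1) x0)).
  rewrite /Fr mulrC.
  have -> // : (fun M => T M x) = (fun M => k q x * binsum alpha M (r%:C * w x)).
  by apply/funext => M; rewrite TE// mulrC.
move=> iF; rewrite (_ : (fun n => cintegral mu P (T n)) = (fun N => S N r)) //.
by apply/funext => M; rewrite IT.
Qed.

(** [|1 - r w|] stays above [|1 - w| / 2], which makes the boundary singularity
    at [w = 1] uniformly integrable in [r]. *)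
Let Fr_dominated : exists h : R -> R, mu.-integrable P (EFin \o h) /\
  forall r x, 0 <= r < 1 -> 0 < x -> cmod (Fr r x) <= h x.
Proof.
have [C1 [C10 hC1]] := cmod_upper_gamma_integrand_le z_ge0 z0 q.
have [C2 [C20 hC2]] := cmod_shift_power_le z_ge0 z0 (q + (1 - a)%:C).
pose K := expR (`|a - 1| * ln 2 + `|Im alpha| * (pi / 2)).
pose e1 x := expR (0 * ln x + Re q * ln (1 + x) - 1 * x).
pose e2 x := expR ((a - 1) * ln x + Re (q + (1 - a)%:C) * ln (1 + x) - 1 * x).
have a1 : -1 < a - 1 by have := alpha0; rewrite /a; lra.
have N10 : -1 < 0 :> R by rewrite ltrN10.
have ie1 := integrable_power_exp (Re q) N10 ltr01 ltr01.
have ie2 := integrable_power_exp (Re (q + (1 - a)%:C)) a1 ltr01 ltr01.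
exists (fun x => K * C1 * e1 x + K * C2 * e2 x); split.
  by apply: eq_integrable (integrableD mP (integrableZl mP (K * C1) ie1) (integrableZl mP (K * C2) ie2)).
move=> r x /andP[r0 r1] x0.
have zx := shift_neq0 z_ge0 x0.
have zxm : 0 < cmod (z + x%:C) by rewrite cmod_gt0.
set y := cmod (1 - r%:C * w x).
have ReY : 0 < Re (1 - r%:C * w x) by apply: Re1_gt0; exact: cmod_rw_lt1 r0 (ltW r1) x0.
have y0 : 0 < y by rewrite cmod_gt0; apply: contraTneq ReY => ->; rewrite ltxx.
have hrw := cmod_rw r0 (ltW r1) x0.
have y2 : y <= 2.
  by apply: le_trans (ler_cmodB _ _) _; rewrite cmod1; lra.
have w1E : cmod (1 - w x) = x / cmod (z + x%:C).
  rewrite /w /shift_ratio; have -> : 1 - z / (z + x%:C) = x%:C / (z + x%:C) by field.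
  by rewrite cmodM cmodV cmodR ger0_norm// ltW.
have w1p : 0 < cmod (1 - w x) by rewrite w1E divr_gt0.
have y1 : cmod (1 - w x) / 2 <= y.
  have h1 : cmod (1 - w x) <= y + (1 - r) * cmod (w x).
    have -> : 1 - w x = (1 - r%:C * w x) - (1 - r)%:C * w x by rewrite rmorphB; ring.
    apply: le_trans (ler_cmodB _ _) _; rewrite [in X in _ + X]cmodM cmodR ger0_norm//.
    by rewrite subr_ge0 ltW.
  have h2 : 1 - r <= y.
    have := ler_cmodD (1 - r%:C * w x) (r%:C * w x).
    by rewrite subrK cmod1 -/y; lra.
  have h3 : cmod (w x) < 1 by exact: cmod_shift_ratio_lt1.
  have := ler_wpM2l (ltW (_ : 0 < 1 - r)) (ltW h3); rewrite subr_gt0 => /(_ r1).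
  lra.
have lw : ln (cmod (1 - w x)) = ln x - ln (cmod (z + x%:C)).
  by rewrite w1E ln_div ?posrE.
have l2 : 0 <= ln (2 : R) by rewrite ln_ge0// ler1n.
have hy : expR ((a - 1) * ln y) <= expR (`|a - 1| * ln 2) *
    (1 + expR ((a - 1) * (ln x - ln (cmod (z + x%:C))))).
  rewrite -lw mulrDr mulr1 -expRD; have [a1'|a1'] := leP 0 (a - 1).
    rewrite ger0_norm// -[leLHS]addr0; apply: lerD; last exact: expR_ge0.
    by rewrite ler_expR ler_wpM2l// ler_ln ?posrE.
  rewrite ltr0_norm// -[leLHS]add0r; apply: lerD; first exact: expR_ge0.
  have : ln (cmod (1 - w x) / 2) <= ln y by rewrite ler_ln ?posrE ?divr_gt0.
  have -> : ln (cmod (1 - w x) / 2) = ln (cmod (1 - w x)) - ln 2 by apply: ln_div; rewrite posrE.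
  by move=> h; rewrite ler_expR; nra.
have hF : cmod (cexp ((alpha - 1) * clog (1 - r%:C * w x))) <=
    K * (1 + expR ((a - 1) * (ln x - ln (cmod (z + x%:C))))).
  have -> : K = expR (`|Im alpha| * (pi / 2)) * expR (`|a - 1| * ln 2).
    by rewrite /K expRD mulrC.
  rewrite -mulrA; apply: le_trans (ler_wpM2l (expR_ge0 _) hy).
  rewrite -expRD cmod_cexp ler_expR [leRHS]addrC.
  have := @cmod_cexp_clog_le _ (alpha - 1) (1 - r%:C * w x) (ln y) 0 (ltW ReY).
  rewrite -/y subrr normr0 lexx => /(_ isT).
  have -> : Re (alpha - 1) = a - 1 by rewrite !creE.
  have -> : Im (alpha - 1) = Im alpha by rewrite !creE subr0.
  by rewrite mulr0 add0r.
rewrite /Fr cmodM; apply: le_trans (ler_wpM2r (cmod_ge0 _) hF) _.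
rewrite mulrDr mulr1 mulrDl -!mulrA; apply: lerD; rewrite ler_wpM2l ?expR_ge0//.
  exact: hC1.
rewrite cmod_upper_gamma_integrandE.
have -> : expR ((a - 1) * (ln x - ln (cmod (z + x%:C)))) =
    expR ((a - 1) * ln x) * cmod (cexp ((1 - a)%:C * clog (z + x%:C))).
  rewrite cmod_cexp -expRD cReM cReR cImR mul0r subr0 Re_clog; congr expR; ring.
have -> : e2 x = expR ((a - 1) * ln x) * expR (Re (q + (1 - a)%:C) * ln (1 + x)) * expR (- x).
  by rewrite -!expRD /e2 mul1r.
have aux (A X Y Z B : R) : 0 <= A -> 0 <= Z -> X * Y <= C2 * B ->
    A * X * (Y * Z) <= C2 * (A * B * Z).
  move=> A0 Z0 h; have -> : A * X * (Y * Z) = A * Z * (X * Y) by ring.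
  have -> : C2 * (A * B * Z) = A * Z * (C2 * B) by ring.
  by rewrite ler_wpM2l// mulr_ge0.
apply: aux; try exact: expR_ge0.
rewrite -cmodM -cexpD -mulrDl [(1 - a)%:C + q]addrC; exact: (hC2 x x0).
Qed.

Let cvg_Fr : ccvg (fun n => cintegral mu P (Fr (1 - harmonicS n)))
  (cintegral mu P (tricomi_integrand alpha s z)).
Proof.
have [h [ih hh]] := Fr_dominated.
have r01 n : 0 <= (1 - harmonicS n : R) < 1.
  by have /andP[? ?] := @harmonicS01 R n; apply/andP; split; lra.
have rcv : (1 - harmonicS n : R) @[n --> \oo] --> (1 : R).
  rewrite -[X in _ --> X]subr0; apply: cvgB; [exact: cvg_cst|exact: cvg_harmonicS].
have [] // := @dominated_cvg_cintegral _ _ _ mu P (fun n => Fr (1 - harmonicS n))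
  (tricomi_integrand alpha s z) h mP _ ih.
- by move=> n; exact: cintegrable_measurable (cvg_S (r01 n)).1.
- by move=> n x; rewrite /= in_itv/= andbT; exact: hh.
move=> x; rewrite /= in_itv/= andbT => x0.
have w1 : 0 < Re (1 - (1 : R)%:C * w x).
  by apply: Re1_gt0; rewrite mul1r; exact: cmod_shift_ratio_lt1.
have -> : tricomi_integrand alpha s z x = Fr 1 x.
  have zx := shift_neq0 z_ge0 x0; have zx0 := Re_shift_gt0 z_ge0 x0.
  rewrite /Fr mul1r.
  have -> : 1 - w x = x%:C / (z + x%:C) by rewrite /w /shift_ratio; field.
  rewrite clog_div ?(ltW zx0)// clogR// /k /upper_gamma_integrand -cexpD /q.
  by congr cexp; ring.
have dR := is_cderiveM (is_cderive_id 1) (is_cderive_cst (w x) 1).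
have dF := is_cderiveM (is_cderive_cexp (is_cderiveZ (alpha - 1) (is_cderive_clog w1
  (is_cderiveB (is_cderive_cst 1 (1 : R)) dR)))) (is_cderive_cst (k q x) 1).
exact: (ccvg_cderive dF rcv).
Qed.

(** The tails are bounded uniformly up to [r = 1] by telescoping sums. *)
Let tail_le : exists (C : R) (N0 : nat), 0 <= C /\ forall N j r, (N0 <= N)%N -> 0 <= r <= 1 ->
  cmod (S (N + j) r - S N r) <= C * (d N - d (N + j)).
Proof.
have [C hC] := shift_ratio_moment_le z_ge0 z0 q.
have [N0 hN] := bincoef_telescope alpha0.
have C0 : 0 <= C by apply: le_trans (hC 0%N); rewrite mulr_ge0 ?cmod_ge0.
have a0 : 0 < a := alpha0.
have C'0 : 0 <= C * 2 / a by rewrite !mulr_ge0 ?invr_ge0 ?(ltW a0).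
exists (C * 2 / a), N0; split=> // N j r NN /andP[r0 r1].
elim: j => [|j IH]; first by rewrite addn0 !subrr cmod0 mulr0.
rewrite addnS /S big_ord_recr /= addrAC -/(S (N + j) r) -/(S N r).
apply: le_trans (ler_cmodD _ _) _.
have -> : d N - d (N + j).+1 = (d N - d (N + j)) + (d (N + j) - d (N + j).+1) by ring.
rewrite mulrDr; apply: lerD IH _.
set n := (N + j)%N; have := hN n (leq_trans NN (leq_addr _ _)).
have Gn : cmod (G n) <= C / n.+1%:R by rewrite ler_pdivlMr// mulrC; exact: hC.
have d0 : 0 <= d n := cmod_ge0 _.
rewrite -/(d n) -/(d n.+1) => h.
have h1 : cmod (c n * r%:C ^+ n * G n) <= d n * (C / n.+1%:R).
  rewrite cmodM [cmod (c n * _)]cmodM cmodX cmodR (ger0_norm r0) -[X in _ <= X * _]mulr1.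
  have rn0 : 0 <= r ^+ n by exact: exprn_ge0.
  have rn1 : r ^+ n <= 1 by exact: exprn_ile1.
  apply: ler_pM; [by rewrite mulr_ge0|exact: cmod_ge0| |exact: Gn].
  by rewrite ler_wpM2l.
apply: le_trans h1 _.
have -> : d n * (C / n.+1%:R) = C * 2 / a * (a / 2 * (d n / n.+1%:R)).
  have y0 : (n.+1%:R : R) != 0 by rewrite pnatr_eq0.
  have an0 : a != 0 by rewrite gt_eqF.
  by move: (n.+1%:R : R) y0 => y y0; field; rewrite ?y0 ?an0.
by rewrite ler_wpM2l.
Qed.

(** Abel's theorem: by the uniform tail bound, the limits [N -> oo] and [r -> 1]
    may be interchanged. *)
Let cvg_S1 : ccvg (fun N => S N 1) (cintegral mu P (tricomi_integrand alpha s z)).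
Proof.
have [C [N0 [C0 hC]]] := tail_le.
have [N1 hN1] := bincoef_telescope alpha0.
pose M := maxn N0 N1.
have dec n : (M <= n)%N -> d n.+1 <= d n.
  move=> Mn; rewrite -subr_ge0; apply: le_trans (hN1 n _).
    by rewrite !mulr_ge0 ?invr_ge0 ?cmod_ge0 ?(ltW alpha0).
  by rewrite (leq_trans _ Mn)// leq_maxr.
pose e n := d (n + M).
have e_ni : nonincreasing_seq e.
  by apply/nonincreasing_seqP => n; rewrite /e addSn; apply: dec; rewrite leq_addl.
have e_lb : has_lbound (range e) by exists 0 => _ [n _ <-]; exact: cmod_ge0.
have e_cv : cvgn e := nonincreasing_is_cvgn e_ni e_lb.
pose l := limn e.
have el n : l <= e n by exact: nonincreasing_cvgn_ge.
have r01 n : 0 <= (1 - harmonicS n : R) < 1.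
  by have /andP[? ?] := @harmonicS01 R n; apply/andP; split; lra.
have rcv : (1 - harmonicS n : R) @[n --> \oo] --> (1 : R).
  rewrite -[X in _ --> X]subr0; apply: cvgB; [exact: cvg_cst|exact: cvg_harmonicS].
have h1 n r : 0 <= r < 1 -> cmod (cintegral mu P (Fr r) - S (n + M) r) <= 2 * (C * (e n - l)).
  move=> r01'; have [_ cv] := cvg_S r01'.
  have cv' : ccvg (fun j => S (n + M + j) r - S (n + M) r) (cintegral mu P (Fr r) - S (n + M) r).
    apply: ccvgD; last exact: ccvg_cst.
    under eq_fun do rewrite addnC.
    by case: cv => cr ci; split; rewrite (cvg_shiftn (n + M) (fun j => _ (S j r))).
  apply: (ccvg_cmod_le cv') => j; apply: le_trans (hC _ _ _ _ _) _.
  - by rewrite (leq_trans (leq_maxl N0 N1))// leq_addl.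
  - by case/andP: r01' => -> /ltW ->.
  rewrite ler_wpM2l// lerD2l lerN2 (_ : (n + M + j = (n + j) + M)%N) ?el//.
  by rewrite addnAC.
have cS N : ccvg (fun n => S N (1 - harmonicS n)) (S N 1).
  have [dd hd] : exists dd, is_cderive (S N) 1 dd.
    elim: N => [|N [dd IH]].
      by exists 0; rewrite /S; under eq_fun do rewrite big_ord0; exact: is_cderive_cst.
    eexists; rewrite /S; under eq_fun do rewrite big_ord_recr /=.
    apply: is_cderiveD; first exact: IH.
    apply: is_cderiveM; last exact: is_cderive_cst.
    by apply: is_cderiveZ; apply: is_cderiveX; exact: is_cderive_id.
  exact: ccvg_cderive hd rcv.
have h2 n : cmod (cintegral mu P (tricomi_integrand alpha s z) - S (n + M) 1) <=
    2 * (2 * (C * (e n - l))).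
  have cv : ccvg (fun j => cintegral mu P (Fr (1 - harmonicS j)) + -1 * S (n + M) (1 - harmonicS j))
      (cintegral mu P (tricomi_integrand alpha s z) + -1 * S (n + M) 1).
    by apply: ccvgD; [exact: cvg_Fr|exact/ccvgM_cst/cS].
  rewrite -[- S _ _]mulN1r; apply: (ccvg_cmod_le cv) => j; rewrite mulN1r.
  exact: h1.
have h3 : ccvg (fun n => cintegral mu P (tricomi_integrand alpha s z) - S (n + M) 1) 0.
  apply: ccvg0_le h2 _.
  rewrite -(mulr0 2); apply: cvgMr; rewrite -(mulr0 2); apply: cvgMr.
  rewrite -(mulr0 C); apply: cvgMr; rewrite -(subrr l); apply: cvgB; [exact: e_cv|exact: cvg_cst].
have h4 : ccvg (fun n => S (n + M) 1) (cintegral mu P (tricomi_integrand alpha s z)).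
  have := ccvgD (ccvgM_cst (-1) h3) (ccvg_cst (cintegral mu P (tricomi_integrand alpha s z))).
  rewrite mulr0 add0r.
  have -> // : (fun n => -1 * (cintegral mu P (tricomi_integrand alpha s z) - S (n + M) 1) +
    cintegral mu P (tricomi_integrand alpha s z)) = (fun n => S (n + M) 1).
  by apply/funext => n; ring.
by case: h4 => r i; split; rewrite -(cvg_shiftn M).
Qed.

Lemma cvg_binomial_moments :
  ccvg (fun N => \sum_(n < N) bincoef alpha n *
      (z ^+ n * cintegral mu P (upper_gamma_integrand z (alpha + s - 2 - n%:R))))
    (cintegral mu P (tricomi_integrand alpha s z)).
Proof.
have := cvg_S1; rewrite /S; congr ccvg; apply/funext => N.
by apply: eq_bigr => n _; rewrite expr1n mulr1.
Qed.
End TricomiSeries.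

Section SeriesTerm.
Context {R : realType}.
Local Notation mu := (@lebesgue_measure R).
Local Notation P := (`](0 : R), +oo[%classic : set (measurableTypeR R)).
Variables (alpha beta s : R[i]) (u : R).
Hypotheses (alpha0 : 0 < Re alpha) (beta_ge0 : 0 <= Re beta) (beta0 : beta != 0) (u0 : 0 < u).

Let z := beta * u%:C.
Let z_ge0 : 0 <= Re z.
Proof. by rewrite cReM cReR cImR mulr0 subr0 mulr_ge0// ltW. Qed.
Let z0 : z != 0.
Proof. by rewrite mulf_neq0//; apply: contraTneq u0 => -[->]; rewrite ltxx. Qed.

Let K := cexp (- z) / cGamma alpha.

(** The sign of [(- z) ^ n] turns [1 / (Gamma (alpha - n) n!)] into a coefficient
    of the binomial series. *)
Lemma series_termE n : series_term alpha beta s u n = K * (bincoef alpha n *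
  (z ^+ n * cintegral mu P (upper_gamma_integrand z (alpha + s - 2 - n%:R)))).
Proof.
rewrite /series_term -/z upper_gammaE// invr_cGamma_subn// -bincoefE.
have -> : alpha + s - n%:R - 1 - 1 = alpha + s - 2 - n%:R by ring.
by rewrite [(- z) ^+ n]exprNn /K; ring.
Qed.

Let cvg_series : ccvg (fun N => \sum_(n < N) series_term alpha beta s u n)
  (K * cintegral mu P (tricomi_integrand alpha s z)).
Proof.
have := ccvgM_cst K (cvg_binomial_moments s alpha0 z_ge0 z0).
congr ccvg; apply/funext => N; rewrite mulr_sumr; apply: eq_bigr => n _.
by rewrite series_termE.
Qed.

Let cvg_parts :
  series (fun n => Re (series_term alpha beta s u n)) @ \oo -->
    Re (K * cintegral mu P (tricomi_integrand alpha s z)) /\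
  series (fun n => Im (series_term alpha beta s u n)) @ \oo -->
    Im (K * cintegral mu P (tricomi_integrand alpha s z)).
Proof.
case: cvg_series => r i; split.
  have -> // : series (fun n => Re (series_term alpha beta s u n)) =
    (fun N => Re (\sum_(n < N) series_term alpha beta s u n)).
  by apply/funext => N; rewrite /series /= cRe_sum big_mkord.
have -> // : series (fun n => Im (series_term alpha beta s u n)) =
  (fun N => Im (\sum_(n < N) series_term alpha beta s u n)).
by apply/funext => N; rewrite /series /= cIm_sum big_mkord.
Qed.

Lemma csummable_series_term : csummable (series_term alpha beta s u).
Proof. by case: cvg_parts => r i; split; apply/cvg_ex; eexists; [exact: r|exact: i]. Qed.

Lemma csum_series_term : csum (series_term alpha beta s u) =
  cexp (- z) / cGamma alpha * cintegral mu P (tricomi_integrand alpha s z).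
Proof.
by case: cvg_parts => r i; apply: cplx_eq; rewrite /csum /=; [exact: cvg_lim r|exact: cvg_lim i].
Qed.
End SeriesTerm.

(** * Translation invariance and Fubini's theorem *)

Section MeasureTools.
Context {R : realType}.
Local Notation mu := (@lebesgue_measure R).
Local Notation RR := (measurableTypeR R).

Let sub_right (u : R) : RR -> RR := fun t => t - u.

Let measurable_sub_right u : measurable_fun setT (sub_right u).
Proof. by apply: measurable_funB => //; exact: measurable_cst. Qed.

(** Lebesgue measure is determined by its values on half-open intervals, whose
    lengths are translation invariant. *)
Lemma lebesgue_measure_translate (u : R) A : measurable A ->
  mu A = pushforward mu (sub_right u) A.
Proof.
have mu_ := measurable_sub_right u.
apply: (@lebesgue_measure_unique R (pushforward mu (sub_right u))) => X [[a b] _ <-] /=.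
rewrite /pushforward /=.
have -> : sub_right u @^-1` `]a, b]%classic = `]a + u, b + u]%classic.
  by apply/seteqP; split=> x /=; rewrite /sub_right !in_itv/= ltrBrDr lerBlDr.
rewrite !lebesgue_measure_itv /= !lte_fin ltrD2r.
by case: ifP => // _; rewrite -!EFinD; congr (_%:E); ring.
Qed.

Lemma integral_translate (u : R) (h : RR -> \bar R) : measurable_fun setT h ->
  (\int[mu]_t h (t - u)%R = \int[mu]_y h y)%E.
Proof.
have ms := measurable_sub_right u.
have ge0 (g : RR -> \bar R) : measurable_fun setT g -> (forall y, 0 <= g y)%E ->
    (\int[mu]_t g (t - u)%R = \int[mu]_y g y)%E.
  move=> mg g0.
  have -> : (\int[mu]_y g y = \int[pushforward mu (sub_right u)]_y g y)%E.
    by apply: eq_measure_integral => A mA _; exact: lebesgue_measure_translate.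
  by rewrite (ge0_integral_pushforward ms).
move=> mh; rewrite [LHS]integralE [RHS]integralE.
have mp := measurable_funepos mh; have mn := measurable_funeneg mh.
congr (_ - _)%E.
  rewrite -(ge0 _ mp) => [|y]; last exact: funepos_ge0.
  by apply: eq_integral => t _; rewrite -[LHS]/((h \o sub_right u)^\+%E t) funepos_comp.
rewrite -(ge0 _ mn) => [|y]; last exact: funeneg_ge0.
by apply: eq_integral => t _; rewrite -[LHS]/((h \o sub_right u)^\-%E t) funeneg_comp.
Qed.

Lemma integrable_translate (u : R) (h : RR -> R) : measurable_fun setT h ->
  mu.-integrable setT (EFin \o (fun t => h (t - u))) -> mu.-integrable setT (EFin \o h).
Proof.
move=> mh /integrableP[_ ih]; apply/integrableP; split; first exact/measurable_EFinP.
apply: le_lt_trans ih.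
have ma : measurable_fun setT (abse \o (EFin \o h)).
  by apply: measurableT_comp => //; exact/measurable_EFinP.
by rewrite -(integral_translate u ma).
Qed.

Lemma cintegral_translate (u : R) (F : RR -> R[i]) : cmeasurable setT F ->
  cintegral mu setT (fun t => F (t - u)) = cintegral mu setT F.
Proof.
move=> [mr mi]; apply: cplx_eq; rewrite /cintegral /Rintegral /=; congr fine.
  by rewrite -(integral_translate u (h := fun y => (Re (F y))%:E))//; exact/measurable_EFinP.
by rewrite -(integral_translate u (h := fun y => (Im (F y))%:E))//; exact/measurable_EFinP.
Qed.

Lemma cintegrable_translate (u : R) (F : RR -> R[i]) : cmeasurable setT F ->
  cintegrable mu setT (fun t => F (t - u)) -> cintegrable mu setT F.
Proof.
move=> [mr mi] [ir ii]; split.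
  exact: (integrable_translate (u := u) (h := fun y => Re (F y))).
exact: (integrable_translate (u := u) (h := fun y => Im (F y))).
Qed.

(** No integrability of the sections is assumed: where one is not integrable,
    the integral still has the conventional value computed from its positive
    and negative parts. *)
Let measurable_Rintegral_param (h : RR * RR -> R) : measurable_fun setT h ->
  measurable_fun setT (fun t => Rintegral mu setT (fun u => h (t, u))).
Proof.
move=> mh; have me : measurable_fun setT (EFin \o h) by exact/measurable_EFinP.
rewrite /Rintegral; apply: (measurableT_comp (fine_measurable measurableT)).
have -> : (fun t => \int[mu]_u (h (t, u))%:E)%E =
    (fun t => \int[mu]_u (EFin \o h)^\+ (t, u) - \int[mu]_u (EFin \o h)^\- (t, u))%E.
  apply/funext => t; rewrite integralE.
  congr (_ - _)%E; apply: eq_integral => u _.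
    by rewrite -[LHS]/(((EFin \o h) \o (fun u => (t, u)))^\+%E u) funepos_comp.
  by rewrite -[LHS]/(((EFin \o h) \o (fun u => (t, u)))^\-%E u) funeneg_comp.
have mp := measurable_fun_fubini_tonelli_F (m2 := mu) _ (measurable_funepos me) (funepos_ge0 _).
have mn := measurable_fun_fubini_tonelli_F (m2 := mu) _ (measurable_funeneg me) (funeneg_ge0 _).
exact: emeasurable_funB mp mn.
Qed.

Lemma cmeasurable_cintegral_param (F : RR * RR -> R[i]) : cmeasurable setT F ->
  cmeasurable setT (fun t => cintegral mu setT (fun u => F (t, u))).
Proof.
move=> [mr mi]; split.
  exact: (measurable_Rintegral_param (h := fun x => Re (F x))).
exact: (measurable_Rintegral_param (h := fun x => Im (F x))).
Qed.

Lemma cFubini (F : RR * RR -> R[i]) : cintegrable (mu \x mu)%E setT F ->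
  [/\ {ae mu, forall t, cintegrable mu setT (fun u => F (t, u))},
      {ae mu, forall u, cintegrable mu setT (fun t => F (t, u))},
      cintegrable mu setT (fun t => cintegral mu setT (fun u => F (t, u))),
      cintegrable mu setT (fun u => cintegral mu setT (fun t => F (t, u))) &
      cintegral mu setT (fun t => cintegral mu setT (fun u => F (t, u))) =
      cintegral mu setT (fun u => cintegral mu setT (fun t => F (t, u)))].
Proof.
have aux (h : RR * RR -> R) : (mu \x mu)%E.-integrable setT (EFin \o h) ->
  [/\ {ae mu, forall t, mu.-integrable setT (fun u => (h (t, u))%:E)},
      {ae mu, forall u, mu.-integrable setT (fun t => (h (t, u))%:E)},
      mu.-integrable setT (EFin \o (fun t => Rintegral mu setT (fun u => h (t, u)))),
      mu.-integrable setT (EFin \o (fun u => Rintegral mu setT (fun t => h (t, u)))) &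
      Rintegral mu setT (fun t => Rintegral mu setT (fun u => h (t, u))) =
      Rintegral mu setT (fun u => Rintegral mu setT (fun t => h (t, u)))].
  move=> ih.
  have a1 := ae_integrable1 ih; have a2 := ae_integrable2 ih.
  have mh : measurable_fun setT h by have /measurable_EFinP := measurable_int _ ih.
  have ms := measurableT_comp mh (@measurable_swap _ _ RR RR).
  have ihs : (mu \x mu)%E.-integrable setT (EFin \o (h \o @unstable.swap RR RR)).
    apply/integrable12ltyP; first exact/measurable_EFinP.
    by apply/(integrable21ltyP mu mu (f := EFin \o h)) => //; exact/measurable_EFinP.
  have iF := integrable_fubini_F ih.
  have iG : mu.-integrable setT (fubini_G mu (EFin \o h)) by exact: (integrable_fubini_F ihs).
  have m1 := measurable_Rintegral_param mh.
  have m2 := measurable_Rintegral_param ms.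
  have e1 : {ae mu, forall t, setT t -> (Rintegral mu setT (fun u => h (t, u)))%:E =
      fubini_F mu (EFin \o h) t}.
    apply: filterS a1 => t it _; rewrite /Rintegral fineK//.
    exact: integrable_fin_num.
  have e2 : {ae mu, forall u, setT u -> (Rintegral mu setT (fun t => h (t, u)))%:E =
      fubini_G mu (EFin \o h) u}.
    apply: filterS a2 => t it _; rewrite /Rintegral fineK//.
    exact: integrable_fin_num.
  have c1 : (\int[mu]_t (Rintegral mu setT (fun u => h (t, u)))%:E =
      \int[mu]_t fubini_F mu (EFin \o h) t)%E.
    apply: ae_eq_integral => //; [exact/measurable_EFinP|exact: (measurable_int _ iF)].
  have c2 : (\int[mu]_u (Rintegral mu setT (fun t => h (t, u)))%:E =
      \int[mu]_u fubini_G mu (EFin \o h) u)%E.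
    apply: ae_eq_integral => //; [exact/measurable_EFinP|exact: (measurable_int _ iG)].
  have abs1 (g k : RR -> \bar R) : measurable_fun setT g -> mu.-integrable setT k ->
      {ae mu, forall t, setT t -> g t = k t} -> mu.-integrable setT g.
    move=> mg /integrableP[mk ik] gk; apply/integrableP; split=> //.
    rewrite (_ : (\int[mu]_x `|g x| = \int[mu]_x `|k x|)%E)//.
    apply: ae_eq_integral => //; try exact: measurableT_comp.
    by apply: filterS gk => t gk /gk ->.
  split=> //.
  - by apply: abs1 iF e1; exact/measurable_EFinP.
  - by apply: abs1 iG e2; exact/measurable_EFinP.
  - by rewrite [LHS]/Rintegral [RHS]/Rintegral c1 c2; congr fine; exact: Fubini.
move=> [/aux[a1 a2 a3 a4 a5] /aux[b1 b2 b3 b4 b5]]; split.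
- by apply: filterS2 a1 b1 => t.
- by apply: filterS2 a2 b2 => t.
- by [].
- by [].
- by rewrite /cintegral /= a5 b5.
Qed.

Lemma ae_eq_cintegral (D : set RR) (F G : RR -> R[i]) : measurable D ->
  cmeasurable D F -> cintegrable mu D G -> {ae mu, forall x, D x -> F x = G x} ->
  cintegrable mu D F /\ cintegral mu D F = cintegral mu D G.
Proof.
move=> mD [mr mi] [ir ii] FG.
have aux (g k : RR -> R) : measurable_fun D g -> mu.-integrable D (EFin \o k) ->
    {ae mu, forall t, D t -> g t = k t} ->
    mu.-integrable D (EFin \o g) /\ Rintegral mu D g = Rintegral mu D k.
  move=> mg /integrableP[mk ik] gk; have mg' : measurable_fun D (EFin \o g) by exact/measurable_EFinP.
  split; last first.
    rewrite /Rintegral; congr fine; apply: ae_eq_integral => //.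
    by apply: filterS gk => t h /h ->.
  apply/integrableP; split=> //.
  rewrite (_ : (\int[mu]_(x in D) `|(EFin \o g) x| = \int[mu]_(x in D) `|(EFin \o k) x|)%E)//.
  apply: ae_eq_integral => //; try exact: measurableT_comp.
  by apply: filterS gk => t h /h /= ->.
have [i1 e1] := aux _ _ mr ir (filterS (fun t h Dt => congr1 (@complex.Re R) (h Dt)) FG).
have [i2 e2] := aux _ _ mi ii (filterS (fun t h Dt => congr1 (@complex.Im R) (h Dt)) FG).
by split; [split|rewrite /cintegral e1 e2].
Qed.

Lemma cintegral_mkcond {d} {T : measurableType d} (m : {measure set T -> \bar R})
    (D : set T) (p : T -> bool) (F : T -> R[i]) : (forall x, D x <-> p x) ->
  cintegral m setT (fun x => if p x then F x else 0) = cintegral m D F.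
Proof.
move=> Dp; rewrite /cintegral !(Rintegral_mkcond m D).
congr (_ +i* _); apply: eq_Rintegral => x _; rewrite patchE.
  by case: ifPn => [/Dp/mem_set ->//|]; case: ifPn => // /set_mem/Dp ->.
by case: ifPn => [/Dp/mem_set ->//|]; case: ifPn => // /set_mem/Dp ->.
Qed.

Lemma cintegrable_mkcond {d} {T : measurableType d} (m : {measure set T -> \bar R})
    (D : set T) (p : T -> bool) (F : T -> R[i]) : measurable D -> (forall x, D x <-> p x) ->
  cintegrable m setT (fun x => if p x then F x else 0) <-> cintegrable m D F.
Proof.
move=> mD Dp.
have e (q : R[i] -> R) : q 0 = 0 ->
    (EFin \o (fun x => q (if p x then F x else 0))) = (EFin \o (fun x => q (F x))) \_ D.
  move=> q0; apply/funext => x; rewrite patchE /=.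
  by case: ifPn => [/Dp/mem_set ->//|]; case: ifPn => [/set_mem/Dp ->//|]; rewrite q0.
rewrite /cintegrable [X in _ <-> X /\ _](integrable_mkcond _ mD).
rewrite [X in _ <-> _ /\ X](integrable_mkcond _ mD).
by rewrite -(e (@complex.Re R))// -(e (@complex.Im R)).
Qed.

Lemma cmeasurable_if {d} {T : measurableType d} (p : T -> bool) (F : T -> R[i]) :
  measurable_fun setT p -> cmeasurable setT F ->
  cmeasurable setT (fun x => if p x then F x else 0).
Proof.
move=> mp [mr mi]; split.
  rewrite (_ : (fun x => _) = (fun x => if p x then Re (F x) else 0)).
    by apply: measurable_fun_ifT => //; exact: measurable_cst.
  by apply/funext => x; case: ifP.
rewrite (_ : (fun x => _) = (fun x => if p x then Im (F x) else 0)).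
  by apply: measurable_fun_ifT => //; exact: measurable_cst.
by apply/funext => x; case: ifP.
Qed.
Lemma cmeasurable_mkcond {d} {T : measurableType d}
    (D : set T) (p : T -> bool) (F : T -> R[i]) : measurable D -> (forall x, D x <-> p x) ->
  cmeasurable D F -> cmeasurable setT (fun x => if p x then F x else 0).
Proof.
move=> mD Dp [mr mi]; split.
  rewrite (_ : (fun x => _) = (fun x => Re (F x)) \_ D); first exact/(measurable_restrictT _ mD).1.
  apply/funext => x; rewrite patchE.
  by case: ifPn => [/Dp/mem_set ->//|]; case: ifPn => // /set_mem/Dp ->.
rewrite (_ : (fun x => _) = (fun x => Im (F x)) \_ D); first exact/(measurable_restrictT _ mD).1.
apply/funext => x; rewrite patchE.
by case: ifPn => [/Dp/mem_set ->//|]; case: ifPn => // /set_mem/Dp ->.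
Qed.

Lemma cintegral_itv_cc (t : R) (F : RR -> R[i]) : cmeasurable `]0, t[ F ->
  cintegral mu `[0, t] F = cintegral mu `]0, t[ F.
Proof.
have aux (g : RR -> R) : measurable_fun `]0, t[ g ->
    (\int[mu]_(x in `[0%R, t]) (g x)%:E = \int[mu]_(x in `]0%R, t[) (g x)%:E)%E.
  move=> mg; have me : measurable_fun `]0, t[ (EFin \o g) by exact/measurable_EFinP.
  rewrite -integral_itv_bndo_bndc; last by apply/emeasurable_fun_itv_obnd_cbndP.
  by rewrite -integral_itv_obnd_cbnd.
by move=> [mr mi]; rewrite /cintegral /Rintegral !aux.
Qed.
End MeasureTools.

(** * The double integral *)

Section MellinTempered.
Context {R : realType}.
Local Notation mu := (@lebesgue_measure R).
Local Notation RR := (measurableTypeR R).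
Local Notation P := (`](0 : R), +oo[%classic : set RR).
Variables (f : R -> R[i]) (alpha beta s : R[i]).
Hypothesis hf : cintegrable mu `[0, +oo[ f.
Hypotheses (alpha0 : 0 < Re alpha) (beta_ge0 : 0 <= Re beta) (beta0 : beta != 0).

Let mP : measurable P. Proof. exact: measurable_itv. Qed.
Let mTT : measurable [set: RR]. Proof. exact: measurableT. Qed.
Let Pp x : P x <-> 0 < x. Proof. by rewrite /= in_itv/= andbT. Qed.

Let f0 (u : RR) : R[i] := if 0 < u then f u else 0.
Let kern (y : RR) : R[i] := cexp ((alpha - 1) * (ln y)%:C - beta * y%:C).
(** In the open triangle [0 < u < t] all powers have positive real bases; the
    edges are null sets for every integral below. *)
Let tri (x : RR * RR) : bool := (0 < x.2) && (x.2 < x.1).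
Let jk (x : RR * RR) : R[i] := if tri x then kern (x.1 - x.2) * f0 x.2 else 0.
Let J (x : RR * RR) : R[i] :=
  if tri x then cexp ((s - 1) * (ln x.1)%:C) * (kern (x.1 - x.2) * f0 x.2) else 0.

Let PD : P `<=` `[0, +oo[%classic.
Proof. by move=> x; rewrite /= !in_itv/= !andbT; exact: ltW. Qed.

Let hfP : cintegrable mu P f.
Proof. by case: hf => r i; split; [apply: integrableS PD r|apply: integrableS PD i]. Qed.

Let if0 : cintegrable mu setT f0.
Proof. exact/(cintegrable_mkcond mu f mP Pp). Qed.

Let mf0 : cmeasurable setT f0. Proof. exact: cintegrable_measurable if0. Qed.

Let m1 : measurable_fun setT (fun x : RR * RR => x.1 : R) := @measurable_fst _ _ RR RR.
Let m2 : measurable_fun setT (fun x : RR * RR => x.2 : R) := @measurable_snd _ _ RR RR.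
Let md : measurable_fun setT (fun x : RR * RR => (x.1 - x.2 : R)).
Proof. exact: measurable_funB. Qed.

Let mtri : measurable_fun setT tri.
Proof.
by apply: measurable_and; apply: measurable_fun_ltr => //; exact: measurable_cst.
Qed.

Let mln : cmeasurable setT (fun y : RR => (ln y)%:C).
Proof. by apply: cmeasurable_real; exact: measurable_ln. Qed.

Let mkern : cmeasurable setT kern.
Proof.
apply: cmeasurable_cexp; apply: cmeasurableD.
  by apply: cmeasurableM; [exact: cmeasurable_cst|exact: mln].
apply: cmeasurableN; apply: cmeasurableM; first exact: cmeasurable_cst.
by apply: cmeasurable_real; exact: measurable_id.
Qed.

Let cmeasurable_comp (F : RR -> R[i]) (g : RR * RR -> RR) : cmeasurable setT F ->
  measurable_fun setT g -> cmeasurable setT (fun x => F (g x)).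
Proof. by move=> [mr mi] mg; split; [exact: (measurableT_comp mr mg)|exact: (measurableT_comp mi mg)]. Qed.

Let mkf : cmeasurable setT (fun x : RR * RR => kern (x.1 - x.2) * f0 x.2).
Proof.
apply: cmeasurableM; first exact: (cmeasurable_comp mkern md).
exact: (cmeasurable_comp mf0 m2).
Qed.

Let mjk : cmeasurable setT jk. Proof. exact: cmeasurable_if. Qed.

Let ms1 : cmeasurable setT (fun t : RR => cexp ((s - 1) * (ln t)%:C)).
Proof.
apply: cmeasurable_cexp; apply: cmeasurableM; first exact: cmeasurable_cst.
exact: mln.
Qed.

Let mJ : cmeasurable setT J.
Proof.
apply: cmeasurable_if => //; apply: cmeasurableM => //.
exact: (cmeasurable_comp ms1 m1).
Qed.

Let tempered_kernelE y : 0 < y -> tempered_kernel alpha beta y = kern y.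
Proof. by move=> y0; rewrite /tempered_kernel cpowR// -cexpD. Qed.

Let measurable_bool (p : RR * RR -> bool) : measurable_fun setT p -> measurable [set x | p x].
Proof.
move=> mp; have := mp measurableT [set true]; rewrite setTI.
by apply.
Qed.

Let J_of_abs_conv : mellin_tempered_abs_conv alpha beta f s ->
  cintegrable (mu \x mu)%E setT J.
Proof.
move=> h; have mT := measurable_bool mtri.
apply/(cintegrable_mkcond (mu \x mu)%E _ mT (fun x => iff_refl _)).
pose D2 := [set x : RR * RR | 0 <= x.2 <= x.1].
have mD2 : measurable D2.
  apply: (measurable_bool (p := fun x => (0 <= x.2) && (x.2 <= x.1))).
  by apply: measurable_and; apply: measurable_fun_ler => //; exact: measurable_cst.
have sub : [set x | tri x] `<=` D2.
  by move=> x /= /andP[x1 x2]; rewrite /D2/= !ltW.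
have h' : cintegrable (mu \x mu)%E [set x | tri x] (fun x : R * R =>
       cpow x.1%:C (s - 1) * (tempered_kernel alpha beta (x.1 - x.2) * f x.2)).
  by case: h => r i; split; [apply: (integrableS mD2 mT sub r)|apply: (integrableS mD2 mT sub i)].
apply: (eq_cintegrable mT _ h') => -[t u] /= /andP[/= u0 ut].
rewrite cpowR ?(lt_trans u0 ut)// tempered_kernelE ?subr_gt0//.
by rewrite /f0 u0.
Qed.

(** For [Re s <= 1] the inner integral is at most
    [int y ^ (Re (alpha + s) - 2) exp (- Re beta y)], whatever [u] is. *)
Let J_of_decay : 0 < Re beta -> 1 - Re alpha < Re s <= 1 ->
  cintegrable (mu \x mu)%E setT J.
Proof.
move=> b0 /andP[s1 s2].
pose kap (y : RR) : R := expR ((Re s + Re alpha - 2) * ln y + 0 * ln (1 + y) - Re beta * y).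
pose kp (y : RR) : R := if 0 < y then kap y else 0.
pose N (x : RR * RR) : R := kp (x.1 - x.2) * cmod (f0 x.2).
have A1 : -1 < Re s + Re alpha - 2 by lra.
have ikap := integrable_power_exp 0 A1 ltr01 b0.
have kpE : EFin \o kp = (EFin \o kap) \_ P.
  apply/funext => y; rewrite patchE /= /kp.
  by case: ifPn => [/Pp/mem_set ->//|]; case: ifPn => // /set_mem/Pp ->.
have ikp : mu.-integrable setT (EFin \o kp) by rewrite kpE; exact/(integrable_mkcond _ mP).
have mkp : measurable_fun setT kp by have /measurable_EFinP := measurable_int _ ikp.
have kp0 y : 0 <= kp y by rewrite /kp; case: ifP => // _; exact: expR_ge0.
have mN : measurable_fun setT N.
  apply: measurable_funM; first exact: (measurableT_comp mkp md).
  exact: (measurableT_comp (measurable_cmod mf0) m2).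
have N0 x : 0 <= N x by rewrite mulr_ge0 ?cmod_ge0.
have iN : (mu \x mu)%E.-integrable setT (EFin \o N).
  apply/integrable21ltyP; first exact/measurable_EFinP.
  have e u : (\int[mu]_t `|(EFin \o N) (t, u)| = \int[mu]_y (kp y)%:E * (cmod (f0 u))%:E)%E.
    have mkpu : measurable_fun setT (fun y : RR => (kp y)%:E) by exact/measurable_EFinP.
    rewrite -(integral_translate u mkpu) -ge0_integralZr//.
    - by apply: eq_integral => t _; rewrite /= ger0_norm ?N0// /N EFinM.
    - by apply/measurable_EFinP; apply: (measurableT_comp mkp); apply: measurable_funB => //; exact: measurable_cst.
    - by move=> t _; rewrite lee_fin.
    - by rewrite lee_fin cmod_ge0.
  under eq_integral do rewrite e.
  rewrite ge0_integralZl//; last 3 first.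
  - by apply/measurable_EFinP; exact: measurable_cmod.
  - by move=> u _; rewrite lee_fin cmod_ge0.
  - by apply: integral_ge0 => y _; rewrite lee_fin.
  have /integrableP[_ i1] := integrable_cmod measurableT if0.
  have /integrableP[_ i2] := ikp.
  apply: lte_mul_pinfty.
  - by apply: integral_ge0 => y _; rewrite lee_fin.
  - by apply: integrable_fin_num.
  - move: i1; congr (_ < _)%E; apply: eq_integral => u _ /=.
    by rewrite ger0_norm ?cmod_ge0.
apply: (cintegrable_le measurableT mJ iN) => -[t u] _.
rewrite /J /N /=; case: ifPn => [/andP[/= u0 ut]|_]; last by rewrite cmod0 mulr_ge0 ?cmod_ge0.
rewrite !cmodM mulrA ler_wpM2r ?cmod_ge0// /kp subr_gt0 ut /kap /kern.
rewrite !cmod_cexp -expRD ler_expR !creE.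
have t0 : 0 < t by exact: lt_trans ut.
have tu : 0 < t - u by rewrite subr_gt0.
have : ln (t - u) <= ln t by rewrite ler_ln ?posrE// gerBl ltW.
nra.
Qed.

Hypothesis hs : (0 < Re beta /\ 1 - Re alpha < Re s <= 1) \/
  mellin_tempered_abs_conv alpha beta f s.

Let iJ : cintegrable (mu \x mu)%E setT J.
Proof. by case: hs => [[b0 s1]|h]; [exact: J_of_decay|exact: J_of_abs_conv]. Qed.

Let W (t : RR) : R[i] := cintegral mu setT (fun u => jk (t, u)).

Let tempered_integralE t : 0 < t -> tempered_integral alpha beta f t = (cGamma alpha)^-1 * W t.
Proof.
move=> t0; rewrite /tempered_integral; congr (_ * _).
have mjt : cmeasurable setT (fun u : RR => jk (t, u)).
  by case: mjk => r i; split; [exact: (measurableT_comp r (pair1_measurable _))|exact: (measurableT_comp i (pair1_measurable _))].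
have e u : u \in `]0, t[ -> tempered_kernel alpha beta (t - u) * f u = kern (t - u) * f0 u.
  by rewrite in_itv/= => /andP[u0 ut]; rewrite tempered_kernelE ?subr_gt0// /f0 u0.
rewrite cintegral_itv_cc; last first.
  apply: (@eq_cmeasurable _ _ _ _ (fun u : RR => jk (t, u))).
    by move=> u /= ut; rewrite e// /jk /tri/=; move: ut; rewrite in_itv/= => ->.
  by apply: cmeasurableS mjt => //.
rewrite (eq_cintegral _ (g := fun u : RR => kern (t - u) * f0 u)) => [|u /=]; last exact: e.
by rewrite -(cintegral_mkcond mu (p := fun u : RR => tri (t, u)))// => u; rewrite /tri/= in_itv.
Qed.

Let mellin_integrandE t : 0 < t ->
  mellin_integrand (tempered_integral alpha beta f) s t =
  cexp ((s - 1) * (ln t)%:C) * ((cGamma alpha)^-1 * W t).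
Proof. by move=> t0; rewrite /mellin_integrand cpowR// tempered_integralE. Qed.

Let X (t : RR) : R[i] := cintegral mu setT (fun u => J (t, u)).
Let Y (u : RR) : R[i] := cintegral mu setT (fun t => J (t, u)).

(** The section at [t] is the integrand of the Mellin transform. *)
Let mellin_part :
  cintegrable mu P (mellin_integrand (tempered_integral alpha beta f) s) /\
  cintegral mu P (mellin_integrand (tempered_integral alpha beta f) s) =
  (cGamma alpha)^-1 * cintegral mu setT Y.
Proof.
have [aeX _ iX _ eXY] := cFubini iJ.
have iXP : cintegrable mu P X.
  by case: iX => r i; split; [exact: integrableS measurableT mP (@subsetT _ P) r|exact: integrableS measurableT mP (@subsetT _ P) i].
have mM : cmeasurable P (mellin_integrand (tempered_integral alpha beta f) s).
  apply: (@eq_cmeasurable _ _ _ _ (fun t : RR => cexp ((s - 1) * (ln t)%:C) * ((cGamma alpha)^-1 * W t))).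
    by move=> t /Pp t0; rewrite mellin_integrandE.
  apply: (cmeasurableS measurableT (@subsetT _ P)); apply: cmeasurableM; first exact: ms1.
  by apply: cmeasurableM; [exact: cmeasurable_cst|exact: cmeasurable_cintegral_param mjk].
have iGX : cintegrable mu P (fun t => (cGamma alpha)^-1 * X t) by exact: cintegrableZ.
have aeE : {ae mu, forall t, P t -> mellin_integrand (tempered_integral alpha beta f) s t =
    (cGamma alpha)^-1 * X t}.
  apply: filterS aeX => t it /Pp t0.
  rewrite (mellin_integrandE t0) mulrCA.
  congr (_ * _).
  set e := cexp _; have e0 : e != 0 by exact: cexp_neq0.
  have Jjk u : J (t, u) = e * jk (t, u) by rewrite /J /jk; case: ifP; rewrite ?mulr0.
  have ijk : cintegrable mu setT (fun u => jk (t, u)).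
    have i2 := cintegrableZ e^-1 mTT it.
    apply: (eq_cintegrable mTT _ i2) => u _.
    rewrite Jjk; exact: mulKf e0 _.
  rewrite /X (eq_cintegral mu (g := fun u => e * jk (t, u))) => [|u _]; last exact: Jjk.
  by rewrite cintegralZ.
have eP : cintegral mu P X = cintegral mu setT X.
  rewrite -(cintegral_mkcond mu (p := fun t : RR => 0 < t) X Pp).
  apply: eq_cintegral => t _; case: ifPn => [_|t0]; first by [].
  rewrite -(cintegral0 mu setT); apply: eq_cintegral => u _.
  rewrite /J /tri /=; case: ifPn => [/andP[u0 ut]|_]; last by [].
  by rewrite (lt_trans u0 ut) in t0.
have [iM ->] := ae_eq_cintegral mP mM iGX aeE.
split; first exact: iM.
by rewrite (cintegralZ (cGamma alpha)^-1 mP iXP) eP; exact: congr1 eXY.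
Qed.

Let T (u : R) : R[i] := cintegral mu P (tricomi_integrand alpha s (beta * u%:C)).

(** A formula for the principal logarithm on the right half-plane that is
    visibly measurable. *)
Let lgm (z : R[i]) : R[i] := ln (cmod z) +i* atan (Im z * expR (- ln (Re z))).
Let lgmE z : 0 < Re z -> lgm z = clog z.
Proof.
move=> z0; apply: cplx_eq; rewrite /lgm /clog//= carg_atan//.
by rewrite expRN lnK.
Qed.

Let mT : cmeasurable P T.
Proof.
pose h (x : RR * RR) := if (0 < x.1) && (0 < x.2) then
  cexp ((alpha - 1) * (ln x.2)%:C + (s - 1) * lgm (beta * x.1%:C + x.2%:C) - x.2%:C) else 0.
have mz : cmeasurable setT (fun x : RR * RR => beta * x.1%:C + x.2%:C).
  apply: cmeasurableD; last exact: cmeasurable_real.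
  by apply: cmeasurableM; [exact: cmeasurable_cst|exact: cmeasurable_real].
have mlg : cmeasurable setT (fun x : RR * RR => lgm (beta * x.1%:C + x.2%:C)).
  split; first exact: (measurableT_comp (@measurable_ln R) (measurable_cmod mz)).
  apply: (measurableT_comp (continuous_measurable_fun (@continuous_atan R))).
  apply: measurable_funM; first by case: mz.
  apply: (measurableT_comp (@measurable_expR R)); apply: measurable_funN.
  by apply: (measurableT_comp (@measurable_ln R)); case: mz.
have mh : cmeasurable setT h.
  apply: cmeasurable_if.
    by apply: measurable_and; apply: measurable_fun_ltr => //; exact: measurable_cst.
  apply: cmeasurable_cexp; apply: cmeasurableD; last first.
    by apply: cmeasurableN; exact: cmeasurable_real.
  apply: cmeasurableD; apply: cmeasurableM => //; try exact: cmeasurable_cst.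
  by apply: cmeasurable_real; exact: (measurableT_comp (@measurable_ln R) m2).
apply: (@eq_cmeasurable _ _ _ _ (fun u : RR => cintegral mu setT (fun x => h (u, x)))).
  move=> u /Pp u0; rewrite /T -(cintegral_mkcond mu (p := fun x : RR => 0 < x) _ Pp).
  apply: eq_cintegral => x _; rewrite /h /= u0 /=; case: ifPn => [x0|_]; last by [].
  rewrite lgmE// cReD cReR cReM cReR cImR mulr0 subr0 ltr_wpDl// mulr_ge0// ltW//.
apply: (cmeasurableS (E := setT)) => //; exact: cmeasurable_cintegral_param.
Qed.

Let series_integrandE u : 0 < u ->
  series_integrand alpha beta f s u = f u * ((cGamma alpha)^-1 * T u).
Proof.
move=> u0; rewrite /series_integrand csum_series_term// -/(T u) cexpN -!mulrA.
by congr (_ * _); rewrite !mulrA mulfV ?cexp_neq0// mul1r.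
Qed.

(** The substitution [t = u + y] turns the section at [u] into the Laplace
    integral, whose contour is then rotated. *)
Let section_integral u : 0 < u -> cintegrable mu setT (fun t => J (t, u)) ->
  Y u = f u * (cpow beta (- alpha - s + 1) * T u).
Proof.
move=> u0 iJu.
pose jl (y : RR) : R[i] := if 0 < y then laplace_integrand alpha beta s u y else 0.
have Jl t : J (t, u) = f u * jl (t - u).
  rewrite /J /jl /tri /= u0 /= subr_gt0; case: ifP => [ut|]; last by rewrite mulr0.
  have e : u + (t - u) = t by rewrite addrC subrK.
  rewrite /f0 u0 /kern /laplace_integrand e mulrA -cexpD mulrC.
  by congr (f u * cexp _); ring.
have [fu|fu] := eqVneq (f u) 0.
  rewrite fu mul0r -(cintegral0 mu setT); apply: eq_cintegral => t _.
  by rewrite Jl fu mul0r.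
have mla : cmeasurable P (laplace_integrand alpha beta s u).
  apply: cmeasurable_halfline => y y0.
  have uy : 0 < u + y by exact: addr_gt0.
  have d1 := is_deriveD_fun (is_derive_cst u y 1) (is_derive_id y 1).
  have d2 := is_cderive_real (is_derive_comp_fun d1 (is_derive1_ln uy)).
  eexists; apply: is_cderive_cexp; apply: is_cderiveB; last first.
    exact: is_cderiveZ (is_cderive_id y).
  apply: is_cderiveD; last exact: is_cderiveZ d2.
  exact: is_cderiveZ (is_cderive_ln y0).
have mjl : cmeasurable setT jl by exact: cmeasurable_mkcond mP Pp mla.
have ijl : cintegrable mu setT jl.
  apply: (cintegrable_translate (u := u)) => //.
  have i2 := cintegrableZ (f u)^-1 mTT iJu.
  apply: (eq_cintegrable mTT _ i2) => t _.
  by rewrite Jl; exact: mulKf fu _.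
have YE : Y u = f u * cintegral mu setT jl.
  rewrite /Y (eq_cintegral mu (g := fun t => f u * jl (t - u))) => [|t _]; last exact: Jl.
  rewrite cintegralZ ?(cintegral_translate _ mjl)//.
  have i2 := cintegrableZ (f u)^-1 mTT iJu.
  apply: (eq_cintegrable mTT _ i2) => t _.
  by rewrite Jl; exact: mulKf fu _.
have il : cintegrable mu P (laplace_integrand alpha beta s u).
  exact/(cintegrable_mkcond mu _ mP Pp).
rewrite YE; congr (_ * _); rewrite (cintegral_mkcond mu _ Pp).
have [kappa [k1 k2 ik]] : exists kappa, [/\ kappa <= Re beta, kappa <= 1 &
    mu.-integrable P (EFin \o (fun r => expR ((Re alpha - 1) * ln r + (Re s - 1) * ln (u + r) - kappa * r)))].
  (* on the imaginary axis there is no decay to spare: the only dominating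
     function available is the modulus of the integrand itself *)
  have [b0|b0] := ltP 0 (Re beta).
    exists (Num.min (Re beta) 1); split; rewrite ?ge_min ?lexx ?orbT//.
    by apply: integrable_power_exp; rewrite ?lt_min ?b0 ?ltr01//; have := alpha0; lra.
  exists (Re beta); split=> //; first by rewrite (le_trans b0).
  apply: eq_integrable (integrable_cmod mP il) => // y _ /=.
  by rewrite cmod_cexp !creE; congr (_%:E); congr expR; ring.
by rewrite (laplace_rotation alpha0 beta_ge0 beta0 u0 k1 k2 ik).
Qed.

Let series_part :
  cintegrable mu P (series_integrand alpha beta f s) /\
  (cGamma alpha)^-1 * cintegral mu setT Y = cpow beta (- alpha - s + 1) *
    cintegral mu P (series_integrand alpha beta f s).
Proof.
have [_ aeY _ iY _] := cFubini iJ.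
set k := cpow beta _; have k0 : k != 0 by rewrite /k cpowE// cexp_neq0.
have iYP : cintegrable mu P Y.
  by case: iY => r i; split; [exact: integrableS measurableT mP (@subsetT _ P) r|exact: integrableS measurableT mP (@subsetT _ P) i].
have mS : cmeasurable P (series_integrand alpha beta f s).
  apply: (@eq_cmeasurable _ _ _ _ (fun u : RR => f u * ((cGamma alpha)^-1 * T u))).
    by move=> u /Pp u0; rewrite series_integrandE.
  apply: cmeasurableM; first exact: cintegrable_measurable hfP.
  by apply: cmeasurableM mT; exact: cmeasurable_cst.
have iGY : cintegrable mu P (fun u => (cGamma alpha)^-1 * k^-1 * Y u) by exact: cintegrableZ.
have aeE : {ae mu, forall u, P u -> series_integrand alpha beta f s u =
    (cGamma alpha)^-1 * k^-1 * Y u}.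
  apply: filterS aeY => u it /Pp u0; rewrite series_integrandE// section_integral//.
  rewrite -/k mulrACA; set g := (cGamma alpha)^-1.
  have -> : g * f u * (k^-1 * (k * T u)) = f u * (g * T u) * (k^-1 * k) by ring.
  by rewrite mulVf// mulr1.
have eP : cintegral mu P Y = cintegral mu setT Y.
  rewrite -(cintegral_mkcond mu (p := fun u : RR => 0 < u) Y Pp).
  apply: eq_cintegral => u _; case: ifPn => [_|u0]; first by [].
  rewrite -(cintegral0 mu setT); apply: eq_cintegral => t _.
  by rewrite /J /tri /= (negbTE u0).
have [iS ->] := ae_eq_cintegral mP mS iGY aeE.
split; first exact: iS.
rewrite (cintegralZ ((cGamma alpha)^-1 * k^-1) mP iYP) eP.
by rewrite mulrA mulrCA mulfV// mulr1.
Qed.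

Lemma mellin_tempered_series :
  [/\ cintegrable mu `[0, +oo[ (mellin_integrand (tempered_integral alpha beta f) s),
      cintegrable mu `[0, +oo[ (series_integrand alpha beta f s) &
      mellin (tempered_integral alpha beta f) s = cpow beta (- alpha - s + 1) *
        cintegral mu `[0, +oo[ (series_integrand alpha beta f s)].
Proof.
have [iM eM] := mellin_part; have [iS eS] := series_part.
have mM := cintegrable_measurable iM; have mS := cintegrable_measurable iS.
split; [exact: cintegrable_itv_cy|exact: cintegrable_itv_cy|].
by rewrite /mellin !cintegral_itv_cy// eM eS.
Qed.
End MellinTempered.

Theorem theorem2p15 (R : realType) (f : R -> R[i]) (alpha beta s : R[i])
  (hf : cintegrable (@lebesgue_measure R) `[0, +oo[ f)
  (halpha : 0 < complex.Re alpha)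
  (hbeta : 0 <= complex.Re beta) (hbeta0 : beta != 0)
  (hs : (0 < complex.Re beta /\
         1 - complex.Re alpha < complex.Re s <= 1) \/
        mellin_tempered_abs_conv alpha beta f s) :
  [/\ cintegrable (@lebesgue_measure R) `[0, +oo[
        (mellin_integrand (tempered_integral alpha beta f) s),
      forall u : R, 0 < u -> csummable (series_term alpha beta s u),
      cintegrable (@lebesgue_measure R) `[0, +oo[
        (series_integrand alpha beta f s)
    & mellin (tempered_integral alpha beta f) s =
      cpow beta (- alpha - s + 1) *
      cintegral (@lebesgue_measure R) `[0, +oo[
        (series_integrand alpha beta f s)].
Proof.
have [iM iS e] := mellin_tempered_series hf halpha hbeta hbeta0 hs.
by split=> // u u0; exact: csummable_series_term.
Qed.
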